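(* Let $\alpha\in(-\infty,1)$, $p,q\in[1,\infty)$, and $\gamma\in[q,\infty)$ with $\frac1\gamma=\frac1p+\frac1n$. Then $\dot W^{1,\gamma}(\mathbb{R}^n)\subset JNQ^{\alpha}_{p,q}(\mathbb{R}^n)$ and there exists a positive constant $C$ such that, for any $f\in\dot W^{1,\gamma}(\mathbb{R}^n)$, $$\|f\|_{JNQ^{\alpha}_{p,q}(\mathbb{R}^n)}\le C\|f\|_{\dot W^{1,\gamma}(\mathbb{R}^n)}.$$
   Context: Here $n\in\mathbb{N}$, $n\ge1$. A measurable function $f$ on $\mathbb{R}^n$ is a Lebesgue measurable function with $|f|<\infty$ almost everywhere. A cube has finite positive edge length and all its edges parallel to the coordinate axes, and need not be open or closed. For $\ell\in(0,\infty)$, $\Pi_\ell$ is the class of all collections $\{Q_j\}_j$ of cubes of $\mathbb{R}^n$ with pairwise disjoint interiors and equal edge length $\ell$. The space $JNQ^{\alpha}_{p,q}(\mathbb{R}^n)$ is the set of all measurable $f$ on $\mathbb{R}^n$ with $$\|f\|_{JNQ^\alpha_{p,q}(\mathbb{R}^n)}:=\sup_{\ell\in(0,\infty),\,\{Q_j\}_j\in\Pi_\ell}\Big\{\sum_j|Q_j|\Big[|Q_j|^{\frac{q\alpha}{n}-1}\int_{Q_j}\int_{Q_j}\frac{|f(x)-f(y)|^q}{|x-y|^{n+q\alpha}}\,dy\,dx\Big]^{p/q}\Big\}^{1/p}<\infty.$$ $\dot W^{1,\gamma}(\mathbb{R}^n)$ is the set of all weakly differentiable functions $f$ on $\mathbb{R}^n$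 with $\|f\|_{\dot W^{1,\gamma}(\mathbb{R}^n)}:=\big[\int_{\mathbb{R}^n}|\nabla f(x)|^\gamma\,dx\big]^{1/\gamma}<\infty$. *)

(* Defs.v *)
From HB Require Import structures.
From mathcomp Require Import all_boot all_order all_algebra.
From mathcomp Require Import all_classical all_reals all_analysis.
From mathcomp Require Import measurable_realfun.

Set Implicit Arguments.
Unset Strict Implicit.
Unset Printing Implicit Defensive.

Import Order.TTheory GRing.Theory Num.Theory.
Import numFieldNormedType.Exports.

Local Open Scope classical_set_scope.
Local Open Scope ring_scope.

(* The Euclidean space R^n with n >= 1 is 'rV[R]_m.+1, i.e. n = m.+1.
   Its topology is the usual one, but its library norm is the max norm;
   Euclidean distances are written with [enorm]. *)

Section lebesgue_measure_rV.
Context {R : realType} {m : nat}.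
Implicit Types (A : set 'rV[R]_m.+1) (p : 'rV[R]_m.+1 * 'rV[R]_m.+1).
Implicit Types B : nat -> 'rV[R]_m.+1 * 'rV[R]_m.+1.

Definition box p : set 'rV[R]_m.+1 :=
  [set x | forall i, p.1 ord0 i < x ord0 i <= p.2 ord0 i].

Definition box_volume p : R := \prod_i (p.2 ord0 i - p.1 ord0 i).

Definition box_cover A :=
  [set B : nat -> 'rV[R]_m.+1 * 'rV[R]_m.+1 |
           (forall k i, (B k).1 ord0 i <= (B k).2 ord0 i) /\
           A `<=` \bigcup_k box (B k)].

Definition lebesgue_outer A : \bar R :=
  ereal_inf [set (\sum_(k <oo) (box_volume (B k))%:E)%E | B in box_cover A].

Local Lemma box_volume_ge0 A B k : box_cover A B ->
  (0 <= (box_volume (B k))%:E)%E.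
Proof.
by move=> [le_B _]; rewrite lee_fin; apply: prodr_ge0 => i _; rewrite subr_ge0.
Qed.

Local Lemma lebesgue_outer_ge0 A : (0 <= lebesgue_outer A)%E.
Proof.
apply: le_ereal_inf_tmp => _ [B cB <-]; apply: nneseries_ge0 => k _ _.
exact: box_volume_ge0 cB.
Qed.

Local Lemma lebesgue_outer0 : lebesgue_outer set0 = 0%E.
Proof.
apply/eqP; rewrite eq_le lebesgue_outer_ge0 andbT.
apply: ereal_inf_lbound; exists (fun=> (0, 0)); first by split.
rewrite eseries0// => k _ _.
by rewrite /box_volume big_ord_recl subrr mul0r.
Qed.

Local Lemma le_lebesgue_outer :
  {homo lebesgue_outer : A A' / A `<=` A' >-> (A <= A')%E}.
Proof.
move=> A A' AA'; apply/ereal_inf_le_tmp => _ [B [le_B A'B] <-].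
by exists B => //; split => //; exact: subset_trans A'B.
Qed.

Local Lemma lebesgue_outer_sigma_subadditive :
  sigma_subadditive lebesgue_outer.
Proof.
move=> A; have [[i ioo]|] := pselect (exists i, lebesgue_outer (A i) = +oo%E).
  rewrite (eseries_pinfty _ _ ioo) ?leey// => n _.
  by rewrite -ltNye (lt_le_trans _ (lebesgue_outer_ge0 _)).
rewrite -forallNE => Aoo.
suff add2e (e : {posnum R}) : (lebesgue_outer (\bigcup_n A n) <=
    \sum_(i <oo) lebesgue_outer (A i) + e%:num%:E)%E.
  by apply/lee_addgt0Pr => _/posnumP[].
rewrite (le_trans _ (epsilon_trick _ _ _))//; last first.
  by move=> n; exact: lebesgue_outer_ge0.
pose P n B := box_cover (A n) B /\ (\sum_(k <oo) (box_volume (B k))%:E <=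
  lebesgue_outer (A n) + (e%:num / (2 ^ n.+1)%:R)%:E)%E.
have [G PG] : {G & forall n, P n (G n)}.
  apply: (@choice _ _ P) => n; rewrite /P /lebesgue_outer.
  set S := (X in ereal_inf X); move infS : (ereal_inf S) => iS.
  case: iS infS => [r Sr|Soo|Soo].
  - have en1 : (0 < e%:num / (2 ^ n.+1)%:R) by [].
    have /(lb_ereal_inf_adherent en1) : ereal_inf S \is a fin_num by rewrite Sr.
    move=> [x [B cB muBx] xS].
    by exists B; split => //; rewrite muBx -Sr; exact/ltW.
  - by have := Aoo n; rewrite /lebesgue_outer Soo.
  - by have := lebesgue_outer_ge0 (A n); rewrite /lebesgue_outer -/S Soo.
pose vol (ij : nat * nat) := (box_volume (G ij.1 ij.2))%:E.
have vol_ge0 ij : (0 <= vol ij)%E by exact: box_volume_ge0 (PG _).1.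
apply: (@le_trans _ _ (\esum_(ij in setT) vol ij)).
  apply: ereal_inf_lbound => /=.
  have /card_esym/ppcard_eqP[f] := card_nat2.
  exists (uncurry G \o f).
    split => [k i|].
      by rewrite /= /uncurry; case: (f k) => a b /=; exact: (PG a).1.1.
    move=> t [i _] /(PG i).1.2 [j _ Bijt].
    by exists (f^-1%FUN (i, j)) => //=; rewrite invK ?inE.
  rewrite (eq_eseriesr (g := vol \o f)); last first.
    by move=> k _; rewrite /vol /=; case: (f k).
  rewrite -(esum_pred_image vol _ xpredT) ?[fun=> _]set_true//.
  by rewrite image_eq.
rewrite (_ : esum _ _ = \sum_(i <oo) \sum_(j <oo) vol (i, j))%E; last first.
  pose J : nat -> set (nat * nat) := fun i => [set (i, j) | j in setT].
  rewrite (_ : setT = \bigcup_k J k); last first.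
    by rewrite predeqE => -[a b]; split => // _; exists a => //; exists b.
  rewrite esum_bigcupT /=; last 2 first.
    - apply/trivIsetP => i j _ _ ij.
      rewrite predeqE => -[n k] /=; split => //= -[] [_] _ [<-{n} _].
      by move=> [k' _] [] /esym/eqP; rewrite (negbTE ij).
    - by move=> ij; exact: vol_ge0.
  rewrite -(image_id [set: nat]) -fun_true esum_pred_image//; last first.
    by move=> n _; exact: esum_ge0.
  apply: eq_eseriesr => /= j _.
  rewrite -(esum_pred_image vol (pair j) predT)//=; last first.
    by move=> ? ? _ _; exact: (@can_inj _ _ _ snd).
  by congr esum; rewrite predeqE => -[a b]; split; move=> [i _ <-]; exists i.
apply: lee_nneseries => [i _ _|i _]; last exact: (PG i).2.
by apply: nneseries_ge0 => j _ _; exact: vol_ge0.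
Qed.

HB.instance Definition _ := isOuterMeasure.Build R 'rV[R]_m.+1 lebesgue_outer
  lebesgue_outer0 lebesgue_outer_ge0 le_lebesgue_outer
  lebesgue_outer_sigma_subadditive.

End lebesgue_measure_rV.

(* R^n with the sigma-algebra of Lebesgue (i.e. Caratheodory) measurable sets *)
Definition lebesgue_rV (R : realType) (m : nat) : Type :=
  caratheodory_type (@lebesgue_outer R m).

HB.instance Definition _ (R : realType) (m : nat) :=
  Measurable.copy (lebesgue_rV R m) (caratheodory_type (@lebesgue_outer R m)).

Definition lebesgue_measure_rV {R : realType} {m : nat} :
  set (lebesgue_rV R m) -> \bar R := @lebesgue_outer R m.

HB.instance Definition _ (R : realType) (m : nat) := isMeasure.Build _ _ _
  (@lebesgue_measure_rV R m)
  (@caratheodory_measure0 _ _ (@lebesgue_outer R m))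
  (@caratheodory_measure_ge0 _ _ (@lebesgue_outer R m))
  (@caratheodory_measure_sigma_additive _ _ (@lebesgue_outer R m)).

Section function_spaces.
Context {R : realType} {m : nat}.
Local Notation Rn := (lebesgue_rV R m).
Local Notation mu := (@lebesgue_measure_rV R m).
Implicit Types (f : 'rV[R]_m.+1 -> \bar R) (g : 'rV[R]_m.+1 -> 'rV[R]_m.+1).
Implicit Types (phi : 'rV[R]_m.+1 -> R) (Q : set 'rV[R]_m.+1).

Definition enorm (x : 'rV[R]_m.+1) : R := Num.sqrt (\sum_i x ord0 i ^+ 2).

Definition lebesgue_measurable f : Prop :=
  measurable_fun [set: Rn] (f : Rn -> \bar R) /\
  {ae mu, forall x : Rn, (`|f x| < +oo)%E}.

(* [Interval (BSide b a) (BSide b' c)] has endpoints a and c; b = true (resp.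
   b' = false) means that a (resp. c) belongs to it. *)
Definition is_cube (l : R) Q : Prop :=
  0 < l /\ exists (a : 'rV[R]_m.+1) (b b' : 'I_m.+1 -> bool),
    Q = [set x | forall i, x ord0 i \in
           Interval (BSide (b i) (a ord0 i)) (BSide (b' i) (a ord0 i + l))].

(* Cubes with pairwise disjoint interiors are distinct, so that a collection
   {Q_j}_j in Pi_l is faithfully represented by the set of its members. *)
Definition cube_collection (l : R) (P : set (set 'rV[R]_m.+1)) : Prop :=
  (forall Q, P Q -> is_cube l Q) /\
  (forall Q Q', P Q -> P Q' -> Q <> Q' -> Q° `&` Q'° = set0).

Local Open Scope ereal_scope.
Local Notation "x `^ r" := (poweR x r) : ereal_scope.

(* The conventions in force where the integrand degenerates (x = y, or f
   infinite at x or y) only concern null sets. *)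
Definition JNQ_local (alpha q : R) f Q : \bar R :=
  mu Q `^ (q * alpha / m.+1%:R - 1) *
  \int[mu]_(x in (Q : set Rn)) \int[mu]_(y in (Q : set Rn))
    (`|f x - f y| `^ q *
     ((powR (enorm (x - y)) (m.+1%:R + q * alpha))^-1)%:E).

Definition JNQ_norm (alpha p q : R) f : \bar R :=
  ereal_sup [set s | exists (l : R) (P : set (set 'rV[R]_m.+1)),
    [/\ (0 < l)%R, cube_collection l P &
     s = (\esum_(Q in P) mu Q * JNQ_local alpha q f Q `^ (p / q))
           `^ p^-1]].

Definition JNQ (alpha p q : R) : set ('rV[R]_m.+1 -> \bar R) :=
  [set f | lebesgue_measurable f /\ JNQ_norm alpha p q f < +oo].

Definition iter_partial (s : seq 'I_m.+1) phi : 'rV[R]_m.+1 -> R :=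
  foldr (fun i (h : 'rV[R]_m.+1 -> R) x => 'D_(delta_mx ord0 i) h x) phi s.

Definition test_function phi : Prop :=
  (forall s, continuous (iter_partial s phi) /\
     forall i x, derivable (iter_partial s phi) x (delta_mx ord0 i)) /\
  compact (closure [set x | phi x != 0%R]).

Definition locally_integrable_rV f : Prop :=
  measurable_fun [set: Rn] (f : Rn -> \bar R) /\
  forall K : set 'rV[R]_m.+1, compact K ->
    mu.-integrable (K : set Rn) (f : Rn -> \bar R).

Definition is_weak_gradient f g : Prop :=
  (forall i, locally_integrable_rV (fun x => (g x ord0 i)%:E)) /\
  forall i phi, test_function phi ->
    \int[mu]_(x in [set: Rn]) (f x * ('D_(delta_mx ord0 i) phi x)%:E) =
    - \int[mu]_(x in [set: Rn]) (g x ord0 i * phi x)%:E.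

Definition weakly_differentiable f : Prop :=
  locally_integrable_rV f /\ exists g, is_weak_gradient f g.

(* A weak gradient is unique up to a null set; this picks one when it exists. *)
Definition weak_gradient f : 'rV[R]_m.+1 -> 'rV[R]_m.+1 :=
  xget (fun=> 0%R) [set g | is_weak_gradient f g].

Definition dotW1_norm (gamma : R) f : \bar R :=
  (\int[mu]_(x in [set: Rn]) (powR (enorm (weak_gradient f x)) gamma)%:E)
    `^ gamma^-1.

Definition dotW1 (gamma : R) : set ('rV[R]_m.+1 -> \bar R) :=
  [set f | weakly_differentiable f /\ dotW1_norm gamma f < +oo].

End function_spaces.

Arguments JNQ_norm {R m} alpha p q f.
Arguments JNQ {R} m alpha p q.
Arguments dotW1_norm {R m} gamma f.
Arguments dotW1 {R} m gamma.

(* Main.v *)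
Require Import Defs.
From HB Require Import structures.
From mathcomp Require Import all_boot all_order all_algebra.
From mathcomp Require Import all_classical all_reals all_analysis.
From mathcomp Require Import measurable_realfun ring lra.

Set Implicit Arguments.
Unset Strict Implicit.
Unset Printing Implicit Defensive.

Import Order.TTheory GRing.Theory Num.Theory.
Import numFieldNormedType.Exports.

Local Open Scope classical_set_scope.
Local Open Scope ring_scope.

(** The argument is local: on one cube Q of edge l, fractional differences are
    bounded by the gradient, with a constant whose power of l is exactly the one
    that makes the sum over cubes scale invariant.

    Along a coordinate axis, the difference f(x + s e_j) - f(x) is the integral
    of the weak partial derivative over the segment, for almost every x
    ([difference_formula]).  Both sides are compared by testing them against
    bumps: translating a bump and integrating its derivative moves the
    difference quotient onto the weak derivative, and the lemma of
    du Bois-Reymond concludes.  The bumps are products of the functions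
    exp(- c / ((t - a) (b - t))); the products of such an exponential with
    rational functions are stable under differentiation, hence smooth, and the
    bumps tend to the indicator of a box as c tends to 0.

    Jensen's inequality and the invariance by translation then bound the L^q norm
    of f(x + s e_j) - f(x), over the x such that both points are in Q, by |s|
    times the L^q norm on Q of the partial derivative.  An arbitrary increment z
    is decomposed into its coordinates: the path from x to x + z that follows the
    axes stays in Q when its end points are in Q, so that, up to a constant, |z|
    times the sum of the norms of the partial derivatives is a bound
    ([path_difference]).  Integrating against |z|^-(n + q alpha) over the
    increments of Q leaves the integral of |z|^(q (1 - alpha) - n), which is at
    most a constant times l^(q (1 - alpha)) because alpha < 1
    ([kernel_integral_le]).

    Hoelder's inequality replaces q by gamma, at the cost of a power of |Q|, and
    the relation between gamma, p and n says that all powers of l cancel in the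
    term of Q: it is at most K T_Q^(p / gamma), where T_Q is the integral of
    |grad f|^gamma over Q ([cube_term_le]).  As p / gamma = 1 + p / n is at least
    1 and the cubes have disjoint interiors, these terms sum to at most
    K T^(p / gamma), where T is the integral over the whole space; taking the
    p-th root gives the theorem.

    Translations, Fubini's theorem and generation by boxes are best handled on
    the Borel sigma-algebra.  So f and its weak gradient are replaced by Borel
    functions equal to them off Borel null sets ([borel_modification]), which
    changes neither the integrals nor the integration by parts. *)

(** * Outer measure, half-spaces and affine maps *)

Section geometry.
Context {R : realType} {m : nat}.
Local Notation V := 'rV[R]_m.+1.
Local Notation outer := (@lebesgue_outer R m).
Implicit Types (x z a b : V) (A : set V).

Definition set_coord (x : V) (j : 'I_m.+1) (t : R) : V :=
  \row_i (if i == j then t else x ord0 i).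

Lemma box_volume_split (p : V * V) j t :
  box_volume p = box_volume (p.1, set_coord p.2 j t) +
                 box_volume (set_coord p.1 j t, p.2).
Proof.
rewrite /box_volume (bigD1 j)//= [in RHS](bigD1 j)//= mxE eqxx.
rewrite [X in _ = _ + X](bigD1 j)//= mxE eqxx.
set P1 := \prod_(i < m.+1 | _) _.
have <- : P1 = \prod_(i < m.+1 | i != j)
    (set_coord p.2 j t ord0 i - p.1 ord0 i).
  by apply: eq_bigr => i ij; rewrite !mxE (negbTE ij).
have <- : P1 = \prod_(i < m.+1 | i != j)
    (p.2 ord0 i - set_coord p.1 j t ord0 i).
  by apply: eq_bigr => i ij; rewrite !mxE (negbTE ij).
by rewrite -mulrDl; congr (_ * _); ring.
Qed.

Lemma box_volume_pos (p : V * V) :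
  (forall i, p.1 ord0 i <= p.2 ord0 i) -> (0 <= (box_volume p)%:E)%E.
Proof.
by move=> le_p; rewrite lee_fin; apply: prodr_ge0 => i _; rewrite subr_ge0.
Qed.

(** A hyperplane orthogonal to an axis cuts every box of a cover into two boxes
    whose volumes add up, so half-spaces satisfy the Caratheodory criterion. *)
Lemma halfspace_caratheodory j t :
  outer.-caratheodory [set x : V | x ord0 j <= t].
Proof.
apply: le_caratheodory_measurable => X.
apply: le_ereal_inf_tmp => _ [B [le_B XB] <-].
(* clamping t to the j-th side keeps both halves of a box nondegenerate *)
pose c k := Num.max ((B k).1 ord0 j) (Num.min ((B k).2 ord0 j) t).
have c1 k : (B k).1 ord0 j <= c k by rewrite le_max lexx.
have c2 k : c k <= (B k).2 ord0 j by rewrite ge_max le_B ge_min lexx.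
pose B1 k := ((B k).1, set_coord (B k).2 j (c k)).
pose B2 k := (set_coord (B k).1 j (c k), (B k).2).
have le_B1 k i : (B1 k).1 ord0 i <= (B1 k).2 ord0 i.
  by rewrite /= mxE; case: eqP => // ->.
have le_B2 k i : (B2 k).1 ord0 i <= (B2 k).2 ord0 i.
  by rewrite /= mxE; case: eqP => // ->.
have -> : (\sum_(k <oo) (box_volume (B k))%:E =
  \sum_(k <oo) (box_volume (B1 k))%:E + \sum_(k <oo) (box_volume (B2 k))%:E)%E.
  rewrite -nneseriesD//; last 2 first.
    by move=> k _ _; exact: box_volume_pos.
    by move=> k _ _; exact: box_volume_pos.
  by apply: eq_eseriesr => k _; rewrite -EFinD -box_volume_split.
apply: leeD; apply: ereal_inf_lbound.
- exists B1 => //; split => // x [/XB[k _ Bkx] xt]; exists k => // i.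
  rewrite /= mxE; have /andP[lo hi] := Bkx i.
  case: eqP => [ij|_]; last by rewrite lo.
  by subst i; rewrite lo/= /c le_max le_min hi [x ord0 j <= t]xt orbT.
- exists B2 => //; split => // x [/XB[k _ Bkx] /negP]; rewrite -ltNge => xt.
  exists k => // i; rewrite /= mxE; have /andP[lo hi] := Bkx i.
  case: eqP => [ij|_]; last by rewrite lo.
  by subst i; rewrite hi andbT /c gt_max lo gt_min xt orbT.
Qed.

Lemma outer_box_le (p : V * V) : (forall i, p.1 ord0 i <= p.2 ord0 i) ->
  (outer (box p) <= (box_volume p)%:E)%E.
Proof.
move=> le_p; apply: ereal_inf_lbound.
exists (fun k : nat => if k == 0%N then p else (0, 0)).
  split=> [k i|x px]; first by case: ifP.
  by exists 0%N.
rewrite (@nneseriesD1 _ _ 0%N)//=; last first.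
  by move=> k _; apply: box_volume_pos => i; case: ifP.
rewrite eseries0 ?adde0// => k _ /negbTE ->.
by rewrite /box_volume big_ord_recl subrr mul0r.
Qed.

Definition affine (r : R) (z x : V) : V := r *: x + z.

(** The inverse of the map takes a cover by boxes to a cover by boxes, and
    divides every volume by r ^ n. *)
Lemma outer_affine_le r z A : 0 < r ->
  ((r ^+ m.+1)%:E * outer (affine r z @^-1` A) <= outer A)%E.
Proof.
move=> r0; apply: le_ereal_inf_tmp => _ [B [le_B AB] <-].
pose f x : V := r^-1 *: (x - z).
pose B' k := (f (B k).1, f (B k).2).
have le_B' k i : (B' k).1 ord0 i <= (B' k).2 ord0 i.
  by rewrite /= !mxE ler_pM2l ?invr_gt0// lerD2r.
have vol k : box_volume (B k) = r ^+ m.+1 * box_volume (B' k).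
  rewrite /box_volume -[in X in r ^+ X * _](card_ord m.+1) -prodr_const.
  rewrite -big_split/=; apply: eq_bigr => i _; rewrite !mxE.
  by field; rewrite gt_eqF.
have -> : (\sum_(k <oo) (box_volume (B k))%:E =
    (r ^+ m.+1)%:E * \sum_(k <oo) (box_volume (B' k))%:E)%E.
  rewrite -nneseriesZl; first by apply: eq_eseriesr => k _; rewrite vol EFinM.
  by move=> k _; exact: box_volume_pos.
rewrite lee_pmul2l ?fin_numE// ?lte_fin ?exprn_gt0//.
apply: ereal_inf_lbound; exists B' => //; split => // x /AB[k _ Bkx].
exists k => // i; have := Bkx i; rewrite /affine !mxE => /andP[lo hi].
by rewrite mulrC ltr_pdivrMr// ltrBlDr mulrC lo mulrC ler_pdivlMr// lerBrDr mulrC.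
Qed.

(** The inequality above for the inverse map is the converse one. *)
Lemma outer_affine r z A : 0 < r ->
  ((r ^+ m.+1)%:E * outer (affine r z @^-1` A) = outer A)%E.
Proof.
move=> r0; apply/eqP; rewrite eq_le outer_affine_le//=.
have r0' : 0 < r^-1 by rewrite invr_gt0.
have := @outer_affine_le r^-1 (- (r^-1 *: z)) (affine r z @^-1` A) r0'.
rewrite (_ : _ @^-1` _ = A); last first.
  rewrite -comp_preimage (_ : _ \o _ = id)// funeqE => x /=.
  by rewrite /affine scalerDr scalerN !scalerA divff ?gt_eqF// !scale1r subrK.
rewrite -(@lee_pmul2l _ (r ^+ m.+1)%:E)// ?lte_fin ?exprn_gt0//.
by rewrite muleA -EFinM -exprMn divff ?gt_eqF// expr1n mul1e.
Qed.

Lemma outer_translation z A : outer ((fun x => x + z) @^-1` A) = outer A.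
Proof.
rewrite -(@outer_affine 1 z A ltr01) expr1n mul1e; congr outer.
by apply/seteqP; split => x /=; rewrite /affine scale1r.
Qed.

End geometry.

(** * Borel sets of the Euclidean space *)

Section borel.
Context {R : realType} {m : nat}.
Local Notation V := 'rV[R]_m.+1.
Implicit Types (a b z : V).

Definition open_box a b : set V :=
  [set x | forall i, a ord0 i < x ord0 i < b ord0 i].

Definition open_boxes : set (set V) := [set A | exists a b, A = open_box a b].

End borel.

(** The same space, with the sigma-algebra generated by the open boxes: unlike
    the Lebesgue one, it makes a map measurable as soon as its coordinates are,
    on products as well. *)
Definition borel_rV (R : realType) (m : nat) : Type :=
  g_sigma_algebraType (@open_boxes R m).

HB.instance Definition _ (R : realType) (m : nat) :=
  Measurable.copy (borel_rV R m) (g_sigma_algebraType (@open_boxes R m)).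

Section borel_measurability.
Context {R : realType} {m : nat}.
Local Notation V := 'rV[R]_m.+1.
Local Notation Bn := (borel_rV R m).
Local Notation Ln := (lebesgue_rV R m).
Local Notation outer := (@lebesgue_outer R m).
Implicit Types (a b z : V).

Lemma measurable_open_box a b : measurable (open_box a b : set Bn).
Proof. by apply: sub_sigma_algebra; exists a, b. Qed.

Lemma open_boxI a b a' b' : open_box a b `&` open_box a' b' =
  open_box (\row_i Num.max (a ord0 i) (a' ord0 i))
           (\row_i Num.min (b ord0 i) (b' ord0 i)).
Proof.
apply/seteqP; split=> x.
  move=> [xab xab'] i; rewrite !mxE gt_max lt_min.
  by have /andP[-> ->] := xab i; have /andP[-> ->] := xab' i.
move=> h; split=> i; have := h i; rewrite !mxE gt_max lt_min.
  by move=> /andP[/andP[-> _] /andP[-> _]].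
by move=> /andP[/andP[_ ->] /andP[_ ->]].
Qed.

Lemma setI_closed_open_boxes : setI_closed (@open_boxes R m).
Proof. by move=> _ _ [a [b ->]] [a' [b' ->]]; rewrite open_boxI; do 2!eexists. Qed.

Definition cbox (k : nat) : set V :=
  open_box (const_mx (- k%:R)) (const_mx k%:R).

Lemma bigcup_cbox : \bigcup_k cbox k = [set: V].
Proof.
apply/seteqP; split => // x _.
pose M := \sum_i `|x ord0 i|.
exists (Num.truncn M).+1 => // i; rewrite !mxE -ltr_norml.
apply: le_lt_trans (truncnS_gt _).
by rewrite /M (bigD1 i)//= lerDl sumr_ge0.
Qed.

Lemma measurable_coord_borel i : measurable_fun [set: Bn] (fun x : Bn => (x : V) ord0 i).
Proof.
apply: (measurability _ (RGenOInfty.measurableE R)) => // _ [_ [t ->] <-].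
rewrite setTI.
have -> : (fun x : Bn => (x : V) ord0 i) @^-1` `]t, +oo[ =
  \bigcup_k open_box (\row_j if j == i then t else - k%:R) (const_mx k%:R).
  apply/seteqP; split => x.
    rewrite /= in_itv/= andbT => tx.
    have [k _ xk] : (\bigcup_k cbox k) x by rewrite bigcup_cbox.
    exists k => // j; rewrite !mxE; have := xk j; rewrite !mxE => /andP[lo ->].
    by case: eqP => [->|_]; rewrite andbT.
  move=> [k _ /(_ i)]; rewrite !mxE eqxx => /andP[tx _].
  by rewrite /= in_itv/= andbT.
by apply: bigcupT_measurable => k; exact: measurable_open_box.
Qed.

Lemma measurable_fun_rV d (T : measurableType d) (h : T -> V) :
  (forall i, measurable_fun setT (fun t => h t ord0 i)) ->
  measurable_fun setT (h : T -> Bn).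
Proof.
move=> mh; apply: (@measurability _ _ _ Bn _ _ open_boxes) => //.
move=> _ [_ [a [b ->]] <-]; rewrite setTI.
have -> : h @^-1` open_box a b = \bigcap_(i in [set: 'I_m.+1])
    ((fun t => h t ord0 i) @^-1` `]a ord0 i, b ord0 i[).
  apply/seteqP; split => t /=.
    by move=> ht i _ /=; rewrite in_itv/=; exact: ht.
  by move=> ht i; have := ht i I; rewrite /= in_itv.
apply: fin_bigcap_measurable => //.
move=> i _; rewrite -[X in measurable X]setTI; apply: mh => //.
Qed.

Lemma measurable_coord_lebesgue i :
  measurable_fun [set: Ln] (fun x : Ln => (x : V) ord0 i).
Proof.
apply: (measurability _ (RGenOInfty.measurableE R)) => // _ [_ [t ->] <-].
rewrite setTI (_ : _ @^-1` _ = ~` [set x : V | x ord0 i <= t]).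
  apply: (@measurableC _ Ln); exact: halfspace_caratheodory.
by apply/seteqP; split => x; rewrite /= in_itv/= andbT ltNge => /negP.
Qed.

(** This presents the Borel measure as the image of the Lebesgue measure, whence
    the comparison of integrals. *)
Lemma measurable_id_borel : measurable_fun [set: Ln] (id : Ln -> Bn).
Proof. by apply: measurable_fun_rV => i; exact: measurable_coord_lebesgue. Qed.

Lemma borel_lebesgue (A : set V) :
  measurable (A : set Bn) -> measurable (A : set Ln).
Proof.
by move=> mA; rewrite -[A : set Ln](setTI (A : set Ln)); exact: measurable_id_borel.
Qed.

Lemma measurable_addrV z : measurable_fun [set: Bn] ((fun x : V => x + z) : Bn -> Bn).
Proof.
apply: measurable_fun_rV => i.
under eq_fun do rewrite mxE.
by apply: measurable_funD => //; exact: measurable_coord_borel.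
Qed.

(** Every open set is the countable union of the rational open boxes it
    contains. *)
Lemma open_measurable_borel (U : set V) : open U -> measurable (U : set Bn).
Proof.
move=> oU.
pose rv (r : 'rV[rat]_m.+1) : V := map_mx (@ratr R) r.
pose F (r : 'rV[rat]_m.+1 * 'rV[rat]_m.+1) : set V :=
  if pselect (open_box (rv r.1) (rv r.2) `<=` U)
  then open_box (rv r.1) (rv r.2) else set0.
have -> : U = \bigcup_r F r.
  apply/seteqP; split => [x Ux|x [r _]]; last first.
    by rewrite /F; case: pselect => // sub; exact: sub.
  have [P Px PU] : nbhs x U by move: oU; rewrite openE => /(_ _ Ux).
  have H i : exists ab : rat * rat, ratr ab.1 < x ord0 i < ratr ab.2 /\
      (forall t, ratr ab.1 < t < ratr ab.2 -> P ord0 i t).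
    have [e e0 eP] := Px ord0 i.
    have := @rat_in_itvoo R (x ord0 i - e) (x ord0 i).
    rewrite ltrBlDr ltrDl => /(_ e0)[r1]; rewrite in_itv/= => /andP[r1l r1r].
    have := @rat_in_itvoo R (x ord0 i) (x ord0 i + e).
    rewrite ltrDl => /(_ e0)[r2]; rewrite in_itv/= => /andP[r2l r2r].
    exists (r1, r2); split => /=; first by rewrite r1r.
    move=> t /andP[t1 t2]; apply: eP => /=; rewrite ltr_distlC.
    by rewrite (lt_trans r1l t1) (lt_trans t2 r2r).
  have [f Hf] := choice H.
  exists (\row_i (f i).1, \row_i (f i).2) => //.
  rewrite /F; case: pselect => [_ i|[]]/=; first by rewrite !mxE; exact: (Hf i).1.
  move=> y yab; apply: PU => i j; rewrite (ord1 i).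
  by apply: (Hf j).2; have := yab j; rewrite !mxE.
apply: (@countable_bigcupT_measurable _ Bn); first exact: countableP.
move=> r; rewrite /F; case: pselect => ?; [exact: measurable_open_box|exact: measurable0].
Qed.

Lemma continuous_measurable_borel (h : V -> R) : continuous h ->
  measurable_fun [set: Bn] (h : Bn -> R).
Proof.
move=> /continuousP ch.
apply: (measurability _ (RGenOpens.measurableE R)) => // _ [_ [s [t ->]] <-].
rewrite setTI; apply: open_measurable_borel; apply: ch; exact: itv_open.
Qed.

Definition borel_mu : set Bn -> \bar R := outer.

Let borel_mu0 : borel_mu set0 = 0%E.
Proof. exact: (measure0 (@lebesgue_measure_rV R m)). Qed.

Let borel_mu_ge0 A : (0 <= borel_mu A)%E.
Proof. exact: outer_measure_ge0. Qed.

Let borel_mu_sigma_additive : semi_sigma_additive borel_mu.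
Proof.
move=> F mF tF mUF; apply: (@measure_semi_sigma_additive _ _ _ (@lebesgue_measure_rV R m)) => //.
  by move=> k; exact: borel_lebesgue.
exact: borel_lebesgue.
Qed.

HB.instance Definition _ := isMeasure.Build _ _ _ borel_mu
  borel_mu0 borel_mu_ge0 borel_mu_sigma_additive.

Lemma borel_mu_cbox k : (borel_mu (cbox k) < +oo)%E.
Proof.
apply: (@le_lt_trans _ _ (box_volume (const_mx (- k%:R), const_mx k%:R : V))%:E).
  apply: le_trans (outer_box_le _); last first.
    by move=> i; rewrite /= !mxE; rewrite (@le_trans _ _ 0)// oppr_le0.
  by apply: le_outer_measure => x xk i; have /andP[-> /ltW->] := xk i.
by rewrite ltry.
Qed.

Let borel_mu_sigma_finite : sigma_finite [set: Bn] borel_mu.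
Proof.
exists cbox; first by rewrite bigcup_cbox.
move=> k; split; [exact: measurable_open_box|exact: borel_mu_cbox].
Qed.

HB.instance Definition _ := Measure_isSigmaFinite.Build _ _ _ borel_mu
  borel_mu_sigma_finite.

End borel_measurability.

(** * Measure of cubes *)

Section cubes.
Context {R : realType} {m : nat}.
Local Notation V := 'rV[R]_m.+1.
Local Notation Bn := (borel_rV R m).
Local Notation Ln := (lebesgue_rV R m).
Local Notation outer := (@lebesgue_outer R m).
Local Notation bmu := (@borel_mu R m).
Implicit Types (a b z : V) (l : R).

(** Translations and dilations determine the measure of all cubes up to this
    factor. *)
Definition unit_mass : R := fine (outer (box (0, const_mx 1))).

Lemma unit_massE : unit_mass%:E = outer (box (0, const_mx 1)).
Proof.
rewrite /unit_mass fineK// ge0_fin_numE ?outer_measure_ge0//.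
apply: (@le_lt_trans _ _ (box_volume (0, const_mx 1 : V))%:E); last by rewrite ltry.
by apply: outer_box_le => i; rewrite /= !mxE.
Qed.

Lemma unit_mass_ge0 : 0 <= unit_mass.
Proof. by rewrite -lee_fin unit_massE outer_measure_ge0. Qed.

Lemma unit_mass_le1 : unit_mass <= 1.
Proof.
rewrite -lee_fin unit_massE; apply: le_trans (outer_box_le _) _.
  by move=> i; rewrite /= !mxE.
by rewrite lee_fin /box_volume big1// => i _; rewrite !mxE subr0.
Qed.

Lemma outer_half_open_cube a l : 0 < l ->
  outer (box (a, a + const_mx l)) = (unit_mass * l ^+ m.+1)%:E.
Proof.
move=> l0; have l0' : 0 < l^-1 by rewrite invr_gt0.
have := outer_affine (- (l^-1 *: a)) (box (0, const_mx 1)) l0'.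
rewrite -unit_massE (_ : _ @^-1` _ = box (a, a + const_mx l)); last first.
  apply/seteqP; split => x xab i; have := xab i;
    by rewrite /affine !mxE -mulrBr mulrC pmulr_lgt0// ler_pdivrMr// mul1r;
       rewrite subr_gt0 lerBlDl.
move=> /(congr1 (fun y => (l ^+ m.+1)%:E * y)%E).
rewrite muleA -EFinM -exprMn divff ?gt_eqF// expr1n mul1e => ->.
by rewrite -EFinM mulrC.
Qed.

Lemma cube_sandwich l Q : is_cube l Q -> exists a,
  open_box a (a + const_mx l) `<=` Q /\
  forall x, Q x -> forall i, a ord0 i <= x ord0 i <= a ord0 i + l.
Proof.
move=> [l0 [a [b [b' ->]]]]; exists a; split => x /= xQ i; have := xQ i.
  by rewrite !mxE !in_itv/= => /andP[? ?]; rewrite !lteifS.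
by rewrite in_itv/= => /andP[/lteifW -> /lteifW ->].
Qed.

Lemma is_cube_open_box a l : 0 < l -> is_cube l (open_box a (a + const_mx l)).
Proof.
move=> l0; split => //; exists a, (fun=> false), (fun=> true).
by apply/seteqP; split => x h i; have := h i; rewrite !mxE in_itv.
Qed.

Lemma measurable_coordwise (S : 'I_m.+1 -> set R) :
  (forall i, measurable (S i)) ->
  measurable ([set x : V | forall i, S i (x ord0 i)] : set Bn).
Proof.
move=> mS.
have -> : [set x : V | forall i, S i (x ord0 i)] =
    \bigcap_(i in [set: 'I_m.+1]) ((fun x : V => x ord0 i) @^-1` S i).
  by apply/seteqP; split => x /= h i; [move=> _ /=|]; apply: h.
apply: (@fin_bigcap_measurable _ Bn) => // i _.
by rewrite -[X in measurable X](@setTI Bn); exact: measurable_coord_borel.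
Qed.

Lemma measurable_cube l Q : is_cube l Q -> measurable (Q : set Bn).
Proof.
move=> [l0 [a [b [b' ->]]]].
by apply: (@measurable_coordwise (fun i =>
  [set` Interval (BSide (b i) (a ord0 i)) (BSide (b' i) (a ord0 i + l))])).
Qed.

(** Squeezing a cube between half-open ones of edges l - 2e and l + 2e shows
    that its faces are negligible. *)
Lemma borel_mu_cube l Q : is_cube l Q -> bmu Q = (unit_mass * l ^+ m.+1)%:E.
Proof.
move=> cQ; have l0 : 0 < l by case: cQ.
have [a [aQ Qa]] := cube_sandwich cQ.
have lo e : 0 < e < l / 2 -> ((unit_mass * (l - 2 * e) ^+ m.+1)%:E <= bmu Q)%E.
  move=> /andP[e0 el].
  rewrite -(@outer_half_open_cube (a + const_mx e)); last by lra.
  apply: le_outer_measure => x xe; apply: aQ => i; have := xe i.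
  by rewrite /= !mxE => /andP[? ?]; apply/andP; split; lra.
have hi e : 0 < e -> (bmu Q <= (unit_mass * (l + 2 * e) ^+ m.+1)%:E)%E.
  move=> e0; rewrite -(@outer_half_open_cube (a - const_mx e)); last by lra.
  apply: le_outer_measure => x /Qa xe i; have := xe i.
  by rewrite /= !mxE => /andP[? ?]; apply/andP; split; lra.
have fQ : bmu Q \is a fin_num.
  rewrite ge0_fin_numE//; exact: le_lt_trans (hi 1 ltr01) (ltry _).
rewrite -(fineK fQ); congr (_%:E).
have cv (s : R) : (fun e : R => unit_mass * (l + s * e) ^+ m.+1) @ 0^'+ -->
    unit_mass * l ^+ m.+1.
  apply: cvg_at_right_filter.
  have -> : l ^+ m.+1 = (l + s * 0) ^+ m.+1 by rewrite mulr0 addr0.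
  apply: cvgM; first exact: cvg_cst.
  apply: (@cvg_comp _ _ _ (fun e => l + s * e) (fun y => y ^+ m.+1) _
    (nbhs (l + s * 0))); last exact: exprn_continuous.
  by apply: cvgD; [exact: cvg_cst|apply: cvgM; [exact: cvg_cst|exact: cvg_id]].
apply/eqP; rewrite eq_le; apply/andP; split.
  apply: (cvgr_to_ge (cv 2)); near=> e.
  by rewrite -lee_fin fineK//; apply: hi; near: e; exact: nbhs_right_gt.
apply: (cvgr_to_le (cv (-2))); near=> e.
rewrite -lee_fin fineK// mulNr; apply: lo; apply/andP; split; near: e.
  exact: nbhs_right_gt.
by apply: nbhs_right_lt; lra.
Unshelve. all: by end_near. Qed.

Lemma borel_mu_cubeD l Q a : is_cube l Q -> open_box a (a + const_mx l) `<=` Q ->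
  bmu (Q `\` open_box a (a + const_mx l)) = 0%E.
Proof.
move=> cQ aQ; have l0 : 0 < l by case: cQ.
have cO := is_cube_open_box a l0.
rewrite measureD//; first by rewrite setIidr// [X in (X - _)%E](borel_mu_cube cQ)
  [X in (_ - X)%E](borel_mu_cube cO) subee.
- exact: measurable_cube cQ.
- exact: measurable_cube cO.
- by rewrite [X in (X < _)%E](borel_mu_cube cQ) ltry.
Qed.

End cubes.

(** * Borel modifications of Lebesgue measurable functions *)

Section borel_modification.
Context {R : realType} {m : nat}.
Local Notation V := 'rV[R]_m.+1.
Local Notation Bn := (borel_rV R m).
Local Notation Ln := (lebesgue_rV R m).
Local Notation outer := (@lebesgue_outer R m).
Local Notation bmu := (@borel_mu R m).
Local Notation mu := (@lebesgue_measure_rV R m).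

Lemma measurable_box (p : V * V) : measurable (box p : set Bn).
Proof.
have -> : box p = [set x : V | forall i, `]p.1 ord0 i, p.2 ord0 i]%classic (x ord0 i)].
  by apply/seteqP; split => x /= h i; have := h i; rewrite /= in_itv.
exact: (@measurable_coordwise _ _ (fun i => `]p.1 ord0 i, p.2 ord0 i]%classic)).
Qed.

(** Intersecting the unions of covers whose total volumes approach the outer
    measure. *)
Lemma borel_hull (A : set V) : exists B : set V,
  [/\ measurable (B : set Bn), A `<=` B & bmu B = outer A].
Proof.
have [fA|] := boolP (outer A \is a fin_num); last first.
  rewrite ge0_fin_numE ?outer_measure_ge0// -leNgt leye_eq => /eqP Aoo.
  exists setT; split => //.
  by apply/eqP; rewrite eq_le [X in (_ <= X)%E]Aoo leey/=; apply: le_outer_measure.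
have H (k : nat) : exists B : set V, [/\ measurable (B : set Bn), A `<=` B &
    (bmu B <= outer A + (k.+1%:R^-1)%:E)%E].
  have k0 : 0 < k.+1%:R^-1 :> R by rewrite invr_gt0.
  have [_ [B [le_B AB] <-] Bk] := lb_ereal_inf_adherent k0 fA.
  exists (\bigcup_k box (B k)); split => //.
    by apply: (@bigcup_measurable _ Bn) => j _; exact: measurable_box.
  apply: le_trans (ltW Bk); apply: le_trans (outer_measure_sigma_subadditive _ _) _.
  apply: lee_nneseries => [j _ _|j _]; first exact: outer_measure_ge0.
  exact: outer_box_le.
have [B HB] := choice H; exists (\bigcap_k B k).
have mB : measurable (\bigcap_k B k : set Bn).
  by apply: (@bigcap_measurable _ Bn) => // k _; have [] := HB k.
have AB : A `<=` \bigcap_k B k by move=> x Ax k _; have [_ + _] := HB k; exact.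
split => //; apply/eqP; rewrite eq_le; apply/andP; split; last exact: le_outer_measure.
apply/lee_addgt0Pr => e e0.
have [k ke] : exists k : nat, k.+1%:R^-1 < e.
  exists (Num.truncn e^-1); rewrite invf_plt ?posrE//; exact: truncnS_gt.
apply: (@le_trans _ _ (bmu (B k))); first by apply: (@le_outer_measure _ _ outer); exact: bigcap_inf.
by have [_ _ /le_trans] := HB k; apply; rewrite leeD2l// lee_fin ltW.
Qed.

Lemma null_borel_hull (A : set V) : outer A = 0%E -> exists B : set V,
  [/\ measurable (B : set Bn), A `<=` B & bmu B = 0%E].
Proof. by move=> A0; have [B [mB AB BA]] := borel_hull A; exists B; rewrite BA. Qed.

(** Each bounded piece of a Lebesgue measurable set has a Borel hull of the
    same measure, so that the difference is null. *)
Lemma borel_off_null (A : set V) : measurable (A : set Ln) -> exists Z : set V,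
  [/\ measurable (Z : set Bn), bmu Z = 0%E & measurable (A `\` Z : set Bn)].
Proof.
move=> mA.
have mc k : measurable (cbox k : set Bn) by exact: measurable_open_box.
have H (k : nat) : exists BZ : set V * set V,
   [/\ measurable (BZ.1 : set Bn), measurable (BZ.2 : set Bn), bmu BZ.2 = 0%E,
     A `&` cbox k `<=` BZ.1 & BZ.1 `\` (A `&` cbox k) `<=` BZ.2].
  have [B [mB AB BA]] := borel_hull (A `&` cbox k).
  have mAk : measurable (A `&` cbox k : set Ln).
    by apply: measurableI => //; exact: borel_lebesgue.
  have : mu (B `\` (A `&` cbox k)) = 0%E.
    have fA : (mu (A `&` cbox k) < +oo)%E.
      apply: le_lt_trans (borel_mu_cbox k); apply: le_outer_measure.
      exact: subIsetr.
    rewrite measureD//; last 2 first.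
      exact: borel_lebesgue.
      by rewrite [X in (X < _)%E]BA.
    by rewrite setIidr// [X in (X - _)%E]BA subee// ge0_fin_numE// outer_measure_ge0.
  by move=> /null_borel_hull[Z [mZ BZ Z0]]; exists (B, Z).
have [F HF] := choice H.
exists (\bigcup_k (F k).2).
have mZ : measurable (\bigcup_k (F k).2 : set Bn).
  by apply: (@bigcup_measurable _ Bn) => k _; have [] := HF k.
split => //.
- apply/eqP; rewrite eq_le measure_ge0 andbT.
  apply: le_trans (outer_measure_sigma_subadditive _ _) _.
  by rewrite eseries0// => k _ _; have [] := HF k.
- rewrite (_ : _ `\` _ = (\bigcup_k (F k).1) `\` (\bigcup_k (F k).2)).
    apply: (@measurableD _ Bn) => //.
    by apply: (@bigcup_measurable _ Bn) => k _; have [] := HF k.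
  apply/seteqP; split => x [+ xZ].
    move=> Ax; split => //.
    have [k _ xk] : (\bigcup_k cbox k) x by rewrite bigcup_cbox.
    by exists k => //; have [_ _ _ + _] := HF k; apply.
  move=> [k _ xk]; split => //; apply: contrapT => nAx; apply: xZ; exists k => //.
  by have [_ _ _ _] := HF k; apply; split => // -[].
Qed.

Lemma outer_bigcup0 (T : countType) (W : T -> set V) :
  (forall t, outer (W t) = 0%E) -> outer (\bigcup_t W t) = 0%E.
Proof.
move=> W0; pose U k : set V := oapp W set0 (unpickle k).
have sub : \bigcup_t W t `<=` \bigcup_k U k.
  by move=> x [t _ Wx]; exists (pickle t) => //; rewrite /U pickleK.
apply/eqP; rewrite eq_le outer_measure_ge0 andbT.
apply: le_trans (le_outer_measure outer _ _ sub) _.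
apply: le_trans (outer_measure_sigma_subadditive _ _) _.
rewrite eseries0// => k _ _; rewrite /U.
by case: unpickle => /= [t|]; [exact: W0|exact: outer_measure0].
Qed.

(** Discarding a null set that makes all the superlevel sets at rational levels
    Borel turns f into a Borel function. *)
Lemma borel_modification (f : V -> \bar R) :
  measurable_fun [set: Ln] (f : Ln -> \bar R) ->
  {ae mu, forall x : Ln, (`|f x| < +oo)%E} ->
  exists (F : V -> R) (Z : set V), [/\ measurable_fun [set: Bn] (F : Bn -> R),
    measurable (Z : set Bn), bmu Z = 0%E & forall x, ~ Z x -> f x = (F x)%:E].
Proof.
move=> mf [N [mN N0 fN]].
have [Z0 [mZ0 NZ0 Z00]] := null_borel_hull N0.
pose A (r : rat) : set V := [set x | ((ratr r)%:E < f x)%E].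
have H r : exists Z : set V, [/\ measurable (Z : set Bn), bmu Z = 0%E &
    measurable (A r `\` Z : set Bn)].
  apply: borel_off_null; rewrite -[X in measurable X](@setTI Ln).
  exact: emeasurable_fun_o_infty.
have [W HW] := choice H.
have mW : measurable (\bigcup_r W r : set Bn).
  by apply: (@bigcupT_measurable_rat _ Bn) => r; have [] := HW r.
pose Z := Z0 `|` \bigcup_r W r.
have mZ : measurable (Z : set Bn) by exact: (@measurableU _ Bn).
have fin x : ~ Z x -> f x \is a fin_num.
  move=> nZ; apply: contrapT => foo; apply: nZ; left.
  by apply: NZ0; apply: fN => /= foo'; apply: foo; rewrite fin_num_abs.
pose F x : R := if pselect (Z x) then 0 else fine (f x).
exists F, Z; split => //.
- apply: (measurability _ (RGenOInfty.measurableE R)) => // _ [_ [t ->] <-].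
  rewrite setTI.
  pose C r := if (t < ratr r) then A r `\` Z else set0.
  have -> : F @^-1` `]t, +oo[ = \bigcup_r C r `|` (if t < 0 then Z else set0).
    apply/seteqP; split => x /=.
      rewrite in_itv/= andbT /F; case: pselect => [Zx t0|nZx tf].
        by right; rewrite t0.
      left; have := rat_in_itvoo tf => -[r]; rewrite in_itv/= => /andP[tr rf].
      exists r => //; rewrite /C tr; split => //; rewrite /A/=.
      by rewrite -(fineK (fin _ nZx)) lte_fin.
    rewrite in_itv/= andbT /F; case => [[r _]|].
      rewrite /C; case: ifPn => // tr [Ax nZx]; case: pselect => // ?.
      by apply: lt_trans tr _; rewrite -lte_fin fineK//; exact: fin.
    by case: ifPn => // t0 Zx; case: pselect.
  apply: (@measurableU _ Bn); last by case: ifP.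
  apply: (@bigcupT_measurable_rat _ Bn) => r; rewrite /C; case: ifP => // _.
  rewrite (_ : _ `\` _ = (A r `\` W r) `\` Z).
    by apply: (@measurableD _ Bn) => //; have [] := HW r.
  apply/seteqP; split => x [] => [Ax nZ|[]//].
  by split => //; split => // Wx; apply: nZ; right; exists r.
- rewrite /Z; apply/eqP; rewrite eq_le measure_ge0 andbT.
  apply: le_trans (measureU2 _ _ _) _ => //.
  rewrite [X in (X + _)%E]Z00 add0e -[X in (_ <= X)%E](@outer_bigcup0 _ W)//.
  by move=> r; have [] := HW r.
- by move=> x nZx; rewrite /F; case: pselect => // ?; rewrite fineK//; exact: fin.
Qed.

End borel_modification.

(** * Bump functions of one variable *)

Section bump1.
Context {R : realType}.
Implicit Types (a b c t : R) (P : {poly R}) (k : nat).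

Definition gap a b : {poly R} := ('X - a%:P) * (b%:P - 'X).

Lemma horner_gap a b t : (gap a b).[t] = (t - a) * (b - t).
Proof. by rewrite /gap !hornerE. Qed.

Lemma gap_gt0 a b t : a < t < b -> 0 < (gap a b).[t].
Proof. by move=> /andP[at_ tb]; rewrite horner_gap mulr_gt0// subr_gt0. Qed.

(** The general element of a class closed under differentiation, which gives the
    smoothness of the bumps in one step: P u^-k exp(- c / u) on the interval, u
    being the gap. *)
Definition bump1 a b c P k t : R :=
  if a < t < b then P.[t] * (gap a b).[t]^-1 ^+ k * expR (- c * (gap a b).[t]^-1)
  else 0.

(** The numerator of the derivative of P u^-k exp(- c / u) over u^(k+2). *)
Definition bump1_deriv a b c P k : {poly R} :=
  P^`() * gap a b ^+ 2 - k%:R *: (P * (gap a b)^`() * gap a b)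
    + c *: (P * (gap a b)^`()).

Lemma bump1_out a b c P k t : ~~ (a < t < b) -> bump1 a b c P k t = 0.
Proof. by rewrite /bump1 => /negbTE ->. Qed.

Lemma expR_ge_powdiv (y : R) n : 0 <= y -> (y / n.+1%:R) ^+ n.+1 <= expR y.
Proof.
move=> y0; rewrite -[in leRHS](divfK (_ : n.+1%:R != 0 :> R) y)// expRM_natr.
have yn0 : 0 <= y / n.+1%:R by rewrite divr_ge0.
rewrite lerXn2r ?nnegrE ?expR_ge0//.
by apply: le_trans (expR_ge1Dx _); rewrite lerDr.
Qed.

(** The exponential beats every power of 1/gap, which makes the function vanish
    to second order at the end points. *)
Lemma bump1_bound a b c P k : 0 < c -> exists2 M, 0 < M &
  forall t, a < t < b -> `|bump1 a b c P k t| <= M * (gap a b).[t] ^+ 2.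
Proof.
move=> c0; have [ab|ba] := ltP a b; last first.
  by exists 1 => // t /andP[at_ tb]; move: (lt_trans at_ tb); rewrite ltNge ba.
have [M0 M0P] : exists M0, forall t, t \in `[a, b] -> `|P.[t]| <= M0.
  have cP : {within `[a, b], continuous (fun t => `|P.[t]|)}.
    apply: continuous_subspaceT => t; apply: (@continuous_comp _ _ _ (horner P)).
      exact: continuous_horner.
    exact: norm_continuous.
  by have [x xab xP] := EVT_max (ltW ab) cP; exists `|P.[x]|.
have M00 : 0 <= M0.
  by apply: le_trans (M0P a _) => //; rewrite in_itv/= lexx ltW.
pose N := k.+1.
exists ((M0 + 1) * (N.+1%:R / c) ^+ N.+1).
  by rewrite mulr_gt0 ?exprn_gt0 ?divr_gt0// ltr_wpDl.
move=> t tab; rewrite /bump1 tab; set u := (gap a b).[t].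
have u0 : 0 < u by exact: gap_gt0.
rewrite !normrM (ger0_norm (expR_ge0 _)) normrX.
rewrite (@ger0_norm _ u^-1) ?invr_ge0 ?(ltW u0)//.
have E : expR (- c * u^-1) <= (N.+1%:R / c * u) ^+ N.+1.
  have -> : (N.+1%:R / c * u) ^+ N.+1 = ((c / u / N.+1%:R) ^+ N.+1)^-1.
    by rewrite -exprVn; congr (_ ^+ _); field; rewrite ?gt_eqF// nat1r pnatr_eq0.
  rewrite mulNr expRN lef_pV2 ?posrE ?expR_gt0//; last first.
    by rewrite exprn_gt0// !divr_gt0.
  by apply: expR_ge_powdiv; rewrite divr_ge0// ltW.
have Pt : `|P.[t]| <= M0 + 1.
  apply: le_trans (M0P t _) _; last by rewrite lerDl.
  by rewrite in_itv/=; case/andP: tab => /ltW -> /ltW ->.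
have uk0 : 0 <= u^-1 ^+ k by rewrite exprn_ge0// invr_ge0 ltW.
rewrite -mulrA -[leRHS]mulrA; apply: ler_pM => //.
  by rewrite mulr_ge0// expR_ge0.
apply: (@le_trans _ _ (u^-1 ^+ k * (N.+1%:R / c * u) ^+ N.+1)).
  by rewrite ler_wpM2l.
rewrite exprMn mulrCA ler_wpM2l ?exprn_ge0 ?divr_ge0 ?(ltW c0)//.
rewrite /N -addn2 exprD exprVn mulKf//.
by rewrite expf_neq0// gt_eqF.
Qed.

(** Outside the open interval, end points included, the derivative is 0 by the
    quadratic bound. *)
Lemma is_derive_bump1 a b c P k t : 0 < c ->
  is_derive t (1 : R) (bump1 a b c P k)
    (bump1 a b c (bump1_deriv a b c P k) k.+2 t).
Proof.
move=> c0; have [tab|tab] := boolP (a < t < b).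
  have u0 : (gap a b).[t] != 0 by rewrite gt_eqF// gap_gt0.
  pose w : R -> R := fun y => (gap a b).[y]^-1.
  pose f : R -> R := horner P * w ^+ k * (expR \o (- c \*: w)).
  apply: (@near_eq_is_derive _ _ _ f).
    near=> y; have : y \in `]a, b[ by near: y; exact: near_in_itvoo.
    by rewrite in_itv/= /bump1 /f !fctE => ->.
  have dw : is_derive t (1 : R) w (- (gap a b).[t] ^- 2 *: (gap a b)^`().[t]).
    exact: is_deriveV.
  apply: is_derive_eq.
  rewrite /bump1 tab !fctE /bump1_deriv; clear f; rewrite /w; clear dw w.
  move: (gap a b) u0 => U; rewrite !(hornerD, hornerN, hornerM, hornerZ, horner_exp).
  rewrite /GRing.scale/=; set u := U.[t] => u0; set u' := U^`().[t].
  set e := expR _; rewrite -exprVn -[k.+2]addn2 exprD.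
  have -> : k%:R * u^-1 ^+ k.-1 = k%:R * (u^-1 ^+ k * u).
    case: k => [|k]; first by rewrite !mul0r.
    by rewrite [X in _ = _ * (X * _)]exprSr divfK.
  by set wk := u^-1 ^+ k; field.
rewrite bump1_out//.
have [M M0 MP] := bump1_bound a b P k c0.
have bt : bump1 a b c P k t = 0 by rewrite bump1_out.
have ab0 y : `|bump1 a b c P k y| <= M * (b - a) ^+ 2 * `|y - t| ^+ 2.
  have [yab|yab] := boolP (a < y < b); last first.
    rewrite bump1_out// normr0 mulr_ge0 ?exprn_ge0//.
    by rewrite mulr_ge0 ?(ltW M0)// sqr_ge0.
  apply: le_trans (MP _ yab) _; rewrite -mulrA ler_wpM2l ?(ltW M0)//.
  rewrite -exprMn lerXn2r ?nnegrE ?(ltW (gap_gt0 yab))//.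
    by rewrite mulr_ge0// subr_ge0; case/andP: yab => h1 h2; rewrite ltW// (lt_trans h1 h2).
  rewrite horner_gap; case/andP: yab => ya yb.
  move: tab; rewrite negb_and -!leNgt => /orP[ta|tb].
    rewrite ger0_norm ?subr_ge0; last by lra.
    rewrite mulrC; apply: ler_pM; lra.
  rewrite ler0_norm ?subr_le0; last by lra.
  by apply: ler_pM; lra.
set K := M * (b - a) ^+ 2 in ab0.
have K0 : 0 <= K by rewrite mulr_ge0 ?(ltW M0)// sqr_ge0.
have cv : (fun h : R => h^-1 *: ((bump1 a b c P k \o shift t) (h *: (1 : R)) -
    bump1 a b c P k t)) @ 0^' --> (0 : R).
  apply/cvgr0Pnorm_le => e e0; near=> h.
  rewrite bt subr0 /= [h *: _]mulr1 [_ *: _]mulrC normrM normfV.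
  have h0 : 0 < `|h| by rewrite normr_gt0; near: h; exact: nbhs_dnbhs_neq.
  rewrite ler_pdivrMr//; apply: le_trans (ab0 _) _.
  rewrite addrK expr2 mulrA ler_wpM2r ?(ltW h0)//.
  have : `|h| <= e / (K + 1).
    near: h; apply: dnbhs0_le.
    by rewrite divr_gt0// ltr_wpDl.
  rewrite ler_pdivlMr ?ltr_wpDl// => H; apply: le_trans H.
  by rewrite mulrC ler_wpM2l ?(ltW h0)// lerDl.
apply: DeriveDef; first by apply/cvg_ex; exists 0.
by apply/cvg_lim.
Unshelve. all: by end_near. Qed.

Lemma continuous_bump1 a b c P k : 0 < c -> continuous (bump1 a b c P k).
Proof.
move=> c0 t; apply/differentiable_continuous/derivable1_diffP.
by case: (is_derive_bump1 a b P k t c0).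
Qed.

End bump1.

(** * Bump functions on boxes *)

Section closed_box.
Context {R : realType} {m : nat}.
Local Notation V := 'rV[R]_m.+1.
Implicit Types (a b : V).

Definition closed_box a b : set V :=
  [set x | forall i, a ord0 i <= x ord0 i <= b ord0 i].

Lemma compact_closed_box a b : compact (closed_box a b).
Proof.
have := @rV_compact _ _ (fun i => `[a ord0 i, b ord0 i]%classic)
  (fun i => @segment_compact _ _ _).
congr (compact _); apply/seteqP; split => x /= h i; have := h i;
  by rewrite ?in_itv/= ?in_itv.
Qed.

Lemma measurable_closed_box a b : measurable (closed_box a b : set (borel_rV R m)).
Proof.
have -> : closed_box a b = [set x | forall i, `[a ord0 i, b ord0 i]%classic (x ord0 i)].
  by apply/seteqP; split => x /= h i; have := h i; rewrite /= in_itv.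
exact: (@measurable_coordwise _ _ (fun i => `[a ord0 i, b ord0 i]%classic)).
Qed.

End closed_box.

Section tensor_bump.
Context {R : realType} {m : nat}.
Local Notation V := 'rV[R]_m.+1.
Local Notation I := 'I_m.+1.
Implicit Types (a b x z : V) (c t : R) (P : I -> {poly R}) (k : I -> nat).
Local Notation e_ j := (delta_mx ord0 j : V).

Definition tensor_bump a b c P k x : R :=
  \prod_i bump1 (a ord0 i) (b ord0 i) c (P i) (k i) (x ord0 i).

Definition tensor_slice a b c P k j x : R :=
  \prod_(i < m.+1 | i != j) bump1 (a ord0 i) (b ord0 i) c (P i) (k i) (x ord0 i).

Definition deriv_poly a b c P k j : I -> {poly R} :=
  fun i => if i == j then bump1_deriv (a ord0 i) (b ord0 i) c (P i) (k i) else P i.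

Definition deriv_exp k j : I -> nat := fun i => if i == j then (k i).+2 else k i.

Lemma addZeE x t i j : (x + t *: e_ j) ord0 i = x ord0 i + (if i == j then t else 0).
Proof. by rewrite !mxE eqxx/=; case: eqP => _; rewrite ?mulr1 ?mulr0. Qed.

Lemma tensor_bump_line a b c P k j x t : tensor_bump a b c P k (x + t *: e_ j) =
  tensor_slice a b c P k j x *
  bump1 (a ord0 j) (b ord0 j) c (P j) (k j) (x ord0 j + t).
Proof.
rewrite /tensor_bump (bigD1 j)//= addZeE eqxx mulrC; congr (_ * _).
by apply: eq_bigr => i /negbTE ij; rewrite addZeE ij addr0.
Qed.

Lemma tensor_bump_derivE a b c P k j x :
  tensor_bump a b c (deriv_poly a b c P k j) (deriv_exp k j) x =
  tensor_slice a b c P k j x * bump1 (a ord0 j) (b ord0 j) c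
    (bump1_deriv (a ord0 j) (b ord0 j) c (P j) (k j)) (k j).+2 (x ord0 j).
Proof.
rewrite -[x in LHS]addr0 -(scale0r (e_ j)) tensor_bump_line addr0.
rewrite /deriv_poly /deriv_exp eqxx; congr (_ * _).
by apply: eq_bigr => i /negbTE ij; rewrite ij.
Qed.

Lemma is_derive_line a b c P k j x : 0 < c ->
  is_derive (0 : R) (1 : R) (fun t => tensor_bump a b c P k (x + t *: e_ j))
    (tensor_bump a b c (deriv_poly a b c P k j) (deriv_exp k j) x).
Proof.
move=> c0; rewrite tensor_bump_derivE.
under eq_fun do rewrite tensor_bump_line.
set C := tensor_slice _ _ _ _ _ _ _; set f := bump1 _ _ _ _ _.
have df : is_derive (x ord0 j + 0) 1 f (bump1 (a ord0 j) (b ord0 j) c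
    (bump1_deriv (a ord0 j) (b ord0 j) c (P j) (k j)) (k j).+2 (x ord0 j + 0)).
  exact: is_derive_bump1.
have dg : is_derive (0 : R) (1 : R) (fun t => x ord0 j + t) 1.
  rewrite [X in is_derive _ _ X](_ : _ = cst (x ord0 j) + id)//.
  by apply: is_derive_eq; rewrite add0r.
have := @is_derive1_comp _ f (fun t => x ord0 j + t) 0 _ _ df dg.
rewrite mulr1 addr0 => dfg.
exact: is_deriveZ.
Qed.

Lemma is_derive_tensor_bump a b c P k j x : 0 < c ->
  is_derive x (e_ j) (tensor_bump a b c P k)
    (tensor_bump a b c (deriv_poly a b c P k j) (deriv_exp k j) x).
Proof.
move=> c0; have [dl vl] := is_derive_line a b P k j x c0.
have E : (fun h : R => h^-1 *: ((tensor_bump a b c P k \o shift x) (h *: e_ j) -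
    tensor_bump a b c P k x)) = (fun h => h^-1 *:
    (((fun t => tensor_bump a b c P k (x + t *: e_ j)) \o shift 0) (h *: (1 : R)) -
     tensor_bump a b c P k (x + 0 *: e_ j))).
  apply/funext => h; congr (_ *: (_ - _)) => /=; last by rewrite scale0r addr0.
  by rewrite addr0 [h *: 1]mulr1 addrC.
by apply: DeriveDef; rewrite /derivable /derive E.
Qed.

Lemma derive_tensor_bump a b c P k j x : 0 < c ->
  'D_(e_ j) (tensor_bump a b c P k) x =
  tensor_bump a b c (deriv_poly a b c P k j) (deriv_exp k j) x.
Proof. by move=> c0; have [] := is_derive_tensor_bump a b P k j x c0. Qed.

Lemma continuous_tensor_bump a b c P k : 0 < c -> continuous (tensor_bump a b c P k).
Proof.
move=> c0; apply: (@continuous_big R I *%R 1 predT (@mul_continuous R) V _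
  (fun i (x : V) => bump1 (a ord0 i) (b ord0 i) c (P i) (k i) (x ord0 i))) => i _ x.
 apply: (@continuous_comp _ _ _ (fun x : V => x ord0 i)).
  exact: coord_continuous.
exact: continuous_bump1.
Qed.

Lemma tensor_bump_out a b c P k x : ~ open_box a b x -> tensor_bump a b c P k x = 0.
Proof.
move=> /existsNP[i /negP xi]; rewrite /tensor_bump (bigD1 i)//=.
by rewrite bump1_out// mul0r.
Qed.

Lemma test_function_tensor_bump a b c P k : 0 < c ->
  test_function (tensor_bump a b c P k).
Proof.
move=> c0; split.
  move=> s; have [P' [k' ->]] : exists P' k',
      iter_partial s (tensor_bump a b c P k) = tensor_bump a b c P' k'.
    elim: s => [|i s [P' [k' IH]]]; first by exists P, k.
    exists (deriv_poly a b c P' k' i), (deriv_exp k' i).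
    by apply/funext => x; rewrite /= IH derive_tensor_bump.
  split; first exact: continuous_tensor_bump.
  by move=> i x; have [] := is_derive_tensor_bump a b P' k' i x c0.
apply: (@subclosed_compact _ _ (closed_box a b)).
- exact: closed_closure.
- exact: compact_closed_box.
- have cl : closed (closed_box a b).
    by apply: compact_closed; [exact: norm_hausdorff|exact: compact_closed_box].
  rewrite [X in _ `<=` X](closure_id _).1//; apply: closureS => x /= fx.
  have abx : open_box a b x.
    by apply: contrapT => /(@tensor_bump_out a b c P k); exact/eqP.
  by move=> i; have /andP[/ltW -> /ltW ->] := abx i.
Qed.

Lemma tensor_bump_bounded a b c P k : 0 < c ->
  exists2 M, 0 <= M & forall x, `|tensor_bump a b c P k x| <= M.
Proof.
move=> c0.
have H i : exists M, forall t,
    `|bump1 (a ord0 i) (b ord0 i) c (P i) (k i) t| <= M.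
  set al := a ord0 i; set be := b ord0 i.
  have [M M0 MP] := bump1_bound al be (P i) (k i) c0.
  exists (M * (be - al) ^+ 4) => t.
  have [tab|tab] := boolP (al < t < be); last first.
    rewrite bump1_out// normr0 mulr_ge0 ?(ltW M0)//.
    by rewrite (_ : 4 = 2 * 2)%N// exprM sqr_ge0.
  apply: le_trans (MP _ tab) _; rewrite ler_wpM2l ?(ltW M0)//.
  have g0 := ltW (gap_gt0 tab); rewrite (_ : 4 = 2 * 2)%N// exprM.
  rewrite lerXn2r ?nnegrE ?sqr_ge0// horner_gap expr2.
  by case/andP: tab => ? ?; apply: ler_pM; lra.
have [M HM] := choice H; exists (\prod_i M i).
  by apply: prodr_ge0 => i _; apply: le_trans (HM i 0).
move=> x; rewrite /tensor_bump normr_prod; apply: ler_prod => i _.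
by rewrite normr_ge0 HM.
Qed.

Definition bump a b c : V -> R := tensor_bump a b c (fun=> 1) (fun=> 0%N).

Lemma bump_ge0 a b c x : 0 <= bump a b c x.
Proof.
apply: prodr_ge0 => i _; rewrite /bump1; case: ifP => // _.
by rewrite hornerC expr0 !mul1r expR_ge0.
Qed.

Lemma bump_le1 a b c x : 0 < c -> bump a b c x <= 1.
Proof.
move=> c0; apply: prodr_ile1 => i _; rewrite /bump1; case: ifP => [xab|_]; last first.
  by rewrite lexx ler01.
rewrite hornerC expr0 !mul1r expR_ge0/= -expR0 ler_expR mulNr oppr_le0.
by rewrite divr_ge0 ?(ltW c0)// (ltW (gap_gt0 xab)).
Qed.

Lemma bump_translate a b c z x : bump a b c (x - z) = bump (a + z) (b + z) c x.
Proof.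
apply: eq_bigr => i _; rewrite /bump1 !mxE ltrBrDr ltrBlDr.
case: ifP => // _; rewrite !hornerC !horner_gap; congr (_ * _ * expR (_ * _^-1)).
by congr (_ * _); ring.
Qed.

Lemma derive_translate (f : V -> R) z v x :
  'D_v (fun x => f (x - z)) x = 'D_v f (x - z).
Proof.
rewrite /derive [X in lim (X @ _)](_ : _ = (fun h => h^-1 *:
  ((f \o shift (x - z)) (h *: v) - f (x - z))))//.
by apply/funext => h /=; rewrite addrA.
Qed.

(** The functions exp(- c / gap) increase to 1 as c tends to 0. *)
Lemma bump_cvg a b x :
  (fun k : nat => bump a b k.+1%:R^-1 x) @ \oo --> (\1_(open_box a b) x : R).
Proof.
rewrite indicE; have [|] := boolP (x \in open_box a b); last first.
  move=> /negP; rewrite inE => nx.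
  under eq_fun do rewrite /bump tensor_bump_out//.
  exact: cvg_cst.
rewrite inE => xab.
have -> : true%:R = \prod_(i < m.+1) (1 : R) by rewrite big1.
apply: (@cvg_big R I *%R 1 predT (@mul_continuous R) nat \oo _ (fun i (n : nat) =>
  bump1 (a ord0 i) (b ord0 i) n.+1%:R^-1 1 0 (x ord0 i))) => i _; rewrite /bump1 xab.
under eq_fun do rewrite hornerC expr0 !mul1r.
set g := (gap _ _).[_]^-1.
have h0 : (fun n : nat => n.+1%:R^-1 : R) @ \oo --> (0 : R) by exact: cvg_harmonic.
have h1 : (fun n : nat => - n.+1%:R^-1 * g) @ \oo --> (0 : R).
  have -> : (0 : R) = - 0 * g by rewrite oppr0 mul0r.
  by apply: cvgM; [exact: cvgN h0|exact: cvg_cst].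
by have := cvg_comp _ expR h1 (@continuous_expR R 0); rewrite expR0.
Qed.

Lemma bump_FTC a b c j x s : 0 < c -> 0 < s ->
  (\int[lebesgue_measure]_(t in `[0%R, s])
     ('D_(e_ j) (bump a b c) (x - t *: e_ j))%:E =
   (bump a b c x - bump a b c (x - s *: e_ j))%:E)%E.
Proof.
move=> c0 s0.
have dF t : is_derive (t : R) (1 : R) (fun t => - bump a b c (x - t *: e_ j))
    ('D_(e_ j) (bump a b c) (x - t *: e_ j)).
  pose y := x - t *: e_ j; pose L r := bump a b c (y + r *: e_ j).
  have dL : is_derive (t - t) (1 : R) L ('D_(e_ j) (bump a b c) y).
    by rewrite subrr derive_tensor_bump//; exact: is_derive_line.
  have dg : is_derive t (1 : R) (fun r => t - r) (-1).
    rewrite [X in is_derive _ _ X](_ : _ = cst t - id)//.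
    by apply: is_derive_eq; rewrite sub0r.
  have := @is_derive1_comp _ L (fun r => t - r) t _ _ dL dg.
  move=> /is_deriveN; rewrite mulrN1 opprK; congr (is_derive _ _ _ _).
  apply/funext => r; rewrite fctE /= /L /y; congr (- bump a b c _).
  by rewrite -addrA -scaleNr -scalerDl -scaleNr; congr (x + _ *: _); ring.
have cD : continuous (fun t : R => 'D_(e_ j) (bump a b c) (x - t *: e_ j)).
  move=> t; apply: (@continuous_comp _ _ _ (fun t : R => x - t *: e_ j)
    ('D_(e_ j) (bump a b c))).
    apply: cvgB; first exact: cvg_cst.
    by apply: cvgZr_tmp; exact: cvg_id.
  have -> : 'D_(e_ j) (bump a b c) = tensor_bump a b c
      (deriv_poly a b c (fun=> 1) (fun=> 0%N) j) (deriv_exp (fun=> 0%N) j).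
    by apply/funext => y; exact: derive_tensor_bump.
  exact: continuous_tensor_bump.
have cF : continuous (fun t => - bump a b c (x - t *: e_ j)).
  move=> t; apply/differentiable_continuous/derivable1_diffP.
  by case: (dF t).
rewrite (continuous_FTC2 s0 _ (F := fun t => - bump a b c (x - t *: e_ j))).
- by rewrite scale0r subr0 -EFinB opprK addrC.
- exact: continuous_subspaceT.
- split; first by move=> t _; case: (dF t).
    exact/cvg_at_right_filter/cF.
  exact/cvg_at_left_filter/cF.
- by move=> t _; rewrite derive1E; case: (dF t).
Qed.

End tensor_bump.

(** * Measure-preserving changes of variables *)

Section measure_preserving.
Local Open Scope ereal_scope.
Context d1 d2 (X : measurableType d1) (Y : measurableType d2) (R : realType).
Variables (h : X -> Y) (mh : measurable_fun [set: X] h).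
Variables (mu : {measure set X -> \bar R}) (nu : {measure set Y -> \bar R}).
Hypothesis hmu : forall A, measurable A -> mu (h @^-1` A) = nu A.

Lemma ge0_integral_preserving D (f : Y -> \bar R) : measurable D ->
  measurable_fun D f -> (forall y, 0 <= f y) ->
  \int[nu]_(y in D) f y = \int[mu]_(x in h @^-1` D) f (h x).
Proof.
move=> mD mf f0.
have -> : \int[nu]_(y in D) f y = \int[pushforward mu h]_(y in D) f y.
  by apply: eq_measure_integral => A mA _; rewrite /= /pushforward hmu.
by rewrite ge0_integral_pushforward.
Qed.

Lemma integral_preserving D (f : Y -> \bar R) : measurable D ->
  measurable_fun D f ->
  \int[nu]_(y in D) f y = \int[mu]_(x in h @^-1` D) f (h x).
Proof.
move=> mD mf; rewrite integralE [RHS]integralE.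
congr (_ - _).
  rewrite (@ge0_integral_preserving _ (f ^\+))//; last exact: measurable_funepos.
  by rewrite (funepos_comp f h).
rewrite (@ge0_integral_preserving _ (f ^\-))//; last exact: measurable_funeneg.
by rewrite (funeneg_comp f h).
Qed.

Lemma integrable_preserving D (f : Y -> \bar R) : measurable D ->
  nu.-integrable D f -> mu.-integrable (h @^-1` D) (f \o h).
Proof.
move=> mD /integrableP[mf foo]; apply/integrableP; split.
  move=> _ A mA; rewrite -[X in measurable X]/(h @^-1` (D `&` f @^-1` A)).
  rewrite -[X in measurable X]setTI.
  by apply: mh => //; exact: mf.
move: foo; rewrite (@ge0_integral_preserving _ (fun y => `|f y|))//.
exact: measurableT_comp.
Qed.

End measure_preserving.

Section borel_integrals.
Local Open Scope ereal_scope.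
Context {R : realType} {m : nat}.
Local Notation V := 'rV[R]_m.+1.
Local Notation Bn := (borel_rV R m).
Local Notation Ln := (lebesgue_rV R m).
Local Notation bmu := (@borel_mu R m).
Local Notation mu := (@lebesgue_measure_rV R m).

Lemma integral_lebesgue_borel (D : set V) (f : V -> \bar R) :
  measurable (D : set Bn) -> measurable_fun (D : set Bn) (f : Bn -> \bar R) ->
  \int[mu]_(x in (D : set Ln)) f x = \int[bmu]_(x in (D : set Bn)) f x.
Proof.
move=> mD mf; symmetry.
exact: (@integral_preserving _ _ _ _ _ _ measurable_id_borel mu bmu).
Qed.

Lemma borel_mu_translate z (A : set V) : measurable (A : set Bn) ->
  bmu ((fun x : V => x + z)%R @^-1` A) = bmu A.
Proof. by move=> _; exact: outer_translation. Qed.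

Lemma integral_translate z (f : V -> \bar R) :
  measurable_fun [set: Bn] (f : Bn -> \bar R) ->
  \int[bmu]_(x in [set: Bn]) f (x + z)%R = \int[bmu]_(x in [set: Bn]) f x.
Proof.
move=> mf; symmetry; rewrite (integral_preserving (measurable_addrV z)
  (@borel_mu_translate z))//.
Qed.

End borel_integrals.

(** * The lemma of du Bois-Reymond *)

Section du_bois_reymond.
Local Open Scope ereal_scope.
Context {R : realType} {m : nat}.
Local Notation V := 'rV[R]_m.+1.
Local Notation Bn := (borel_rV R m).
Local Notation bmu := (@borel_mu R m).

Section density.
Variable f : Bn -> \bar R.
Hypotheses (mf : measurable_fun [set: Bn] f) (f0 : forall x, 0 <= f x).

(** The proofs are arguments so that the measure structure can be inferred. *)
Definition density (_ : measurable_fun [set: Bn] f) (_ : forall x, 0 <= f x)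
  (A : set Bn) := \int[bmu]_(x in A) f x.

Let density0 : density mf f0 set0 = 0.
Proof. exact: integral_set0. Qed.

Let density_ge0 A : 0 <= density mf f0 A.
Proof. exact: integral_ge0. Qed.

Let density_sigma_additive : semi_sigma_additive (density mf f0).
Proof. exact: semi_sigma_additive_nng_induced. Qed.

HB.instance Definition _ := isMeasure.Build _ _ _ (density mf f0)
  density0 density_ge0 density_sigma_additive.

End density.

(** The positive and negative parts define two finite measures which agree on
    the pi-system of open boxes. *)
Lemma ae_eq0_open_boxes (f : V -> \bar R) :
  bmu.-integrable [set: Bn] (f : Bn -> \bar R) ->
  (forall a b, \int[bmu]_(x in (open_box a b : set Bn)) f x = 0) ->
  ae_eq bmu [set: Bn] (f : Bn -> \bar R) (cst 0).
Proof.
move=> fi f0; have mf : measurable_fun [set: Bn] (f : Bn -> \bar R).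
  exact: measurable_int fi.
pose mp := measurable_funepos mf; pose mn := measurable_funeneg mf.
pose p0 := funepos_ge0 (f : Bn -> \bar R).
pose n0 := funeneg_ge0 (f : Bn -> \bar R).
have fin g (A : set Bn) : bmu.-integrable [set: Bn] g -> measurable A ->
    \int[bmu]_(x in A) g x \is a fin_num.
  by move=> gi mA; apply: integrable_fin_num => //; exact: integrableS gi.
have E (A : set Bn) : measurable A ->
    density mp p0 A = density mn n0 A.
  move=> mA; apply: (@measure_unique _ R Bn (@open_boxes R m) cbox _ _ _ _
    (density mp p0) (density mn n0)) => //.
  - exact: setI_closed_open_boxes.
  - by move=> k; do 2!eexists.
  - exact: bigcup_cbox.
  - move=> _ [a [b ->]] /=; have := f0 a b; rewrite integralE => /eqP.
    have mab := @measurable_open_box R m a b.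
    have fn : \int[bmu]_(x in (open_box a b : set Bn)) (f : Bn -> \bar R)^\- x
        \is a fin_num by apply: fin => //; exact: integrable_funeneg.
    have fp : \int[bmu]_(x in (open_box a b : set Bn)) (f : Bn -> \bar R)^\+ x
        \is a fin_num by apply: fin => //; exact: integrable_funepos.
    by rewrite sube_eq ?fin_num_adde_defl// add0e => /eqP.
  - move=> k; rewrite -ge0_fin_numE//; apply: fin; first exact: integrable_funepos.
    exact: measurable_open_box.
apply: integral_ae_eq => //.
move=> A _ mA; rewrite integral0 integralE.
by rewrite [X in X - _](E _ mA) subee// fin//; exact: integrable_funeneg.
Qed.

Implicit Types (a b : V) (w : V -> \bar R).

Lemma measurable_bump a b c : (0 < c)%R ->
  measurable_fun [set: Bn] (bump a b c : Bn -> R).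
Proof.
by move=> c0; apply: continuous_measurable_borel; exact: continuous_tensor_bump.
Qed.

Lemma measurable_cbox k : measurable (cbox k : set Bn).
Proof. exact: measurable_open_box. Qed.

(** As c tends to 0 the bumps tend to the indicator of their box, with values in
    [0, 1]: by dominated convergence, w has integral 0 on every open box. *)
Lemma du_bois_reymond w : measurable_fun [set: Bn] (w : Bn -> \bar R) ->
  (forall k, bmu.-integrable (cbox k : set Bn) (w : Bn -> \bar R)) ->
  (forall a b c, (0 < c)%R ->
    \int[bmu]_(x in [set: Bn]) (w x * (bump a b c x)%:E) = 0) ->
  {ae bmu, forall x : Bn, w x = 0}.
Proof.
move=> mw wi w0.
have box0 k a b : open_box a b `<=` cbox k ->
    \int[bmu]_(x in (open_box a b : set Bn)) w x = 0.
  move=> abk; pose f_ (n : nat) (x : Bn) := w x * (bump a b n.+1%:R^-1 x)%:E.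
  pose f (x : Bn) := w x * (\1_(open_box a b) x)%:E.
  have n0 (n : nat) : (0 < n.+1%:R^-1 :> R)%R by rewrite invr_gt0.
  have mf_ n : measurable_fun (cbox k : set Bn) (f_ n).
    apply: measurable_funTS; apply: emeasurable_funM => //.
    by apply/measurable_EFinP; exact: measurable_bump.
  have mf : measurable_fun (cbox k : set Bn) f.
    apply: measurable_funTS; apply: emeasurable_funM => //.
    by apply/measurable_EFinP; apply: measurable_indic; exact: measurable_open_box.
  have f_f : {ae bmu, forall x : Bn, (cbox k : set Bn) x -> f_ ^~ x @ \oo --> f x}.
    apply: filterS (integrable_ae (measurable_cbox k) (wi k)) => x wx xk.
    have {}wx := wx xk; rewrite /f_ /f -(fineK wx) -EFinM; apply/fine_cvgP.
    split; first by apply: nearW => n; rewrite -EFinM.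
    under eq_fun do rewrite /= -EFinM /=.
    by apply: cvgM; [exact: cvg_cst|exact: bump_cvg].
  have f_g : {ae bmu, forall (x : Bn) n, (cbox k : set Bn) x -> `|f_ n x| <= `|w x|}.
    apply: aeW => x n _; rewrite /f_ abseM -[leRHS]mule1 lee_wpmul2l//.
    by rewrite /= lee_fin ger0_norm ?bump_ge0// bump_le1.
  have [_ _] := dominated_convergence (measurable_cbox k) mf_ mf f_f
    (integrable_abse (wi k)) f_g.
  have f_0 n : \int[bmu]_(x in (cbox k : set Bn)) f_ n x = 0.
    rewrite -(w0 a b n.+1%:R^-1%R)//; rewrite integral_mkcond.
    apply: eq_integral => x _; rewrite patchE; case: ifPn => // /negP xk.
    rewrite /bump tensor_bump_out ?mule0// => /abk xk'; apply: xk.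
    by rewrite inE.
  under eq_fun do rewrite f_0.
  have -> : \int[bmu]_(x in (open_box a b : set Bn)) w x =
      \int[bmu]_(x in (cbox k : set Bn)) f x.
    rewrite -[in LHS](setIidr abk) integral_mkcondr; apply: eq_integral => x _.
    by rewrite patchE /f indicE; case: ifP; rewrite ?mule1 ?mule0.
  by move=> /cvg_lim <-//; rewrite lim_cst.
have H k : {ae bmu, forall x : Bn, (cbox k : set Bn) x -> w x = 0}.
  pose wk := w \_ (cbox k).
  have : ae_eq bmu [set: Bn] (wk : Bn -> \bar R) (cst 0).
    apply: ae_eq0_open_boxes.
      by apply/(integrable_mkcond _ (measurable_cbox k)).
    move=> a b; rewrite -integral_mkcondr /cbox open_boxI; apply: (box0 k).
    by rewrite -open_boxI; exact: subIsetr.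
  apply: filterS => x /(_ I) + xk; rewrite /wk patchE.
  by rewrite mem_set.
have := ae_foralln H; apply: filterS => x h.
have [k _ xk] : (\bigcup_k cbox k) x by rewrite bigcup_cbox.
exact: h xk.
Qed.

End du_bois_reymond.

(** * Difference quotients of weakly differentiable functions *)

Section pos_scaling.
Local Open Scope ereal_scope.
Context d (T : measurableType d) (R : realType).
Variable mu : {measure set T -> \bar R}.

(** The positive and negative parts may both have an infinite integral: a
    positive factor leaves the value of the resulting difference unchanged. *)
Lemma integralZr_pos (D : set T) (f : T -> \bar R) c : measurable D ->
  measurable_fun D f -> (0 <= c)%R ->
  \int[mu]_(x in D) (f x * c%:E) = \int[mu]_(x in D) f x * c%:E.
Proof.
move=> mD mf; rewrite le_eqVlt => /predU1P[<-|c0].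
  by rewrite mule0; under eq_integral do rewrite mule0; rewrite integral0.
under eq_integral do rewrite muleC.
rewrite muleC integralE [in RHS]integralE.
have -> : (fun x => c%:E * f x)^\+ = fun x => c%:E * f^\+ x.
  by rewrite ge0_funeposM// ltW.
have -> : (fun x => c%:E * f x)^\- = fun x => c%:E * f^\- x.
  by rewrite ge0_funenegM// ltW.
rewrite ge0_integralZl_EFin ?(ltW c0)//; last exact: measurable_funepos.
rewrite ge0_integralZl_EFin ?(ltW c0)//; last exact: measurable_funeneg.
case: (\int[mu]_(x in D) f^\+ x) => [r| |]; case: (\int[mu]_(x in D) f^\- x) => [s| |];
  rewrite -?EFinN -?EFinM -?EFinN -?EFinD -?EFinM//=;
  rewrite ?gt0_muley ?gt0_muleNy ?lte_fin//=.
by congr (_%:E); ring.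
Qed.

End pos_scaling.

Section difference_formula.
Local Open Scope ereal_scope.
Context {R : realType} {m : nat}.
Local Notation V := 'rV[R]_m.+1.
Local Notation Bn := (borel_rV R m).
Local Notation bmu := (@borel_mu R m).
Local Notation leb := (@lebesgue_measure R).
Local Notation e_ j := (delta_mx ord0 j : V).
Implicit Types (a b x : V) (F G : V -> R) (psi : V -> R) (s t : R).

(** The boxes [cbox k] exhaust the space, and every bounded set is in one. *)
Definition loc_integrable F := measurable_fun [set: Bn] (F : Bn -> R) /\
  forall k, bmu.-integrable (cbox k : set Bn) (EFin \o (F : Bn -> R)).

(** Testing against bumps is enough to determine G almost everywhere, by
    [du_bois_reymond]. *)
Definition weak_partial j F G := forall a b c, (0 < c)%R ->
  \int[bmu]_(x in [set: Bn]) (F x * 'D_(e_ j) (bump a b c) x)%:E =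
  - \int[bmu]_(x in [set: Bn]) (G x * bump a b c x)%:E.

Lemma measurable_shift j s : measurable_fun [set: Bn * R]
  ((fun p : Bn * R => ((p.1 : V) + (s * p.2) *: e_ j)%R) : Bn * R -> Bn).
Proof.
apply: measurable_fun_rV => i.
under eq_fun do rewrite addZeE.
apply: measurable_funD.
  apply: (measurableT_comp (@measurable_coord_borel R m i)).
  exact: measurable_fst.
by case: (i == j) => //; apply: measurable_funM => //; exact: measurable_snd.
Qed.

Lemma measurable_fun_shift j (G : V -> R) :
  measurable_fun [set: Bn] (G : Bn -> R) ->
  measurable_fun [set: Bn * R] (fun p : Bn * R => G ((p.1 : V) + p.2 *: e_ j)%R).
Proof.
move=> mG.
have -> : (fun p : Bn * R => G ((p.1 : V) + p.2 *: e_ j)%R) = (G : Bn -> R) \o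
    (fun p : Bn * R => ((p.1 : V) + (1 * p.2) *: e_ j)%R : Bn).
  by apply/funext => p /=; rewrite mul1r.
by apply: (measurableT_comp mG); exact: measurable_shift.
Qed.

(** Up to the factor M s, the integral is that of |F| on a fixed box: this is what
    allows Fubini's theorem on products of F with moving bumps. *)
Lemma dominated_product F psi j s k M : loc_integrable F ->
  measurable_fun [set: Bn] (psi : Bn -> R) -> (0 <= s)%R ->
  (forall x, `|psi x| <= M)%R ->
  (forall x t, (0 <= t <= s)%R -> psi (x - t *: e_ j)%R != 0%R -> cbox k x) ->
  (bmu \x leb).-integrable [set: Bn * R] (fun p =>
    (F p.1 * psi (p.1 - p.2 *: e_ j)%R * \1_(`[0%R, s]%classic) p.2)%:E).
Proof.
move=> [mF iF] mpsi s0 psiM psik.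
set K := (fun p => _).
have mK : measurable_fun [set: Bn * R] K.
  apply/measurable_EFinP; apply: measurable_funM; first apply: measurable_funM.
  - by apply: (measurableT_comp mF); exact: measurable_fst.
  - have -> : (fun p : Bn * R => psi ((p.1 : V) - p.2 *: e_ j)%R) = (psi : Bn -> R) \o
        (fun p : Bn * R => ((p.1 : V) + (-1 * p.2) *: e_ j)%R : Bn).
      by apply/funext => p /=; rewrite mulN1r scaleNr.
    by apply: (measurableT_comp mpsi); exact: measurable_shift.
  - by apply: measurableT_comp; [exact: measurable_indic|exact: measurable_snd].
apply/integrable12ltyP => //.
pose g (x : Bn) := (M * s)%:E * (abse \o ((EFin \o (F : Bn -> R)) \_ (cbox k))) x.
have M0 : (0 <= M)%R by exact: le_trans (psiM 0%R).
have iFk := (integrable_mkcond _ (measurable_cbox k)).1 (iF k).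
apply: (@le_lt_trans _ _ (\int[bmu]_x g x)).
  apply: ge0_le_integral => //.
  - by move=> x _; exact: integral_ge0.
  - apply: (measurable_fun_fubini_tonelli_F (abse \o K)).
      exact: measurableT_comp.
    by move=> p; exact: abse_ge0.
  - apply: measurable_funeM; apply: measurableT_comp => //.
    exact: measurable_int iFk.
  move=> x _.
  apply: (@le_trans _ _ (\int[leb]_(t in [set: R]) ((M%:E *
      `|((EFin \o (F : Bn -> R)) \_ (cbox k)) x|) * (\1_(`[0%R, s]%classic) t)%:E))).
    apply: ge0_le_integral => //.
    - by apply: measurableT_comp => //; exact: (measurable_fun_pair2 x mK).
    - by apply: measurable_funeM; apply/measurable_EFinP; exact: measurable_indic.
    move=> t _; rewrite /K/= indicE; case: (boolP (t \in _)) => [|_]; last first.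
      by rewrite mulr0 normr0 !mule0.
    rewrite inE/= in_itv/= => t0s; rewrite mulr1 mule1 patchE normrM.
    case: ifPn => [_|/negP xk].
      by rewrite /= -EFinM lee_fin mulrC ler_wpM2r.
    rewrite abse0 mule0 lee_fin; have [->|psi0] := eqVneq (psi (x - t *: e_ j)%R) 0%R.
      by rewrite normr0 mulr0.
    by case: xk; rewrite inE; exact: psik psi0.
  rewrite ge0_integralZl//; last 2 first.
    by apply/measurable_EFinP; exact: measurable_indic.
    by rewrite mule_ge0.
  have leb0s : leb `[0%R, s]%classic = s%:E.
    rewrite lebesgue_measure_itv/= lte_fin; case: ltP => [_|s0'].
      by rewrite oppr0 adde0.
    by congr (_%:E); apply/eqP; rewrite eq_le s0 s0'.
  by rewrite integral_indic// setIT [X in _ * X <= _]leb0s /g EFinM muleAC.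
rewrite /g ge0_integralZl//.
- apply: lte_mul_pinfty => //; first by rewrite lee_fin mulr_ge0.
  by have /integrableP[] := iFk.
- by apply: measurableT_comp => //; exact: measurable_int iFk.
- by move=> x _; exact: abse_ge0.
- by rewrite lee_fin mulr_ge0.
Qed.

(** By translation, the integral of |G (x + t e_j) psi x| in x is that of
    |G x psi (x - t e_j)|. *)
Lemma dominated_product_shift G psi j s k M : loc_integrable G ->
  measurable_fun [set: Bn] (psi : Bn -> R) -> (0 <= s)%R ->
  (forall x, `|psi x| <= M)%R ->
  (forall x t, (0 <= t <= s)%R -> psi (x - t *: e_ j)%R != 0%R -> cbox k x) ->
  (bmu \x leb).-integrable [set: Bn * R] (fun p =>
    (G (p.1 + p.2 *: e_ j)%R * psi p.1 * \1_(`[0%R, s]%classic) p.2)%:E).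
Proof.
move=> Gloc mpsi s0 psiM psik; have [mG _] := Gloc.
have mK : measurable_fun [set: Bn * R] (fun p =>
    (G (p.1 + p.2 *: e_ j)%R * psi p.1 * \1_(`[0%R, s]%classic) p.2)%:E).
  apply/measurable_EFinP; apply: measurable_funM; first apply: measurable_funM.
  - exact: measurable_fun_shift.
  - by apply: (measurableT_comp mpsi); exact: measurable_fst.
  - by apply: measurableT_comp; [exact: measurable_indic|exact: measurable_snd].
apply/integrable21ltyP => //.
have i2 := dominated_product Gloc mpsi s0 psiM psik.
have := (integrable21ltyP _ _ (measurable_int _ i2)).1 i2.
congr (_ < _); apply: eq_integral => t _ /=.
pose f (y : Bn) := `|G y * psi (y - t *: e_ j)%R * \1_(`[0%R, s]%classic) t|%:E.
have mf : measurable_fun [set: Bn] f.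
  have := measurableT_comp (@abse_measurable R setT)
    (measurable_fun_pair1 t (measurable_int _ i2)).
  by [].
rewrite -(integral_translate (t *: e_ j) mf); apply: eq_integral => x _.
by rewrite /f addrK.
Qed.

Lemma integrable_bounded_support F psi k M : loc_integrable F ->
  measurable_fun [set: Bn] (psi : Bn -> R) -> (forall x, `|psi x| <= M)%R ->
  (forall x, psi x != 0%R -> cbox k x) ->
  bmu.-integrable [set: Bn] (fun x => (F x * psi x)%:E).
Proof.
move=> [mF iF] mpsi psiM psik.
have iFk := (integrable_mkcond _ (measurable_cbox k)).1 (iF k).
have M0 : (0 <= M)%R by exact: le_trans (psiM 0%R).
have iMF : bmu.-integrable [set: Bn]
    (fun x => M%:E * ((EFin \o (F : Bn -> R)) \_ (cbox k)) x).
  exact: integrableZl.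
apply: le_integrable iMF => //.
- by apply/measurable_EFinP; exact: measurable_funM.
- move=> x _; rewrite patchE; case: ifPn => [_|/negP xk].
    by rewrite /= lee_fin !normrM mulrC ler_wpM2r// (ger0_norm M0).
  rewrite mule0 abse0 /= lee_fin; have [->|psi0] := eqVneq (psi x) 0%R.
    by rewrite mulr0 normr0.
  by case: xk; rewrite inE; exact: psik.
Qed.

Lemma cbox_support a b s : exists k, forall x t j, (0 <= t <= s)%R ->
  open_box a b (x - t *: e_ j)%R -> cbox k x.
Proof.
pose M := (\sum_i `|a ord0 i| + \sum_i `|b ord0 i| + s)%R.
exists (Num.truncn M).+1 => x t j /andP[t0 ts] xab i.
have := xab i; rewrite -scaleNr addZeE !mxE => xi.
have Mi : (M < (Num.truncn M).+1%:R)%R by exact: truncnS_gt.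
have aM : (`|a ord0 i| <= \sum_i `|a ord0 i|)%R.
  by rewrite (bigD1 i)//= lerDl sumr_ge0.
have bM : (`|b ord0 i| <= \sum_i `|b ord0 i|)%R.
  by rewrite (bigD1 i)//= lerDl sumr_ge0.
have := ler_norm (b ord0 i); have := ler_norm (- a ord0 i); rewrite normrN.
move: xi Mi; rewrite /M; set A := (\sum_i `|a ord0 i|)%R in aM *.
set B := (\sum_i `|b ord0 i|)%R in bM *; move: (Num.truncn _).+1%:R => K.
have := normr_ge0 (a ord0 i); have := normr_ge0 (b ord0 i).
by case: ifP => _ ? ? /andP[xa xb] *; apply/andP; split; lra.
Qed.

(** The definition of the weak derivative, applied to the bumps translated by
    t e_j and integrated over t in [0, s]: on the left the derivatives of the
    bump integrate to an increment of the bump, which is moved onto F by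
    translation, and on the right the translation is moved onto G. *)
Lemma weak_partial_difference j F G s a b c :
  loc_integrable F -> loc_integrable G -> weak_partial j F G ->
  (0 < s)%R -> (0 < c)%R ->
  \int[bmu]_(x in [set: Bn]) ((F (x + s *: e_ j)%R - F x) * bump a b c x)%:E =
  \int[bmu]_(x in [set: Bn])
    (\int[leb]_(t in `[0%R, s]) (G (x + t *: e_ j)%R)%:E * (bump a b c x)%:E).
Proof.
move=> Floc Gloc FG s0 c0.
have [[mF _] [mG _]] := (Floc, Gloc).
set phi := bump a b c; pose D := 'D_(e_ j) phi.
have [k supk] := cbox_support a b s.
have phiM x : (`|phi x| <= 1)%R by rewrite ger0_norm ?bump_ge0// bump_le1.
have DE : D = tensor_bump a b c (deriv_poly a b c (fun=> 1%R) (fun=> 0%N) j)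
    (deriv_exp (fun=> 0%N) j).
  by apply/funext => x; exact: derive_tensor_bump.
have [M M0 DM] : exists2 M, (0 <= M)%R & forall x, (`|D x| <= M)%R.
  by rewrite DE; exact: tensor_bump_bounded.
have mphi : measurable_fun [set: Bn] (phi : Bn -> R) by exact: measurable_bump.
have mD : measurable_fun [set: Bn] (D : Bn -> R).
  by apply: continuous_measurable_borel; rewrite DE; exact: continuous_tensor_bump.
have phiout x : phi x != 0%R -> open_box a b x.
  by move=> /eqP x0; apply: contrapT => /(tensor_bump_out) h; apply: x0; exact: h.
have Dout x : D x != 0%R -> open_box a b x.
  by rewrite DE => /eqP x0; apply: contrapT => /(tensor_bump_out) h; apply: x0; exact: h.
have supphi x t : (0 <= t <= s)%R -> phi (x - t *: e_ j)%R != 0%R -> cbox k x.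
  by move=> t0s /phiout; exact: supk.
have supD x t : (0 <= t <= s)%R -> D (x - t *: e_ j)%R != 0%R -> cbox k x.
  by move=> t0s /Dout; exact: supk.
have s0' := ltW s0.
have iK1 := dominated_product Floc mD s0' DM supD.
have iK2 := dominated_product Gloc mphi s0' phiM supphi.
have iK3 := dominated_product_shift Gloc mphi s0' phiM supphi.
pose K1 (p : Bn * R) := (F p.1 * D (p.1 - p.2 *: e_ j)%R *
  \1_(`[0%R, s]%classic) p.2)%:E.
pose K2 (p : Bn * R) := (G p.1 * phi (p.1 - p.2 *: e_ j)%R *
  \1_(`[0%R, s]%classic) p.2)%:E.
pose K3 (p : Bn * R) := (G (p.1 + p.2 *: e_ j)%R * phi p.1 *
  \1_(`[0%R, s]%classic) p.2)%:E.
pose phis x := phi (x - s *: e_ j)%R.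
have mphis : measurable_fun [set: Bn] (phis : Bn -> R).
  have -> : phis = bump (a + s *: e_ j) (b + s *: e_ j) c.
    by apply/funext => x; exact: bump_translate.
  exact: measurable_bump.
have iFphi : bmu.-integrable [set: Bn] (fun x => (F x * phi x)%:E).
  apply: (integrable_bounded_support (k := k) Floc mphi phiM) => x phix.
  by apply: (supphi x 0%R); rewrite ?lexx// scale0r subr0.
have iFphis : bmu.-integrable [set: Bn] (fun x => (F x * phis x)%:E).
  apply: (integrable_bounded_support (k := k) Floc mphis).
    by move=> x; exact: phiM.
  by move=> x; apply: supphi; rewrite s0' lexx.
have iFsphi : bmu.-integrable [set: Bn] (fun x => (F (x + s *: e_ j)%R * phi x)%:E).
  have := integrable_preserving (measurable_addrV (s *: e_ j))
    (@borel_mu_translate R m (s *: e_ j)) measurableT iFphis.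
  rewrite preimage_setT; congr (bmu.-integrable _ _).
  by apply/funext => x; rewrite /= /phis addrK.
(* both sides are turned into the integral of F x * (phis x - phi x) *)
transitivity (\int[bmu]_(x in [set: Bn]) (F x * phis x)%:E -
              \int[bmu]_(x in [set: Bn]) (F x * phi x)%:E).
  under eq_integral do rewrite mulrBl EFinB.
  rewrite (integralB measurableT iFsphi iFphi); congr (_ - _).
  rewrite -(integral_translate (s *: e_ j) (measurable_int _ iFphis)).
  by apply: eq_integral => x _; rewrite /phis addrK.
rewrite -(integralB measurableT iFphis iFphi).
transitivity (- \int[bmu]_(x in [set: Bn]) \int[leb]_(t in [set: R]) K1 (x, t)).
  have iI : bmu.-integrable [set: Bn] (fun x => \int[leb]_t K1 (x, t)).
    exact: integrable_fubini_F.
  rewrite -integralN; last exact: integrable_add_def.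
  apply: eq_integral => x _.
  have -> : \int[leb]_t K1 (x, t) = (F x)%:E *
      \int[leb]_(t in `[0%R, s]) (D (x - t *: e_ j)%R)%:E.
    rewrite -integralZl//; last first.
      apply: continuous_compact_integrable; first exact: segment_compact.
      apply: continuous_subspaceT => t.
      apply: (@continuous_comp _ _ _ (fun t : R => x - t *: e_ j)%R D).
        by apply: cvgB; [exact: cvg_cst|apply: cvgZr_tmp; exact: cvg_id].
      by rewrite DE; exact: continuous_tensor_bump.
    rewrite [RHS]integral_mkcond; apply: eq_integral => t _.
    rewrite patchE /K1 indicE; case: ifP => _; last by rewrite mulr0.
    by rewrite mulr1 EFinM.
  by rewrite bump_FTC// -EFinM -EFinN -EFinB; congr (_%:E); rewrite /phis /phi; ring.
rewrite (Fubini iK1).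
have K12 t : \int[bmu]_x K1 (x, t) = - \int[bmu]_x K2 (x, t).
  rewrite /K1 /K2 /= indicE; case: (_ \in _); last first.
    by under eq_integral do rewrite mulr0; under [X in - X]eq_integral do rewrite mulr0;
      rewrite !integral0 oppe0.
  under eq_integral do rewrite mulr1; under [X in - X]eq_integral do rewrite mulr1.
  have := FG (a + t *: e_ j)%R (b + t *: e_ j)%R c c0.
  have -> : bump (a + t *: e_ j) (b + t *: e_ j) c = fun x => phi (x - t *: e_ j)%R.
    by apply/funext => x; rewrite /phi bump_translate.
  by move=> <-; apply: eq_integral => x _; rewrite derive_translate.
have iI2 : leb.-integrable [set: R] (fun t => \int[bmu]_x K2 (x, t)).
  have mK2 := measurable_int _ iK2.
  apply/integrableP; split; first exact: measurable_fubini_G iK2.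
  apply: le_lt_trans ((integrable21ltyP _ _ mK2).1 iK2).
  apply: ge0_le_integral => //.
  - by apply: measurableT_comp => //; exact: measurable_fubini_G iK2.
  - apply: (measurable_fun_fubini_tonelli_G (abse \o K2)).
      exact: measurableT_comp.
    by move=> p; exact: abse_ge0.
  - move=> t _; apply: le_abse_integral => //; exact: measurable_fun_pair1 mK2.
transitivity (\int[leb]_t \int[bmu]_x K2 (x, t)).
  under eq_integral do rewrite K12.
  by rewrite integralN ?oppeK//; exact: integrable_add_def.
transitivity (\int[leb]_t \int[bmu]_x K3 (x, t)).
  apply: eq_integral => t _.
  have mf := measurable_fun_pair1 t (measurable_int _ iK2).
  rewrite -(integral_translate (t *: e_ j) mf).
  by apply: eq_integral => x _; rewrite /K3/= addrK.
rewrite -(Fubini iK3); apply: eq_integral => x _.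
rewrite -integralZr_pos ?bump_ge0//; last first.
  apply/measurable_EFinP; apply: measurable_funTS.
  exact: (measurable_fun_pair2 (x : Bn) (measurable_fun_shift j mG)).
rewrite [RHS]integral_mkcond; apply: eq_integral => t _.
rewrite patchE /K3 indicE; case: ifP => _; last by rewrite mulr0.
by rewrite mulr1 EFinM.
Qed.

Lemma measurable_line_integral j G s : measurable_fun [set: Bn] (G : Bn -> R) ->
  measurable_fun [set: Bn]
    (fun x : Bn => \int[leb]_(t in `[0%R, s]) (G (x + t *: e_ j)%R)%:E).
Proof.
move=> mG.
pose K (p : Bn * R) := (G (p.1 + p.2 *: e_ j)%R * \1_(`[0%R, s]%classic) p.2)%:E.
have mK : measurable_fun [set: Bn * R] K.
  apply/measurable_EFinP; apply: measurable_funM; first exact: measurable_fun_shift.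
  by apply: measurableT_comp; [exact: measurable_indic|exact: measurable_snd].
have -> : (fun x : Bn => \int[leb]_(t in `[0%R, s]) (G (x + t *: e_ j)%R)%:E) =
    (fun x => \int[leb]_t K^\+ (x, t)) \- (fun x => \int[leb]_t K^\- (x, t)).
  apply/funext => x; rewrite integral_mkcond.
  have -> : (fun t => (G (x + t *: e_ j)%R)%:E) \_ (`[0%R, s]%classic) = K \o pair x.
    apply/funext => t; rewrite patchE /K/= indicE.
    by case: ifP => _; rewrite ?mulr1 ?mulr0.
  by rewrite integralE funepos_comp funeneg_comp.
apply: emeasurable_funB.
  exact: (@measurable_fun_fubini_tonelli_F _ _ _ _ _ leb _
    (measurable_funepos mK) (funepos_ge0 K)).
exact: (@measurable_fun_fubini_tonelli_F _ _ _ _ _ leb _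
  (measurable_funeneg mK) (funeneg_ge0 K)).
Qed.

(** Both sides are locally integrable with the same integral against every bump,
    so that the lemma of du Bois-Reymond identifies them. *)
Lemma difference_formula j F G s :
  loc_integrable F -> loc_integrable G -> weak_partial j F G -> (0 < s)%R ->
  {ae bmu, forall x : Bn, (F (x + s *: e_ j)%R - F x)%:E =
     \int[leb]_(t in `[0%R, s]) (G (x + t *: e_ j)%R)%:E}.
Proof.
move=> Floc Gloc FG s0; have [[mF iF] [mG iG]] := (Floc, Gloc).
pose u (x : Bn) : \bar R := (F (x + s *: e_ j)%R - F x)%:E.
pose H (x : Bn) : \bar R := \int[leb]_(t in `[0%R, s]) (G (x + t *: e_ j)%R)%:E.
have mFs : measurable_fun [set: Bn] (fun x : Bn => F ((x : V) + s *: e_ j)%R).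
  exact: (measurableT_comp mF (measurable_addrV (s *: e_ j))).
have mu : measurable_fun [set: Bn] u.
  by apply/measurable_EFinP; exact: measurable_funB.
have mH : measurable_fun [set: Bn] H by exact: measurable_line_integral.
have iu k : bmu.-integrable (cbox k : set Bn) u.
  have [k' supk] := cbox_support (const_mx (- k%:R)%R : V) (const_mx k%:R%R) s.
  have := integrable_preserving (measurable_addrV (s *: e_ j))
    (@borel_mu_translate R m (s *: e_ j)) (measurable_cbox k') (iF k').
  move=> iFs.
  have -> : u = (fun x : Bn => (F (x + s *: e_ j)%R)%:E) \- (EFin \o (F : Bn -> R)).
    by apply/funext => x; rewrite /u /= EFinB.
  apply: integrableB; [exact: measurable_cbox| |exact: iF].
  have mk := @measurable_cbox R m k.
  apply: (integrableS _ mk _ iFs).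
  - rewrite -[X in measurable X]setTI.
    by apply: measurable_addrV => //; exact: measurable_cbox.
  - move=> x xk /=; apply: (supk _ s j); first by rewrite ltW//= lexx.
    by rewrite addrK.
have iH k : bmu.-integrable (cbox k : set Bn) H.
  have [k' supk] := cbox_support (const_mx (- k%:R)%R : V) (const_mx k%:R%R) s.
  pose psi x : R := \1_(cbox k) x.
  have mpsi : measurable_fun [set: Bn] (psi : Bn -> R).
    by apply: measurable_indic; exact: measurable_cbox.
  have psi1 x : (`|psi x| <= 1)%R.
    by rewrite /psi indicE; case: (_ \in _); rewrite ?normr1// normr0.
  have supp x t : (0 <= t <= s)%R -> psi (x - t *: e_ j)%R != 0%R -> cbox k' x.
    move=> t0s; rewrite /psi indicE; case: (boolP (_ \in _)); last by rewrite eqxx.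
    by rewrite inE => xk _; exact: supk xk.
  have iK := dominated_product_shift Gloc mpsi (ltW s0) psi1 supp.
  have mk := @measurable_cbox R m k.
  have := integrableS measurableT mk (@subsetT _ _) (integrable_fubini_F iK).
  apply: (eq_integrable mk) => x; rewrite inE => xk.
  rewrite /H [RHS]integral_mkcond; apply: eq_integral => t _.
  rewrite patchE /psi !indicE mem_set// mulr1.
  by case: ifP => _; rewrite ?mulr1 ?mulr0.
have defuH x : u x +? - H x by rewrite fin_num_adde_defr.
have : {ae bmu, forall x : Bn, u x - H x = 0}.
  apply: (du_bois_reymond (w := u \- H)).
  - exact: emeasurable_funB.
  - by move=> k; apply: integrableB; [exact: measurable_cbox|exact: iu|exact: iH].
  - move=> a b c c0.
    have [k supk] := cbox_support a b 0.
    have bnd : [bounded bump a b c x | x in (cbox k : set Bn)].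
      exists 1%R; split => // M M1 x _ /=.
      by rewrite ger0_norm ?bump_ge0// (le_trans (bump_le1 _ _ _ c0))// ltW.
    have mb : measurable_fun (cbox k : set Bn) (bump a b c : Bn -> R).
      by apply: measurable_funTS; exact: measurable_bump.
    have out (f : Bn -> \bar R) : \int[bmu]_(x in [set: Bn]) (f x * (bump a b c x)%:E) =
        \int[bmu]_(x in (cbox k : set Bn)) (f x * (bump a b c x)%:E).
      rewrite [RHS]integral_mkcond; apply: eq_integral => x _.
      rewrite patchE; case: ifPn => // /negP xk.
      rewrite /bump tensor_bump_out ?mule0// => xab; apply: xk; rewrite inE.
      by apply: (supk x 0%R ord0); rewrite ?lexx// scale0r subr0.
    rewrite out.
    under eq_integral do rewrite muleBl//.
    have ck := @measurable_cbox R m k.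
    rewrite (integralB ck (integrableMl ck (iu k) mb bnd)
      (integrableMl ck (iH k) mb bnd)).
    rewrite -!out.
    have -> : \int[bmu]_(x in [set: Bn]) (H x * (bump a b c x)%:E) =
        \int[bmu]_(x in [set: Bn]) (u x * (bump a b c x)%:E).
      rewrite -(weak_partial_difference a b Floc Gloc FG s0 c0).
      by apply: eq_integral => x _; rewrite /u -EFinM.
    rewrite subee// out; apply: integrable_fin_num => //.
    by apply: integrableMl => //; exact: iu.
apply: filterS => x; rewrite -/(u x) -/(H x) => /eqP.
by rewrite sube_eq ?add0e => [/eqP||]//; rewrite fin_num_adde_defl.
Qed.

End difference_formula.

(** * Differences inside a cube, along the axes *)

Section power_mean.
Local Open Scope ereal_scope.
Context d (T : measurableType d) (R : realType).
Variable mu : {measure set T -> \bar R}.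

(** Hoelder's inequality for g and the indicator of D. *)
Lemma power_mean (D : set T) (g : T -> R) (M a : R) : measurable D ->
  measurable_fun [set: T] g -> (forall x, 0 <= g x)%R -> mu D = M%:E ->
  (1 <= a)%R ->
  (\int[mu]_(x in D) (g x)%:E) `^ a <=
  (M `^ (a - 1))%:E * \int[mu]_(x in D) (g x `^ a)%:E.
Proof.
move=> mD mg g0 muD; rewrite le_eqVlt => /predU1P[<-|a1].
  rewrite subrr powRr0 mul1e poweRe1; last first.
    by apply: integral_ge0 => x _; rewrite lee_fin.
  by under [leRHS]eq_integral do rewrite powRr1//.
have a0 : (0 < a)%R by rewrite (lt_trans _ a1).
pose q := (a / (a - 1))%R.
have q0 : (0 < q)%R by rewrite divr_gt0// subr_gt0.
have aq : (a^-1 + q^-1 = 1)%R.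
  by rewrite /q invf_div; field; rewrite gt_eqF.
have m1 : measurable_fun [set: T] (\1_D : T -> R) by exact: measurable_indic.
have mf : measurable_fun [set: T] (g \* \1_D)%R by exact: measurable_funM.
have := hoelder mu mf m1 a0 q0 aq.
have -> : Lnorm mu 1 (EFin \o ((g \* \1_D) \* \1_D)%R) = \int[mu]_(x in D) (g x)%:E.
  rewrite Lnorm1 [RHS]integral_mkcond; apply: eq_integral => x _.
  rewrite patchE /= indicE; case: ifP => _; last by rewrite mulr0 normr0.
  by rewrite !mulr1 ger0_norm.
move=> /(gt0_ler_poweR (ltW a0)) -/(_ _ _) H.
have : (\int[mu]_(x in D) (g x)%:E) `^ a <=
    (Lnorm mu a%:E (EFin \o (g \* \1_D)%R) * Lnorm mu q%:E (EFin \o \1_D)) `^ a.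
  apply: H; rewrite in_itv/= leey andbT.
    by apply: integral_ge0 => x _; rewrite lee_fin.
  by rewrite mule_ge0// Lnorm_ge0.
rewrite poweRM ?Lnorm_ge0// poweR_Lnorm ?gt_eqF// muleC => /le_trans; apply.
have -> : \int[mu]_x `|(EFin \o (g \* \1_D)%R) x| `^ a =
    \int[mu]_(x in D) (g x `^ a)%:E.
  rewrite [RHS]integral_mkcond; apply: eq_integral => x _.
  rewrite patchE /= indicE; case: ifP => _.
    by rewrite mulr1 ger0_norm.
  by rewrite mulr0 normr0 powR0// gt_eqF.
have -> : Lnorm mu q%:E (EFin \o \1_D) = (M `^ q^-1)%:E.
  rewrite unlock; have -> : \int[mu]_x `|(EFin \o \1_D) x| `^ q = mu D.
    transitivity (mu (D `&` setT)); last by rewrite setIT.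
    rewrite -integral_indic//; apply: eq_integral => x _ /=.
    rewrite indicE; case: (_ \in _); rewrite ?normr1 ?powR1// normr0 powR0//.
    by rewrite gt_eqF.
  by rewrite muD poweR_EFin.
rewrite poweR_EFin -powRrM; have -> // : (q^-1 * a = a - 1)%R.
by rewrite /q invf_div divfK// gt_eqF.
Qed.

End power_mean.

Section difference_quotients.
Local Open Scope ereal_scope.
Context {R : realType} {m : nat}.
Local Notation V := 'rV[R]_m.+1.
Local Notation Bn := (borel_rV R m).
Local Notation bmu := (@borel_mu R m).
Local Notation leb := (@lebesgue_measure R).
Local Notation e_ j := (delta_mx ord0 j : V).
Implicit Types (a b x z : V) (F G : V -> R) (Q : set V) (s t q : R).

Lemma cube_between l Q x y z : is_cube l Q -> Q x -> Q y ->
  (forall i, (x ord0 i <= z ord0 i <= y ord0 i)%R \/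
             (y ord0 i <= z ord0 i <= x ord0 i)%R) -> Q z.
Proof.
move=> [l0 [a [b [b' ->]]]] /= Qx Qy xyz i; have := interval_is_interval
  (i := Interval (BSide (b i) (a ord0 i)) (BSide (b' i) (a ord0 i + l)%R)).
move=> itv; case: (xyz i) => h; first exact: itv (Qx i) (Qy i) _ h.
exact: itv (Qy i) (Qx i) _ h.
Qed.

Lemma measurable_normpow q (G : V -> R) : measurable_fun [set: Bn] (G : Bn -> R) ->
  measurable_fun [set: Bn] ((fun x => `|G x| `^ q)%R : Bn -> R).
Proof.
move=> mG; apply: (measurableT_comp (measurable_powR q)).
exact: (measurableT_comp (@normr_measurable R setT)).
Qed.

Definition weighted_power q Q G (x : V) : R := (\1_Q x * `|G x| `^ q)%R.

Lemma weighted_power_ge0 q Q G x : (0 <= weighted_power q Q G x)%R.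
Proof. by rewrite mulr_ge0// powR_ge0. Qed.

Lemma measurable_weighted_power q Q G : measurable (Q : set Bn) ->
  measurable_fun [set: Bn] (G : Bn -> R) ->
  measurable_fun [set: Bn] (weighted_power q Q G : Bn -> R).
Proof.
move=> mQ mG; apply: measurable_funM; first exact: measurable_indic.
exact: measurable_normpow.
Qed.

(** Jensen's inequality on the segment from x to x + s e_j, which stays in the
    cube, followed by Tonelli's theorem. *)
Lemma axis_difference_pos j F G l Q s q :
  loc_integrable F -> loc_integrable G -> weak_partial j F G ->
  is_cube l Q -> (1 <= q)%R -> (0 < s)%R ->
  \int[bmu]_(x in [set: Bn])
    (\1_Q x * \1_Q (x + s *: e_ j) * `|F (x + s *: e_ j) - F x| `^ q)%R%:E <=
  (s `^ q)%:E * \int[bmu]_(x in [set: Bn]) (weighted_power q Q G x)%:E.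
Proof.
move=> Floc Gloc FG cQ q1 s0; have [[mF _] [mG _]] := (Floc, Gloc).
have mQ := measurable_cube cQ.
have m1Q : measurable_fun [set: Bn] (\1_Q : Bn -> R) by exact: measurable_indic.
pose W := weighted_power q Q G.
have mW : measurable_fun [set: Bn] (W : Bn -> R) by exact: measurable_weighted_power.
pose K (p : Bn * R) := (W (p.1 + p.2 *: e_ j)%R * \1_(`[0%R, s]%classic) p.2)%:E.
have K0 p : 0 <= K p by rewrite lee_fin mulr_ge0// weighted_power_ge0.
have mK : measurable_fun [set: Bn * R] K.
  apply/measurable_EFinP; apply: measurable_funM; first exact: measurable_fun_shift.
  by apply: measurableT_comp; [exact: measurable_indic|exact: measurable_snd].
have mKx : measurable_fun [set: Bn] (fun x : Bn => \int[leb]_t K (x, t)).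
  exact: (@measurable_fun_fubini_tonelli_F _ _ _ _ _ leb _ mK K0).
have leb0s : leb `[0%R, s]%classic = s%:E.
  by rewrite lebesgue_measure_itv/= lte_fin s0 oppr0 adde0.
have mm x : measurable_fun [set: R] (fun t : R => G (x + t *: e_ j)%R).
  exact: (measurable_fun_pair2 (x : Bn) (measurable_fun_shift j mG)).
apply: (@le_trans _ _ (\int[bmu]_(x in [set: Bn])
    ((s `^ (q - 1))%:E * \int[leb]_t K (x, t)))).
  apply: ae_ge0_le_integral => //.
  - apply/measurable_EFinP; apply: measurable_funM.
      apply: measurable_funM => //.
      exact: (measurableT_comp m1Q (measurable_addrV (s *: e_ j))).
    apply: (@measurable_normpow q (fun x => F (x + s *: e_ j) - F x)%R).
    apply: measurable_funB => //.
    exact: (measurableT_comp mF (measurable_addrV (s *: e_ j))).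
  - by move=> x _; rewrite mule_ge0 ?lee_fin ?powR_ge0// integral_ge0.
  - exact: measurable_funeM.
  apply: filterS (difference_formula Floc Gloc FG s0) => x Fx _.
  have rhs0 : 0 <= (s `^ (q - 1))%:E * \int[leb]_t K (x, t).
    by rewrite mule_ge0 ?lee_fin ?powR_ge0// integral_ge0.
  rewrite !indicE; have [Qx|_] := boolP (x \in Q); last by rewrite !mul0r.
  have [Qxs|_] := boolP ((x + s *: e_ j)%R \in Q); last by rewrite mulr0 mul0r.
  have absF : (`|F (x + s *: e_ j) - F x|%R)%:E =
      `|\int[leb]_(t in `[0%R, s]) (G (x + t *: e_ j)%R)%:E| by rewrite -Fx.
  rewrite !mul1r -[X in X <= _]poweR_EFin absF; rewrite !inE in Qx Qxs.
  apply: (@le_trans _ _ ((\int[leb]_(t in `[0%R, s]) (`|G (x + t *: e_ j)|%R)%:E) `^ q)).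
    apply: gt0_ler_poweR; first lra.
    - by rewrite in_itv/= abse_ge0 leey.
    - by rewrite in_itv/= leey andbT integral_ge0.
    apply: le_abse_integral => //.
    by apply/measurable_EFinP; apply: measurable_funTS; exact: mm.
  apply: le_trans (power_mean _ _ _ leb0s q1) _ => //.
    exact: (measurableT_comp (@normr_measurable R setT) (mm x)).
  rewrite lee_pmul2l ?lte_fin ?powR_gt0// integral_mkcond.
  apply: ge0_le_integral => //.
  - by move=> t _; rewrite erestrict_ge0// => r _; rewrite lee_fin powR_ge0.
  - apply: (measurable_restrictT _ _).1 => //; apply: measurable_funTS.
    apply/measurable_EFinP.
    apply: (measurableT_comp (measurable_powR q)).
    exact: (measurableT_comp (@normr_measurable R setT) (mm x)).
  - exact: measurable_fun_pair2.
  move=> t _; rewrite patchE /K /W /weighted_power /= !indicE; case: ifPn => [|_].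
    rewrite inE/= in_itv/= => /andP[t0 ts]; rewrite mulr1 mem_set ?mul1r//.
    apply: (cube_between cQ Qx Qxs) => i; left; rewrite !addZeE.
    by case: ifP => _; rewrite ?addr0 ?lexx// lerDl lerD2l t0.
  by rewrite mulr0.
rewrite ge0_integralZl//; last 2 first.
- by move=> x _; exact: integral_ge0.
- by rewrite lee_fin powR_ge0.
rewrite (@fubini_tonelli _ _ _ _ _ bmu leb K mK K0).
have inner t : \int[bmu]_x K (x, t) =
    (\int[bmu]_(x in [set: Bn]) (W x)%:E) * (\1_(`[0%R, s]%classic) t)%:E.
  pose Wt (x : Bn) := (W (x + t *: e_ j)%R)%:E.
  have Wt0 x : [set: Bn] x -> 0 <= Wt x by rewrite lee_fin weighted_power_ge0.
  have mWt : measurable_fun [set: Bn] Wt.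
    apply/measurable_EFinP.
    exact: (measurableT_comp mW (measurable_addrV (t *: e_ j))).
  have I0 : 0 <= (\1_(`[0%R, s]%classic) t)%:E :> \bar R by rewrite lee_fin.
  transitivity (\int[bmu]_(x in [set: Bn]) (Wt x * (\1_(`[0%R, s]%classic) t)%:E)).
    by apply: eq_integral => x _; rewrite -EFinM.
  transitivity (\int[bmu]_(x in [set: Bn]) Wt x * (\1_(`[0%R, s]%classic) t)%:E).
    exact: (ge0_integralZr _ _ mWt Wt0 I0).
  have mEW : measurable_fun [set: Bn] (EFin \o W : Bn -> \bar R).
    exact/measurable_EFinP.
  have T : \int[bmu]_(x in [set: Bn]) Wt x = \int[bmu]_(x in [set: Bn]) (EFin \o W) x.
    exact: integral_translate mEW.
  by rewrite T.
under eq_integral do rewrite inner.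
rewrite ge0_integralZl//; last 2 first.
- by apply/measurable_EFinP; exact: measurable_indic.
- by apply: integral_ge0 => x _; rewrite lee_fin weighted_power_ge0.
rewrite integral_indic// setIT [X in _ * (_ * X)]leb0s muleC -muleA -EFinM.
have -> : (s * s `^ (q - 1) = s `^ q)%R.
  rewrite -[X in (X * _)%R]powRr1 ?(ltW s0)// -powRD; last by rewrite (gt_eqF s0) implybT.
  by congr powR; ring.
by rewrite muleC.
Qed.

(** For s < 0, the translation by s e_j exchanges the two end points. *)
Lemma axis_difference j F G l Q s q :
  loc_integrable F -> loc_integrable G -> weak_partial j F G ->
  is_cube l Q -> (1 <= q)%R ->
  \int[bmu]_(x in [set: Bn])
    (\1_Q x * \1_Q (x + s *: e_ j) * `|F (x + s *: e_ j) - F x| `^ q)%R%:E <=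
  (`|s| `^ q)%:E * \int[bmu]_(x in [set: Bn]) (weighted_power q Q G x)%:E.
Proof.
move=> Floc Gloc FG cQ q1; have [[mF _] [mG _]] := (Floc, Gloc).
have mQ := measurable_cube cQ.
have m1Q : measurable_fun [set: Bn] (\1_Q : Bn -> R) by exact: measurable_indic.
have [s0|s0|->] := ltgtP s 0%R.
- have ns0 : (0 < - s)%R by rewrite oppr_gt0.
  have := axis_difference_pos Floc Gloc FG cQ q1 ns0.
  pose f (x : V) :=
    (\1_Q x * \1_Q (x + - s *: e_ j) * `|F (x + - s *: e_ j) - F x| `^ q)%R%:E.
  have mf : measurable_fun [set: Bn] (f : Bn -> \bar R).
    apply/measurable_EFinP; apply: measurable_funM.
      apply: measurable_funM => //.
      exact: (measurableT_comp m1Q (measurable_addrV (- s *: e_ j))).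
    apply: (@measurable_normpow q (fun x => F (x + - s *: e_ j) - F x)%R).
    apply: measurable_funB => //.
    exact: (measurableT_comp mF (measurable_addrV (- s *: e_ j))).
  have -> : (`|s| = - s)%R by rewrite ltr0_norm.
  apply: le_trans.
  have T := integral_translate (s *: e_ j) mf.
  rewrite le_eqVlt; apply/orP; left; apply/eqP.
  transitivity (\int[bmu]_(x in [set: Bn]) f (x + s *: e_ j)%R); last exact: T.
  apply: eq_integral => x _.
  rewrite /f scaleNr addrK distrC; congr (_%:E).
  by rewrite [in RHS](mulrC (\1_Q _)).
- have -> : (`|s| = s)%R by rewrite gtr0_norm.
  exact: (axis_difference_pos Floc Gloc FG cQ q1 s0).
- apply: (@le_trans _ _ 0); last first.
    apply: mule_ge0; first by rewrite lee_fin powR_ge0.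
    by apply: integral_ge0 => x _; rewrite lee_fin weighted_power_ge0.
  rewrite le_eqVlt; apply/orP; left; apply/eqP.
  have q0 : (q != 0)%R by rewrite gt_eqF// (lt_le_trans ltr01).
  under eq_integral do rewrite scale0r addr0 subrr normr0 powR0// mulr0.
  by rewrite integral0.
Qed.

End difference_quotients.

(** * Differences inside a cube, in all directions *)

Section enorm.
Context {R : realType} {m : nat}.
Local Notation V := 'rV[R]_m.+1.
Implicit Types (x z : V).

Lemma enorm_ge0 z : 0 <= enorm z.
Proof. exact: sqrtr_ge0. Qed.

Lemma enormN z : enorm (- z) = enorm z.
Proof. by congr Num.sqrt; apply: eq_bigr => i _; rewrite mxE sqrrN. Qed.

Lemma norm_coord_le_enorm z i : `|z ord0 i| <= enorm z.
Proof.
rewrite -sqrtr_sqr ler_sqrt ?sumr_ge0// => [|k _]; last exact: sqr_ge0.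
by rewrite (bigD1 i)//= lerDl sumr_ge0// => k _; exact: sqr_ge0.
Qed.

Lemma enorm_le z l : (forall i, `|z ord0 i| <= l) -> enorm z <= m.+1%:R * l.
Proof.
move=> zl; have l0 : 0 <= l by exact: le_trans (zl ord0).
rewrite -[leRHS]ger0_norm ?mulr_ge0// -sqrtr_sqr ler_sqrt ?sqr_ge0//.
apply: (@le_trans _ _ (\sum_(i < m.+1) l ^+ 2)).
  by apply: ler_sum => i _; rewrite -real_normK ?num_real// lerXn2r ?nnegrE.
rewrite sumr_const card_ord -[l ^+ 2 *+ _]mulr_natl exprMn ler_wpM2r ?sqr_ge0//.
by rewrite expr2 ler_peMl// ler1n.
Qed.

Lemma measurable_enorm :
  measurable_fun [set: borel_rV R m] (@enorm R m : borel_rV R m -> R).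
Proof.
apply: (measurableT_comp (continuous_measurable_fun (@sqrt_continuous R))).
apply: measurable_sum => i.
by apply: measurable_funX; exact: measurable_coord_borel.
Qed.

End enorm.

Section path_difference.
Local Open Scope ereal_scope.
Context {R : realType} {m : nat}.
Local Notation V := 'rV[R]_m.+1.
Local Notation Bn := (borel_rV R m).
Local Notation bmu := (@borel_mu R m).
Local Notation e_ j := (delta_mx ord0 j : V).
Implicit Types (a b x z : V) (F : V -> R) (Q : set V) (s t q : R).

Definition truncate (k : nat) z : V := \row_i (if (i < k)%N then z ord0 i else 0%R).

Lemma truncate0 z : truncate 0 z = 0%R.
Proof. by apply/rowP => i; rewrite !mxE. Qed.

Lemma truncate_full z : truncate m.+1 z = z.
Proof. by apply/rowP => i; rewrite !mxE ltn_ord. Qed.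

Lemma truncateS (i : 'I_m.+1) z : truncate i.+1 z = (truncate i z + z ord0 i *: e_ i)%R.
Proof.
apply/rowP => j; rewrite addZeE !mxE ltnS leq_eqVlt -(inj_eq val_inj j i)/=.
by case: (ltngtP j i) => [ji|ji|/val_inj ->]; rewrite ?addr0 ?add0r.
Qed.

Lemma truncate_cube l Q x z k : is_cube l Q -> Q x -> Q (x + z)%R ->
  Q (x + truncate k z)%R.
Proof.
move=> cQ Qx Qxz; apply: (cube_between cQ Qx Qxz) => i; rewrite !mxE.
by case: ifP => _; case: (lerP 0%R (z ord0 i)) => z0; [left|right|left|right];
  apply/andP; split; lra.
Qed.

Lemma powR_sum_le (f : 'I_m.+1 -> R) q : (forall i, 0 <= f i)%R -> (0 <= q)%R ->
  ((\sum_i f i) `^ q <= m.+1%:R `^ q * \sum_i f i `^ q)%R.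
Proof.
move=> f0 q0; have [i0 _ fi0] := @Order.TotalTheory.arg_maxP _ _ _ ord0 xpredT f erefl.
apply: (@le_trans _ _ ((m.+1%:R * f i0) `^ q)%R).
  apply: ge0_ler_powR; rewrite ?nnegrE ?mulr_ge0 ?sumr_ge0//.
  rewrite mulr_natl -[X in (_ *+ X)%R]card_ord -sumr_const.
  by apply: ler_sum => i _; exact: fi0.
rewrite powRM// ler_wpM2l ?powR_ge0// (bigD1 i0)//= lerDl.
by apply: sumr_ge0 => i _; exact: powR_ge0.
Qed.

(** Telescoping along the axis-parallel path that changes the coordinates one at
    a time; the path does not leave the cube. *)
Lemma path_difference F (G : 'I_m.+1 -> V -> R) l Q q z :
  loc_integrable F -> (forall j, loc_integrable (G j)) ->
  (forall j, weak_partial j F (G j)) -> is_cube l Q -> (1 <= q)%R ->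
  \int[bmu]_(x in [set: Bn])
    (\1_Q x * \1_Q (x + z) * `|F (x + z) - F x| `^ q)%R%:E <=
  ((m.+1%:R `^ q * enorm z `^ q)%R)%:E *
    \sum_(j < m.+1) \int[bmu]_(x in [set: Bn]) (weighted_power q Q (G j) x)%:E.
Proof.
move=> Floc Gloc FG cQ q1; have [mF _] := Floc.
have q0 : (0 <= q)%R by lra.
have mQ := measurable_cube cQ.
have m1Q : measurable_fun [set: Bn] (\1_Q : Bn -> R) by exact: measurable_indic.
pose h (j : 'I_m.+1) (y : V) : R :=
  (\1_Q y * \1_Q (y + z ord0 j *: e_ j) *
   `|F (y + z ord0 j *: e_ j) - F y| `^ q)%R.
have h0 j y : (0 <= h j y)%R by rewrite mulr_ge0// ?powR_ge0// mulr_ge0.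
have mh j : measurable_fun [set: Bn] (h j : Bn -> R).
  apply: measurable_funM.
    apply: measurable_funM => //.
    exact: (measurableT_comp m1Q (measurable_addrV (z ord0 j *: e_ j))).
  apply: (@measurable_normpow _ _ q (fun x => F (x + z ord0 j *: e_ j) - F x)%R).
  apply: measurable_funB => //.
  exact: (measurableT_comp mF (measurable_addrV (z ord0 j *: e_ j))).
pose hx (j : 'I_m.+1) (x : Bn) := (h j (x + truncate j z)%R)%:E.
have mhx j : measurable_fun [set: Bn] (hx j).
  apply/measurable_EFinP.
  exact: (measurableT_comp (mh j) (measurable_addrV (truncate j z))).
have hx0 j x : [set: Bn] x -> 0 <= hx j x by rewrite lee_fin h0.
have n0 : 0 <= (m.+1%:R `^ q)%R%:E :> \bar R by rewrite lee_fin powR_ge0.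
apply: (@le_trans _ _ (\int[bmu]_(x in [set: Bn])
    ((m.+1%:R `^ q)%R%:E * \sum_(j < m.+1) hx j x))).
  apply: ge0_le_integral => //.
  - apply/measurable_EFinP; apply: measurable_funM.
      apply: measurable_funM => //.
      exact: (measurableT_comp m1Q (measurable_addrV z)).
    apply: (@measurable_normpow _ _ q (fun x => F (x + z) - F x)%R).
    apply: measurable_funB => //.
    exact: (measurableT_comp mF (measurable_addrV z)).
  - by apply: measurable_funeM; exact: emeasurable_sum.
  move=> x _; rewrite /hx sumEFin -EFinM lee_fin.
  have rhs0 : (0 <= m.+1%:R `^ q * \sum_(j < m.+1) h j (x + truncate j z))%R.
    by rewrite mulr_ge0 ?powR_ge0// sumr_ge0.
  rewrite !indicE; have [Qx|_] := boolP (x \in Q); last by rewrite !mul0r.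
  have [Qxz|_] := boolP ((x + z)%R \in Q); last by rewrite mulr0 mul0r.
  rewrite !mul1r; rewrite !inE in Qx Qxz.
  have -> : (\sum_(j < m.+1) h j (x + truncate j z) = \sum_(j < m.+1)
      `|F (x + truncate j.+1 z) - F (x + truncate j z)| `^ q)%R.
    apply: eq_bigr => j _; rewrite /h -addrA -truncateS !indicE.
    by rewrite !mem_set ?mul1r//; apply: truncate_cube cQ Qx Qxz.
  apply: le_trans (powR_sum_le _ q0) => //.
  apply: ge0_ler_powR; rewrite ?nnegrE ?sumr_ge0//.
  have -> : (F (x + z) - F x = \sum_(j < m.+1)
      (F (x + truncate j.+1 z) - F (x + truncate j z)))%R.
    rewrite -(big_mkord xpredT (fun j => F (x + truncate j.+1 z) - F (x + truncate j z))%R).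
    by rewrite telescope_sumr// truncate_full truncate0 addr0.
  exact: ler_norm_sum.
have -> : \int[bmu]_(x in [set: Bn]) ((m.+1%:R `^ q)%R%:E * \sum_(j < m.+1) hx j x) =
    (m.+1%:R `^ q)%R%:E * \int[bmu]_(x in [set: Bn]) (\sum_(j < m.+1) hx j x).
  apply: ge0_integralZl => //; first exact: emeasurable_sum.
  by move=> x _; apply: sume_ge0 => j _; exact: hx0.
rewrite EFinM -muleA; apply: lee_pmul => //.
  by apply: integral_ge0 => x _; apply: sume_ge0 => j _; exact: hx0.
have -> : \int[bmu]_(x in [set: Bn]) (\sum_(j < m.+1) hx j x) =
    \sum_(j < m.+1) \int[bmu]_(x in [set: Bn]) hx j x.
  by rewrite ge0_integral_sum.
rewrite ge0_sume_distrr; last first.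
  by move=> j _; apply: integral_ge0 => x _; rewrite lee_fin weighted_power_ge0.
apply: lee_sum => j _.
have mEh : measurable_fun [set: Bn] (EFin \o h j : Bn -> \bar R) by exact/measurable_EFinP.
have -> : \int[bmu]_(x in [set: Bn]) hx j x = \int[bmu]_(x in [set: Bn]) (h j x)%:E.
  exact: (integral_translate (truncate j z) mEh).
apply: le_trans (axis_difference (z ord0 j) Floc (Gloc j) (FG j) cQ q1) _.
apply: lee_wpmul2r.
  by apply: integral_ge0 => x _; rewrite lee_fin weighted_power_ge0.
rewrite lee_fin; apply: ge0_ler_powR; rewrite ?nnegrE ?enorm_ge0//.
exact: norm_coord_le_enorm.
Qed.

End path_difference.

(** * Integrability of the kernel *)

Section kernel.
Context {R : realType} {m : nat}.
Local Notation V := 'rV[R]_m.+1.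
Local Notation Bn := (borel_rV R m).
Local Notation bmu := (@borel_mu R m).
Implicit Types (x z : V) (l q r : R).

Definition centered_cube l : set V := closed_box (const_mx (- l)) (const_mx l).

Lemma centered_cubeP l z : centered_cube l z <-> forall i, `|z ord0 i| <= l.
Proof. by split=> h i; have := h i; rewrite !mxE ler_norml. Qed.

Lemma borel_mu_centered_cube l : 0 < l ->
  (bmu (centered_cube l) <= ((2 * l) ^+ m.+1)%:E)%E.
Proof.
move=> l0; have c : is_cube (2 * l) (centered_cube l).
  split; first lra.
  exists (const_mx (- l)), (fun=> true), (fun=> false).
  apply/seteqP; split => x h i; have := h i; rewrite !mxE in_itv/=;
    by rewrite (_ : - l + 2 * l = l)//; ring.
rewrite (borel_mu_cube c) lee_fin ler_piMl ?unit_mass_le1// exprn_ge0//.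
by rewrite mulr_ge0// ltW.
Qed.

(** This is |z|^(q - kappa) off the origin, in the form in which the bound on
    differences and the weight produce it. *)
Definition kernel (q kappa : R) z : R := enorm z `^ q * (enorm z `^ kappa)^-1.

Lemma kernel_ge0 q kappa z : 0 <= kernel q kappa z.
Proof. by rewrite mulr_ge0 ?invr_ge0 ?powR_ge0. Qed.

Lemma measurable_kernel q kappa :
  measurable_fun [set: Bn] (kernel q kappa : Bn -> R).
Proof.
have me := @measurable_enorm R m.
apply: measurable_funM; first exact: (measurableT_comp (measurable_powR q) me).
under eq_fun do rewrite -powRN.
exact: (measurableT_comp (measurable_powR (- kappa)) me).
Qed.

Lemma geometric_eseries_le (A x : R) : 0 <= A -> 0 <= x < 1 ->
  (\sum_(k <oo) (A * x ^+ k)%:E <= (A / (1 - x))%:E)%E.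
Proof.
move=> A0 /andP[x0 x1]; apply: lime_le.
  by apply: is_cvg_nneseries => k _ _; rewrite lee_fin mulr_ge0 ?exprn_ge0.
apply: nearW => n; rewrite sumEFin lee_fin -mulr_sumr big_mkord ler_wpM2l//.
have x1' : 0 < 1 - x by rewrite subr_gt0.
rewrite -div1r ler_pdivlMr//.
have -> : (\sum_(i < n) x ^+ i) * (1 - x) = 1 - x ^+ n.
  by rewrite -[RHS]opprB subrX1; ring.
by rewrite gerBl exprn_ge0.
Qed.

(** Dyadic shells: on the k-th one, |z| is comparable to r 2^-k. *)
Lemma dyadic_shell r (rho : R) : 0 < rho -> rho <= r ->
  exists k : nat, r * 2^-1 ^+ k.+1 < rho <= r * 2^-1 ^+ k.
Proof.
move=> rho0 rhor; have r0 : 0 < r by exact: lt_le_trans rhor.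
have ex : exists k : nat, r * 2^-1 ^+ k.+1 < rho.
  have [k] : exists k : nat, r / rho < 2 ^+ k.
    exists (Num.truncn (r / rho)).+1; apply: lt_le_trans (truncnS_gt _) _.
    by rewrite -natrX ler_nat ltnW// ltn_expl.
  rewrite ltr_pdivrMr// => h; exists k.
  rewrite exprVn ltr_pdivrMr ?exprn_gt0// exprS.
  apply: lt_le_trans h _; rewrite mulrC mulrCA ler_peMl ?mulr_ge0 ?exprn_ge0 ?(ltW rho0)//; lra.
exists (ex_minn ex); case: ex_minnP => k kP mink; rewrite kP/=.
case: k kP mink => [|k] kP mink; first by rewrite expr0 mulr1.
by rewrite leNgt; apply/negP => /mink; rewrite ltnn.
Qed.

Lemma powR_shell (e r rho : R) : 0 < r -> r / 2 < rho <= r ->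
  rho `^ e <= 2 `^ `|e| * r `^ e.
Proof.
move=> r0 /andP[r2 rr]; have rho0 : 0 < rho by lra.
have [e0|e0] := leP 0 e.
  apply: (@le_trans _ _ (r `^ e)).
    by apply: ge0_ler_powR; rewrite ?nnegrE//; exact: ltW.
  have : (2 : R) `^ 0 <= 2 `^ `|e| by apply: ler_powR; rewrite ?ler1n.
  by rewrite powRr0 => h; rewrite ler_peMl// powR_ge0.
have -> : e = - `|e| by rewrite ltr0_norm// opprK.
rewrite normrN normr_id; set f := `|e|; have f0 : 0 <= f by exact: normr_ge0.
rewrite !powRN ler_pdivlMr ?powR_gt0// mulrC ler_pdivrMr ?powR_gt0//.
rewrite -powRM//; last exact: ltW.
by apply: ge0_ler_powR; rewrite ?nnegrE//; lra.
Qed.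

(** The kernel at z is at most the term of the shell that contains z. *)
Lemma kernel_le_series q kappa l z (r := fun k => m.+1%:R * l * 2^-1 ^+ k) :
  0 < q -> 0 < l -> centered_cube l z ->
  ((kernel q kappa z)%:E <= \sum_(k <oo)
    (2 `^ `|q - kappa| * r k `^ (q - kappa) * \1_(centered_cube (r k)) z)%:E)%E.
Proof.
move=> q0 l0 /centered_cubeP zl.
have u0 k : (0 <= (2 `^ `|q - kappa| * r k `^ (q - kappa) *
    \1_(centered_cube (r k)) z)%:E)%E.
  by rewrite lee_fin mulr_ge0// mulr_ge0 ?powR_ge0.
have [z0|z0] := eqVneq (enorm z) 0.
  rewrite /kernel z0 powR0 ?gt_eqF// mul0r.
  exact: nneseries_ge0.
have rho0 : 0 < enorm z by rewrite lt0r z0 enorm_ge0.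
have [k /andP[klo khi]] := dyadic_shell rho0 (enorm_le zl).
rewrite (nneseriesD1 (n := k))//; apply: le_trans (leeDl _ _); last first.
  by apply: nneseries_ge0 => i _ _; exact: u0.
rewrite lee_fin indicE mem_set ?mulr1; last first.
  by apply/centered_cubeP => i; apply: le_trans khi; exact: norm_coord_le_enorm.
have r0 : 0 < r k by rewrite /r !mulr_gt0// exprn_gt0// invr_gt0.
have -> : kernel q kappa z = enorm z `^ (q - kappa).
  by rewrite /kernel powRB// z0 implybT.
apply: powR_shell => //; rewrite khi andbT; apply: le_lt_trans klo.
by rewrite /r exprSr mulrA.
Qed.

(** The k-th shell contributes a constant times (l 2^-k)^(q - kappa + n), and
    these contributions form a geometric series. *)
Lemma kernel_integral_le q kappa : 0 < q -> 0 < q - kappa + m.+1%:R ->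
  exists2 C, 0 <= C & forall l, 0 < l ->
    (\int[bmu]_(z in [set: Bn]) (\1_(centered_cube l) z * kernel q kappa z)%:E <=
     (C * l `^ (q - kappa + m.+1%:R))%:E)%E.
Proof.
set e := q - kappa => q0; set b := e + m.+1%:R => b0.
pose x : R := 2^-1 `^ b.
have x01 : 0 <= x < 1.
  have : x < 1 `^ b.
    by apply: gt0_ltr_powR => //; rewrite ?nnegrE ?invr_ge0//; lra.
  by rewrite powR1 powR_ge0.
pose A : R := 2 `^ `|e| * 2 ^+ m.+1 * m.+1%:R `^ b.
have A0 : 0 <= A by rewrite !mulr_ge0 ?powR_ge0 ?exprn_ge0.
exists (A / (1 - x)); first by rewrite divr_ge0//; lra.
move=> l l0; pose r k := m.+1%:R * l * 2^-1 ^+ k : R.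
have r0 k : 0 < r k by rewrite /r !mulr_gt0// exprn_gt0// invr_gt0.
pose f (k : nat) (z : Bn) : \bar R :=
  (2 `^ `|e| * r k `^ e * \1_(centered_cube (r k)) z)%:E.
have mcube s : measurable (centered_cube s : set Bn) by exact: measurable_closed_box.
have mf k : measurable_fun [set: Bn] (f k).
  by apply/measurable_EFinP; apply: measurable_funM => //; exact: measurable_indic.
have f0 k z : [set: Bn] z -> (0 <= f k z)%E.
  by move=> _; rewrite lee_fin mulr_ge0// mulr_ge0 ?powR_ge0.
apply: (@le_trans _ _ (\int[bmu]_(z in [set: Bn]) (\sum_(k <oo) f k z))%E).
  apply: ge0_le_integral => //.
  - by move=> z _; rewrite lee_fin mulr_ge0// kernel_ge0.
  - apply/measurable_EFinP; apply: measurable_funM; last exact: measurable_kernel.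
    exact: measurable_indic.
  - by apply: ge0_emeasurable_sum => // k z _ _; exact: f0.
  move=> z _; rewrite indicE; have [|_] := boolP (z \in _); last first.
    by rewrite mul0r; apply: nneseries_ge0 => k _ _; exact: f0.
  by rewrite inE mul1r => zl; exact: kernel_le_series.
rewrite integral_nneseries//.
apply: (@le_trans _ _ (\sum_(k <oo) (A * l `^ b * x ^+ k)%:E)%E).
  apply: lee_nneseries => [k _ _|k _]; first by apply: integral_ge0 => z; exact: f0.
  rewrite /f; under eq_integral do rewrite EFinM.
  rewrite ge0_integralZl//; last 2 first.
    by apply/measurable_EFinP; exact: measurable_indic.
    by rewrite lee_fin mulr_ge0 ?powR_ge0.
  rewrite integral_indic// setIT.
  apply: le_trans (lee_wpmul2l _ (borel_mu_centered_cube (r0 k))) _.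
    by rewrite lee_fin mulr_ge0 ?powR_ge0.
  rewrite -EFinM lee_fin le_eqVlt; apply/orP; left; apply/eqP.
  have -> : x ^+ k = (2^-1 ^+ k) `^ b.
    rewrite /x -(powR_mulrn k (powR_ge0 _ _)) powRAC; congr powR.
    by rewrite powR_mulrn// invr_ge0.
  rewrite /A exprMn.
  have -> : 2 `^ `|e| * r k `^ e * (2 ^+ m.+1 * r k ^+ m.+1) =
      2 `^ `|e| * 2 ^+ m.+1 * (r k `^ e * r k ^+ m.+1) by ring.
  rewrite -[r k ^+ m.+1]powR_mulrn ?(ltW (r0 k))// -powRD; last first.
    by rewrite (gt_eqF (r0 k)) implybT.
  rewrite -/b /r powRM ?mulr_ge0 ?(ltW l0) ?exprn_ge0 ?invr_ge0//.
  by rewrite powRM ?(ltW l0)// !mulrA.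
apply: le_trans (geometric_eseries_le _ x01) _.
  by rewrite mulr_ge0 ?powR_ge0.
by rewrite lee_fin mulrAC.
Qed.

End kernel.

(** * Estimates on one cube *)

Section local_estimate.
Local Open Scope ereal_scope.
Context {R : realType} {m : nat}.
Local Notation V := 'rV[R]_m.+1.
Local Notation Bn := (borel_rV R m).
Local Notation bmu := (@borel_mu R m).
Implicit Types (x y z : V) (F : V -> R) (Q : set V) (q l : R).

Lemma measurable_addV : measurable_fun [set: Bn * Bn]
  ((fun p : Bn * Bn => ((p.1 : V) + p.2)%R) : Bn * Bn -> Bn).
Proof.
apply: measurable_fun_rV => i; under eq_fun do rewrite mxE.
apply: measurable_funD; apply: (measurableT_comp (@measurable_coord_borel R m i)).
  exact: measurable_fst.
exact: measurable_snd.
Qed.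

Lemma cube_difference l Q x z : is_cube l Q -> Q x -> Q (x + z)%R ->
  centered_cube l z.
Proof.
move=> cQ; have [a [_ Qa]] := cube_sandwich cQ; move=> /Qa xa /Qa xza.
apply/centered_cubeP => i; have := xa i; have := xza i; rewrite mxE.
by move=> /andP[? ?] /andP[? ?]; rewrite ler_norml; apply/andP; split; lra.
Qed.

(** Substituting y = x + z and exchanging the integrals leaves, for each z, the
    differences bounded by [path_difference]; only increments of points of Q
    contribute. *)
Lemma local_estimate (alpha q : R) : (alpha < 1)%R -> (1 <= q)%R ->
  exists2 C : R, (0 <= C)%R &
  forall F (G : 'I_m.+1 -> V -> R), loc_integrable F ->
    (forall j, loc_integrable (G j)) -> (forall j, weak_partial j F (G j)) ->
  forall l Q, is_cube l Q ->
  \int[bmu]_(x in (Q : set Bn)) \int[bmu]_(y in (Q : set Bn))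
    (`|F x - F y| `^ q * (enorm (x - y) `^ (m.+1%:R + q * alpha))^-1)%R%:E <=
  (C * l `^ (q - q * alpha))%R%:E *
    \sum_(j < m.+1) \int[bmu]_(x in [set: Bn]) (weighted_power q Q (G j) x)%:E.
Proof.
move=> a1 q1; set kappa := (m.+1%:R + q * alpha)%R.
have q0 : (0 < q)%R by lra.
have qk : (q - kappa + m.+1%:R = q - q * alpha)%R by rewrite /kappa; ring.
have qk0 : (0 < q - kappa + m.+1%:R)%R.
  by rewrite qk -[X in (X - _)%R]mulr1 -mulrBr mulr_gt0// subr_gt0.
have [C C0 HC] := kernel_integral_le (m := m) q0 qk0.
exists (m.+1%:R `^ q * C)%R; first by rewrite mulr_ge0 ?powR_ge0.
move=> F G Floc Gloc FG l Q cQ; have [mF _] := Floc.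
have l0 : (0 < l)%R by case: cQ.
have mQ := measurable_cube cQ.
have m1Q : measurable_fun [set: Bn] (\1_Q : Bn -> R) by exact: measurable_indic.
set S := \sum_(j < m.+1) _.
have S0 : 0 <= S.
  by apply: sume_ge0 => j _; apply: integral_ge0 => x _;
    rewrite lee_fin weighted_power_ge0.
pose h (x z : V) : R := (\1_Q x * \1_Q (x + z) * `|F (x + z) - F x| `^ q)%R.
have h0 x z : (0 <= h x z)%R by rewrite mulr_ge0// ?powR_ge0// mulr_ge0.
pose k (z : V) : R := (enorm z `^ kappa)^-1%R.
have k0 z : (0 <= k z)%R by rewrite invr_ge0 powR_ge0.
have mk : measurable_fun [set: Bn] (k : Bn -> R).
  rewrite /k; under eq_fun do rewrite -powRN.
  exact: (measurableT_comp (measurable_powR (- kappa)) (@measurable_enorm R m)).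
have mh : measurable_fun [set: Bn * Bn] (fun p : Bn * Bn => h p.1 p.2).
  have mFp : measurable_fun [set: Bn * Bn] (fun p : Bn * Bn => F ((p.1 : V) + p.2)%R).
    exact: (measurableT_comp mF measurable_addV).
  have mF1 : measurable_fun [set: Bn * Bn] (fun p : Bn * Bn => F p.1).
    exact: (measurableT_comp mF measurable_fst).
  apply: measurable_funM; first apply: measurable_funM.
  - exact: (measurableT_comp m1Q measurable_fst).
  - exact: (measurableT_comp m1Q measurable_addV).
  apply: (measurableT_comp (measurable_powR q)).
  apply: (measurableT_comp (@normr_measurable R setT)).
  exact: measurable_funB.
pose Psi (p : Bn * Bn) : \bar R := (h p.1 p.2 * k p.2)%:E.
have Psi0 p : 0 <= Psi p by rewrite lee_fin mulr_ge0.
have mPsi : measurable_fun [set: Bn * Bn] Psi.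
  apply/measurable_EFinP; apply: measurable_funM => //.
  exact: (measurableT_comp mk measurable_snd).
have -> : \int[bmu]_(x in (Q : set Bn)) \int[bmu]_(y in (Q : set Bn))
    (`|F x - F y| `^ q * (enorm (x - y) `^ kappa)^-1)%R%:E =
    \int[bmu]_x \int[bmu]_z Psi (x, z).
  rewrite integral_mkcond; apply: eq_integral => x _; rewrite patchE.
  case: ifPn => [|/negP xQ]; last first.
    rewrite integral0_eq// => z _; rewrite /Psi /h /= indicE.
    by case: (boolP (_ \in _)) => // _; rewrite !mul0r.
  rewrite inE => Qx; rewrite integral_mkcond.
  pose f (y : V) : \bar R := (\1_Q y * (`|F x - F y| `^ q * k (x - y)))%R%:E.
  have mf : measurable_fun [set: Bn] (f : Bn -> \bar R).
    apply/measurable_EFinP; apply: measurable_funM => //; apply: measurable_funM.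
      apply: (@measurable_normpow _ _ q (fun y => F x - F y)%R).
      exact: measurable_funB.
    have -> : (fun y : Bn => k (x - y)%R) = fun y : Bn => k ((y : V) + - x)%R.
      by apply/funext => y; rewrite /k -enormN opprB.
    exact: (measurableT_comp mk (measurable_addrV (- x))).
  transitivity (\int[bmu]_(y in [set: Bn]) f y).
    apply: eq_integral => y _; rewrite patchE /f indicE.
    by case: ifP => _; rewrite ?mul1r ?mul0r.
  transitivity (\int[bmu]_(z in [set: Bn]) f (z + x)%R).
    exact: (esym (integral_translate x mf)).
  apply: eq_integral => z _; rewrite /f /Psi /h /=; congr (_%:E).
  rewrite [X in \1_Q X]addrC (addrC z x) indicE [in RHS]indicE (mem_set Qx) mul1r.
  rewrite -mulrA distrC; congr (_ * (_ * _))%R.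
  by rewrite /k -enormN; congr ((enorm _ `^ _)^-1)%R; rewrite opprB addrAC subrr add0r.
rewrite (@fubini_tonelli _ _ _ _ _ bmu bmu Psi mPsi Psi0).
pose a (z : Bn) : \bar R := (\1_(centered_cube l) z * kernel q kappa z)%:E.
have a0 z : [set: Bn] z -> 0 <= a z by rewrite lee_fin mulr_ge0// kernel_ge0.
have ma : measurable_fun [set: Bn] a.
  apply/measurable_EFinP; apply: measurable_funM; last exact: measurable_kernel.
  by apply: measurable_indic; exact: measurable_closed_box.
have nS0 : 0 <= (m.+1%:R `^ q)%:E * S by rewrite mule_ge0// lee_fin powR_ge0.
apply: (@le_trans _ _ (\int[bmu]_(z in [set: Bn]) (a z * ((m.+1%:R `^ q)%:E * S)))).
  apply: ge0_le_integral => //.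
  - by move=> z _; apply: integral_ge0 => x _; exact: Psi0.
  - exact: (@measurable_fun_fubini_tonelli_G _ _ _ _ _ bmu _ mPsi Psi0).
  - by apply: emeasurable_funM => //; exact: measurable_cst.
  move=> z _; rewrite /a indicE; have [zl|/negP zl] := boolP (z \in _); last first.
    rewrite mul0r mul0e integral0_eq// => x _; rewrite /Psi /h /= !indicE.
    case: (boolP (x \in Q)) => [|_]; last by rewrite !mul0r.
    rewrite inE => Qx; case: (boolP (_ \in Q)) => [|_]; last by rewrite mulr0 !mul0r.
    by rewrite inE => Qxz; case: zl; rewrite inE; exact: cube_difference cQ Qx Qxz.
  rewrite mul1r /Psi /=; under eq_integral do rewrite EFinM.
  pose hz (x : Bn) : \bar R := (h x z)%:E.
  have mhz : measurable_fun [set: Bn] hz.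
    by apply/measurable_EFinP; exact: (measurable_fun_pair1 (z : Bn) mh).
  have hz0 x : [set: Bn] x -> 0 <= hz x by rewrite lee_fin.
  have kz0 : 0 <= (k z)%:E by rewrite lee_fin.
  have -> : \int[bmu]_x (hz x * (k z)%:E) = \int[bmu]_x hz x * (k z)%:E.
    exact: (ge0_integralZr _ _ mhz hz0 kz0).
  apply: le_trans (lee_wpmul2r kz0 (path_difference z Floc Gloc FG cQ q1)) _.
  rewrite le_eqVlt; apply/orP; left; apply/eqP.
  rewrite -/S muleAC -EFinM [RHS]muleA -[in RHS]EFinM.
  have -> // : (m.+1%:R `^ q * enorm z `^ q * k z = kernel q kappa z * m.+1%:R `^ q)%R.
  by rewrite /kernel -/(k z); ring.
have -> : \int[bmu]_(z in [set: Bn]) (a z * ((m.+1%:R `^ q)%:E * S)) =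
    \int[bmu]_(z in [set: Bn]) a z * ((m.+1%:R `^ q)%:E * S).
  exact: (ge0_integralZr _ _ ma a0 nS0).
apply: le_trans (lee_wpmul2r nS0 (HC l l0)) _.
by rewrite qk muleA -EFinM; apply: lee_wpmul2r => //; rewrite lee_fin mulrC mulrA.
Qed.

End local_estimate.

Section cube_terms.
Local Open Scope ereal_scope.
Context {R : realType} {m : nat}.
Local Notation V := 'rV[R]_m.+1.
Local Notation Bn := (borel_rV R m).
Local Notation bmu := (@borel_mu R m).
Implicit Types (x y z : V) (F N : V -> R) (Q : set V) (q l gamma : R).

Lemma weighted_power_le (G : 'I_m.+1 -> V -> R) N l Q q gamma :
  (forall j, measurable_fun [set: Bn] (G j : Bn -> R)) ->
  measurable_fun [set: Bn] (N : Bn -> R) -> (forall j x, `|G j x| <= N x)%R ->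
  is_cube l Q -> (1 <= q)%R -> (q <= gamma)%R ->
  \sum_(j < m.+1) \int[bmu]_(x in [set: Bn]) (weighted_power q Q (G j) x)%:E <=
  (m.+1%:R * (@unit_mass R m * l ^+ m.+1) `^ (1 - q / gamma))%R%:E *
    (\int[bmu]_(x in (Q : set Bn)) (N x `^ gamma)%:E) `^ (q / gamma).
Proof.
move=> mG mN GN cQ q1 qg; have mQ := measurable_cube cQ.
have q0 : (0 < q)%R by lra.
have g0 : (0 < gamma)%R by lra.
have N0 x : (0 <= N x)%R by exact: le_trans (GN ord0 x).
set v := (unit_mass * l ^+ m.+1)%R.
have v0 : (0 <= v)%R.
  by rewrite mulr_ge0 ?unit_mass_ge0// exprn_ge0//; case: cQ => /ltW.
set T := \int[bmu]_(x in (Q : set Bn)) (N x `^ gamma)%:E.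
have T0 : 0 <= T by apply: integral_ge0 => x _; rewrite lee_fin powR_ge0.
have mNq : measurable_fun [set: Bn] ((fun x => N x `^ q)%R : Bn -> R).
  exact: (measurableT_comp (measurable_powR q) mN).
set A := \int[bmu]_(x in (Q : set Bn)) (N x `^ q)%:E.
have A0 : 0 <= A by apply: integral_ge0 => x _; rewrite lee_fin powR_ge0.
have hol : A <= (v `^ (1 - q / gamma))%R%:E * T `^ (q / gamma).
  have a1 : (1 <= gamma / q)%R by rewrite ler_pdivlMr// mul1r.
  have Nq0 (x : Bn) : (0 <= N x `^ q)%R by exact: powR_ge0.
  have := power_mean mQ mNq Nq0 (borel_mu_cube cQ) a1.
  under [X in _ <= _ * X -> _]eq_integral do rewrite -powRrM [(q * _)%R]mulrC divfK ?(gt_eqF q0)//.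
  rewrite -/A -/T -/v => H.
  have qg0 : (0 <= q / gamma)%R by rewrite divr_ge0 ?ltW.
  have := gt0_ler_poweR qg0 _ _ H.
  rewrite !in_itv/= !leey !andbT poweR_ge0 mule_ge0 ?lee_fin ?powR_ge0// => /(_ isT isT).
  rewrite -poweRrM poweRM ?lee_fin ?powR_ge0// poweR_EFin -powRrM.
  have -> : (gamma / q * (q / gamma) = 1)%R by field; rewrite !gt_eqF.
  rewrite poweRe1//.
  by have -> // : ((gamma / q - 1) * (q / gamma) = 1 - q / gamma)%R by field; rewrite !gt_eqF.
apply: (@le_trans _ _ (\sum_(j < m.+1) A)).
  apply: lee_sum => j _; rewrite /A [leRHS]integral_mkcond.
  apply: ge0_le_integral => //.
  - by move=> x _; rewrite lee_fin weighted_power_ge0.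
  - by apply/measurable_EFinP; exact: measurable_weighted_power.
  - apply: (measurable_restrictT _ _).1 => //; apply: measurable_funTS.
    exact/measurable_EFinP.
  move=> x _; rewrite patchE /weighted_power indicE; case: ifP => _; last by rewrite mul0r.
  by rewrite mul1r lee_fin ge0_ler_powR ?nnegrE// ltW.
have -> : \sum_(j < m.+1) A = m.+1%:R%:E * A by rewrite mule_natl sumr_const card_ord.
by rewrite EFinM -muleA; apply: lee_pmul.
Qed.

(** The power of l inside is l^(- n q / p), by the relation between the exponents;
    raised to p / q it cancels the factor l^n of the measure of the cube. *)
Lemma rescale_exponents (c C l alpha q p gamma : R) : (0 < c)%R -> (0 < l)%R ->
  (0 < p)%R -> (0 < q)%R -> (0 < gamma)%R ->
  (gamma^-1 = p^-1 + m.+1%:R^-1)%R -> (0 <= C)%R ->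
  let v := (c * l ^+ m.+1)%R in
  (v * ((v `^ (q * alpha / m.+1%:R - 1)) *
    (C * l `^ (q - q * alpha) * (m.+1%:R * v `^ (1 - q / gamma)))) `^ (p / q) =
   c * (C * m.+1%:R * c `^ (q * alpha / m.+1%:R - q / gamma)) `^ (p / q))%R.
Proof.
move=> c0 l0 p0 q0 g0 hg C0 v; set n : R := m.+1%:R.
have n0 : (0 < n)%R by rewrite ltr0n.
have vE : (v = c * l `^ n)%R by rewrite /v powR_mulrn// ltW.
have v0 : (0 < v)%R by rewrite vE mulr_gt0// powR_gt0.
have cond (r s : R) (u : R) : (0 < u)%R -> (r + s == 0)%R ==> (u != 0)%R.
  by move=> u0; rewrite (gt_eqF u0) implybT.
have -> : (v `^ (q * alpha / n - 1) * (C * l `^ (q - q * alpha) *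
    (n * v `^ (1 - q / gamma))) = C * n * c `^ (q * alpha / n - q / gamma) *
    l `^ (- (n * q / p)))%R.
  transitivity (C * n * (v `^ (q * alpha / n - 1) * v `^ (1 - q / gamma)) *
      l `^ (q - q * alpha))%R; first by ring.
  rewrite -powRD; last exact: cond.
  rewrite (_ : (q * alpha / n - 1 + (1 - q / gamma) = q * alpha / n - q / gamma)%R); last ring.
  rewrite vE powRM ?powR_ge0 ?(ltW c0)// -powRrM.
  have -> : (l `^ (- (n * q / p)) =
      l `^ (n * (q * alpha / n - q / gamma)) * l `^ (q - q * alpha))%R.
    rewrite -powRD; last exact: cond.
    by congr powR; rewrite hg; field; rewrite !gt_eqF.
  by ring.
rewrite powRM ?powR_ge0//; last first.
  by rewrite mulr_ge0 ?powR_ge0// mulr_ge0// ltW.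
rewrite -[in (l `^ _ `^ _)%R]powRrM (_ : (- (n * q / p) * (p / q) = - n)%R); last first.
  by field; rewrite !gt_eqF.
rewrite vE powRN -mulrA; congr (c * _)%R.
by rewrite mulrCA mulfV ?mulr1// gt_eqF// powR_gt0.
Qed.

(** The local estimate, followed by Hoelder's inequality from L^q to L^gamma; the
    constant depends neither on the size of the cube nor on the function. *)
Lemma cube_term_le (alpha p q gamma : R) : (alpha < 1)%R -> (1 <= p)%R ->
  (1 <= q)%R -> (q <= gamma)%R -> (gamma^-1 = p^-1 + m.+1%:R^-1)%R ->
  exists2 K : R, (0 <= K)%R &
  forall F (G : 'I_m.+1 -> V -> R) N, loc_integrable F ->
    (forall j, loc_integrable (G j)) -> (forall j, weak_partial j F (G j)) ->
    measurable_fun [set: Bn] (N : Bn -> R) -> (forall j x, `|G j x| <= N x)%R ->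
  forall l Q, is_cube l Q ->
  bmu Q * (bmu Q `^ (q * alpha / m.+1%:R - 1) *
    \int[bmu]_(x in (Q : set Bn)) \int[bmu]_(y in (Q : set Bn))
    (`|F x - F y| `^ q * (enorm (x - y) `^ (m.+1%:R + q * alpha))^-1)%R%:E)
      `^ (p / q) <=
  K%:E * (\int[bmu]_(x in (Q : set Bn)) (N x `^ gamma)%:E) `^ (p / gamma).
Proof.
move=> a1 p1 q1 qg hg; have [C C0 HC] := local_estimate (m := m) a1 q1.
have [p0 q0 g0] : [/\ 0 < p, 0 < q & 0 < gamma]%R by split; lra.
set c := @unit_mass R m.
exists (c * (C * m.+1%:R * c `^ (q * alpha / m.+1%:R - q / gamma)) `^ (p / q))%R.
  by rewrite mulr_ge0 ?unit_mass_ge0 ?powR_ge0.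
move=> F G N Floc Gloc FG mN GN l Q cQ.
have l0 : (0 < l)%R by case: cQ.
rewrite (borel_mu_cube cQ) -/c.
(* if the unit cube had measure 0, every term would vanish *)
have := unit_mass_ge0 (R := R) (m := m); rewrite -/c le_eqVlt => /predU1P[<-|c0].
  by rewrite !mul0r !mul0e.
set v := (c * l ^+ m.+1)%R; set I := \int[bmu]_(x in _) _.
have v0 : (0 <= v)%R by rewrite mulr_ge0 ?(ltW c0)// exprn_ge0// ltW.
set T := \int[bmu]_(x in (Q : set Bn)) (N x `^ gamma)%:E.
have T0 : 0 <= T by apply: integral_ge0 => x _; rewrite lee_fin powR_ge0.
have I0 : 0 <= I.
  apply: integral_ge0 => x _; apply: integral_ge0 => y _.
  by rewrite lee_fin mulr_ge0 ?invr_ge0 ?powR_ge0.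
have mG j : measurable_fun [set: Bn] (G j : Bn -> R) by have [] := Gloc j.
have IT : I <= (C * l `^ (q - q * alpha) * (m.+1%:R * v `^ (1 - q / gamma)))%R%:E *
    T `^ (q / gamma).
  apply: le_trans (HC _ _ Floc Gloc FG _ _ cQ) _.
  rewrite [in leRHS]EFinM -muleA; apply: lee_wpmul2l.
    by rewrite lee_fin mulr_ge0 ?powR_ge0.
  exact: weighted_power_le.
have pq0 : (0 <= p / q)%R by rewrite divr_ge0// ltW.
have D0 : (0 <= v `^ (q * alpha / m.+1%:R - 1) * (C * l `^ (q - q * alpha) *
    (m.+1%:R * v `^ (1 - q / gamma))))%R.
  by rewrite !mulr_ge0 ?powR_ge0.
apply: (@le_trans _ _ (v%:E * ((v `^ (q * alpha / m.+1%:R - 1) *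
    (C * l `^ (q - q * alpha) * (m.+1%:R * v `^ (1 - q / gamma))))%R%:E *
    T `^ (q / gamma)) `^ (p / q))).
  apply: lee_wpmul2l => //.
  apply: gt0_ler_poweR => //.
  - by rewrite in_itv/= leey andbT mule_ge0// lee_fin powR_ge0.
  - rewrite in_itv/= leey andbT; apply: mule_ge0; last exact: poweR_ge0.
    by rewrite lee_fin.
  rewrite poweR_EFin EFinM -muleA; apply: lee_wpmul2l => //.
  by rewrite lee_fin powR_ge0.
rewrite poweRM ?lee_fin ?poweR_ge0// poweR_EFin -poweRrM muleA -EFinM.
rewrite rescale_exponents// (_ : (q / gamma * (p / q) = p / gamma)%R)//.
by field; rewrite !gt_eqF.
Qed.

End cube_terms.

(** * From Lebesgue to Borel representatives *)

Section transfer.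
Local Open Scope ereal_scope.
Context {R : realType} {m : nat}.
Local Notation V := 'rV[R]_m.+1.
Local Notation Bn := (borel_rV R m).
Local Notation Ln := (lebesgue_rV R m).
Local Notation bmu := (@borel_mu R m).
Local Notation mu := (@lebesgue_measure_rV R m).
Local Notation e_ j := (delta_mx ord0 j : V).
Implicit Types (x y z : V) (F : V -> R) (f : V -> \bar R) (Q Z : set V).

Let lebesgue_sigma_finite : sigma_finite [set: Ln] mu.
Proof.
exists (fun k => cbox k : set Ln); first by rewrite bigcup_cbox.
move=> k; split; last exact: borel_mu_cbox.
by apply: borel_lebesgue; exact: measurable_cbox.
Qed.

HB.instance Definition _ := Measure_isSigmaFinite.Build _ _ _ mu
  lebesgue_sigma_finite.

Lemma measurable_borel_lebesgue d (T : measurableType d) (D : set V) (h : V -> T) :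
  measurable_fun [set: Bn] (h : Bn -> T) ->
  measurable_fun (D : set Ln) (h : Ln -> T).
Proof.
move=> mh; apply: measurable_funTS.
exact: (measurableT_comp mh (@measurable_id_borel R m)).
Qed.

Lemma ae_off_null Z (P : V -> Prop) : measurable (Z : set Bn) -> bmu Z = 0 ->
  (forall x, ~ Z x -> P x) -> {ae mu, forall x : Ln, P x}.
Proof.
move=> mZ Z0 ZP; exists Z; split => //; first exact: borel_lebesgue.
by move=> x /= nP; apply: contrapT => /ZP.
Qed.

Lemma locally_integrable_ae_fin f : locally_integrable_rV f ->
  {ae mu, forall x : Ln, `|f x| < +oo}.
Proof.
move=> [mf cf]; pose K (k : nat) : set V := closed_box (const_mx (- k%:R)%R) (const_mx k%:R%R).
have mK k : measurable (K k : set Ln).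
  by apply: borel_lebesgue; exact: measurable_closed_box.
have H k : {ae mu, forall x : Ln, (K k : set Ln) x -> f x \is a fin_num}.
  by apply: integrable_ae => //; apply: cf; exact: compact_closed_box.
have := ae_foralln H; apply: filterS => x fx.
have [k _ xk] : (\bigcup_k cbox k) x by rewrite bigcup_cbox.
rewrite -fin_num_abs; apply: (fx k) => i.
by have /andP[/ltW -> /ltW ->] := xk i.
Qed.

Lemma loc_integrable_modification f F Z : locally_integrable_rV f ->
  measurable_fun [set: Bn] (F : Bn -> R) -> measurable (Z : set Bn) ->
  bmu Z = 0 -> (forall x, ~ Z x -> f x = (F x)%:E) -> loc_integrable F.
Proof.
move=> [mf cf] mF mZ Z0 fF; split => // k.
have ck := @measurable_cbox R m k.
have mEF : measurable_fun [set: Bn] (EFin \o F : Bn -> \bar R).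
  exact/measurable_EFinP.
pose K : set V := closed_box (const_mx (- k%:R)%R) (const_mx k%:R%R).
have mK : measurable (K : set Ln) by apply: borel_lebesgue; exact: measurable_closed_box.
have iK : mu.-integrable (K : set Ln) (f : Ln -> \bar R).
  by apply: cf; exact: compact_closed_box.
have cK : cbox k `<=` K by move=> x xk i; have /andP[/ltW -> /ltW ->] := xk i.
have mck : measurable (cbox k : set Ln) by exact: borel_lebesgue.
have := integrableS mK mck cK iK.
move=> /integrableP[mfc foo]; apply/integrableP; split; first exact: measurable_funTS.
apply: le_lt_trans foo.
have mEFa : measurable_fun (cbox k : set Bn) (fun x : Bn => `|(EFin \o F) x|).
  by apply: measurable_funTS; exact: measurableT_comp.
rewrite le_eqVlt; apply/orP; left; apply/eqP.
transitivity (\int[mu]_(x in (cbox k : set Ln)) `|(EFin \o F) x|).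
  exact: (esym (integral_lebesgue_borel ck mEFa)).
apply: ge0_ae_eq_integral; first exact: mck.
- by apply: measurableT_comp => //; exact: (measurable_borel_lebesgue (h := EFin \o F)).
- exact: measurableT_comp.
- by move=> x _; exact: abse_ge0.
- by move=> x _; exact: abse_ge0.
- by apply: (ae_off_null mZ Z0) => x nZ _; rewrite fF.
Qed.

(** The bumps are test functions, and null sets do not affect the integrals. *)
Lemma weak_partial_modification f (g : V -> V) F G Zf Zg j :
  is_weak_gradient f g -> measurable_fun [set: Ln] (f : Ln -> \bar R) ->
  measurable_fun [set: Bn] (F : Bn -> R) -> measurable_fun [set: Bn] (G : Bn -> R) ->
  measurable (Zf : set Bn) -> bmu Zf = 0 -> (forall x, ~ Zf x -> f x = (F x)%:E) ->
  measurable (Zg : set Bn) -> bmu Zg = 0 -> (forall x, ~ Zg x -> g x ord0 j = G x) ->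
  weak_partial j F G.
Proof.
move=> [gloc fg] mf mF mG mZf Zf0 fF mZg Zg0 gG a b c c0.
have [mg _] := gloc j.
have tphi : test_function (bump a b c) by exact: test_function_tensor_bump.
have mD : measurable_fun [set: Bn] ('D_(e_ j) (bump a b c) : Bn -> R).
  apply: continuous_measurable_borel.
  have -> : 'D_(e_ j) (bump a b c) = tensor_bump a b c
      (deriv_poly a b c (fun=> 1%R) (fun=> 0%N) j) (deriv_exp (fun=> 0%N) j).
    by apply/funext => x; exact: derive_tensor_bump.
  exact: continuous_tensor_bump.
have mb : measurable_fun [set: Bn] (bump a b c : Bn -> R) by exact: measurable_bump.
have := fg j _ tphi.
have mFD : measurable_fun [set: Bn]
    ((fun x => (F x * 'D_(e_ j) (bump a b c) x)%:E) : Bn -> \bar R).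
  by apply/measurable_EFinP; exact: measurable_funM.
have mGb : measurable_fun [set: Bn] ((fun x => (G x * bump a b c x)%:E) : Bn -> \bar R).
  by apply/measurable_EFinP; exact: measurable_funM.
have -> : \int[mu]_(x in [set: Ln]) (f x * ('D_(e_ j) (bump a b c) x)%:E) =
    \int[bmu]_(x in [set: Bn]) (F x * 'D_(e_ j) (bump a b c) x)%:E.
  transitivity (\int[mu]_(x in [set: Ln]) (F x * 'D_(e_ j) (bump a b c) x)%:E);
    last exact: (integral_lebesgue_borel measurableT mFD).
  have mDl := measurable_borel_lebesgue (D := setT) mD.
  apply: ae_eq_integral; first exact: measurableT.
  - by apply: emeasurable_funM; [exact: mf|exact/measurable_EFinP].
  - exact: measurable_borel_lebesgue mFD.
  - by apply: (ae_off_null mZf Zf0) => x nZ _; rewrite fF.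
have -> // : \int[mu]_(x in [set: Ln]) (g x ord0 j * bump a b c x)%:E =
    \int[bmu]_(x in [set: Bn]) (G x * bump a b c x)%:E.
transitivity (\int[mu]_(x in [set: Ln]) (G x * bump a b c x)%:E);
  last exact: (integral_lebesgue_borel measurableT mGb).
apply: ae_eq_integral; first exact: measurableT.
- apply/measurable_EFinP; apply: measurable_funM; first exact/measurable_EFinP.
  exact: measurable_borel_lebesgue.
- exact: measurable_borel_lebesgue mGb.
- by apply: (ae_off_null mZg Zg0) => x nZ _; rewrite gG.
Qed.

End transfer.

Section transfer_JNQ.
Local Open Scope ereal_scope.
Context {R : realType} {m : nat}.
Local Notation V := 'rV[R]_m.+1.
Local Notation Bn := (borel_rV R m).
Local Notation Ln := (lebesgue_rV R m).
Local Notation bmu := (@borel_mu R m).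
Local Notation mu := (@lebesgue_measure_rV R m).
Implicit Types (x y z : V) (F : V -> R) (f : V -> \bar R) (Q Z : set V).

(** For x off Z the inner integrals agree, the integrands being equal for y off
    Z; hence the outer ones agree too. *)
Lemma JNQ_local_borel (alpha q : R) f F Q Z :
  measurable_fun [set: Ln] (f : Ln -> \bar R) ->
  measurable_fun [set: Bn] (F : Bn -> R) ->
  measurable (Z : set Bn) -> bmu Z = 0 -> (forall x, ~ Z x -> f x = (F x)%:E) ->
  measurable (Q : set Bn) ->
  JNQ_local alpha q f Q = bmu Q `^ (q * alpha / m.+1%:R - 1) *
    \int[bmu]_(x in (Q : set Bn)) \int[bmu]_(y in (Q : set Bn))
    (`|F x - F y| `^ q * (enorm (x - y) `^ (m.+1%:R + q * alpha))^-1)%R%:E.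
Proof.
move=> mf mF mZ Z0 fF mQ.
set kappa := (m.+1%:R + q * alpha)%R.
pose k (z : V) : R := (enorm z `^ kappa)^-1%R.
have k0 z : (0 <= k z)%R by rewrite invr_ge0 powR_ge0.
have mk : measurable_fun [set: Bn] (k : Bn -> R).
  rewrite /k; under eq_fun do rewrite -powRN.
  exact: (measurableT_comp (measurable_powR (- kappa)) (@measurable_enorm R m)).
have mQl : measurable (Q : set Ln) by exact: borel_lebesgue.
pose Hf (p : Ln * Ln) : \bar R := `|f p.1 - f p.2| `^ q * (k (p.1 - p.2)%R)%:E.
pose HF (p : Bn * Bn) : \bar R := (`|F p.1 - F p.2| `^ q * k (p.1 - p.2))%R%:E.
have Hf0 p : 0 <= Hf p by rewrite mule_ge0 ?poweR_ge0// lee_fin.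
have HF0 p : 0 <= HF p by rewrite lee_fin mulr_ge0// powR_ge0.
have HfF x y : ~ Z x -> ~ Z y -> Hf (x, y) = HF (x, y).
  by move=> nx ny; rewrite /Hf /HF /= !fF.
have mHf : measurable_fun [set: Ln * Ln] Hf.
  apply: emeasurable_funM.
    apply: (measurableT_comp (measurable_poweR q)).
    apply: (measurableT_comp (@abse_measurable R setT)).
    apply: emeasurable_funB.
      exact: (measurableT_comp mf measurable_fst).
    exact: (measurableT_comp mf measurable_snd).
  apply/measurable_EFinP.
  apply: (measurableT_comp mk); apply: measurable_fun_rV => i.
  under eq_fun do rewrite !mxE.
  apply: measurable_funB.
    exact: (measurableT_comp (@measurable_coord_lebesgue R m i) measurable_fst).
  exact: (measurableT_comp (@measurable_coord_lebesgue R m i) measurable_snd).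
have mHF : measurable_fun [set: Bn * Bn] HF.
  apply/measurable_EFinP; apply: measurable_funM.
    apply: (measurableT_comp (measurable_powR q)).
    apply: (measurableT_comp (@normr_measurable R setT)).
    apply: measurable_funB.
      exact: (measurableT_comp mF measurable_fst).
    exact: (measurableT_comp mF measurable_snd).
  apply: (measurableT_comp mk); apply: measurable_fun_rV => i.
  under eq_fun do rewrite !mxE.
  apply: measurable_funB.
    exact: (measurableT_comp (@measurable_coord_borel R m i) measurable_fst).
  exact: (measurableT_comp (@measurable_coord_borel R m i) measurable_snd).
pose If (x : Ln) := \int[mu]_(y in (Q : set Ln)) Hf (x, y).
pose IF (x : Bn) := \int[bmu]_(y in (Q : set Bn)) HF (x, y).
have mIf : measurable_fun [set: Ln] If.
  pose K (p : Ln * Ln) : \bar R := Hf p * (\1_Q p.2)%:E.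
  have K0 p : 0 <= K p by rewrite mule_ge0// lee_fin.
  have mK : measurable_fun [set: Ln * Ln] K.
    apply: emeasurable_funM => //; apply/measurable_EFinP.
    by apply: measurableT_comp; [exact: measurable_indic|exact: measurable_snd].
  have -> : If = fun x => \int[mu]_y K (x, y).
    apply/funext => x; rewrite /If integral_mkcond; apply: eq_integral => y _.
    by rewrite patchE /K indicE /=; case: ifP; rewrite ?mule1 ?mule0.
  exact: (@measurable_fun_fubini_tonelli_F _ _ _ _ _ mu _ mK K0).
have mIF : measurable_fun [set: Bn] IF.
  pose K (p : Bn * Bn) : \bar R := HF p * (\1_Q p.2)%:E.
  have K0 p : 0 <= K p by rewrite mule_ge0// lee_fin.
  have mK : measurable_fun [set: Bn * Bn] K.
    apply: emeasurable_funM => //; apply/measurable_EFinP.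
    by apply: measurableT_comp; [exact: measurable_indic|exact: measurable_snd].
  have -> : IF = fun x => \int[bmu]_y K (x, y).
    apply/funext => x; rewrite /IF integral_mkcond; apply: eq_integral => y _.
    by rewrite patchE /K indicE /=; case: ifP; rewrite ?mule1 ?mule0.
  exact: (@measurable_fun_fubini_tonelli_F _ _ _ _ _ bmu _ mK K0).
have IfF x : ~ Z x -> If x = IF x.
  move=> nx; rewrite /If /IF.
  have mHFx : measurable_fun [set: Bn] (fun y : Bn => HF ((x : Bn), y)).
    exact: measurable_fun_pair2.
  transitivity (\int[mu]_(y in (Q : set Ln)) HF (x, y)); last first.
    exact: (integral_lebesgue_borel mQ (measurable_funTS mHFx)).
  apply: ge0_ae_eq_integral; first exact: mQl.
  - by apply: measurable_funTS; exact: (measurable_fun_pair2 (x : Ln) mHf).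
  - exact: measurable_borel_lebesgue mHFx.
  - by move=> y _; exact: Hf0.
  - by move=> y _; exact: HF0.
  - by apply: (ae_off_null mZ Z0) => y ny _; exact: HfF.
rewrite /JNQ_local -/kappa.
have -> : \int[mu]_(x in (Q : set Ln)) \int[mu]_(y in (Q : set Ln))
    (`|f x - f y| `^ q * ((enorm (x - y) `^ kappa)^-1)%R%:E) =
    \int[bmu]_(x in (Q : set Bn)) IF x; last by [].
transitivity (\int[mu]_(x in (Q : set Ln)) IF x); last first.
  exact: (integral_lebesgue_borel mQ (measurable_funTS mIF)).
apply: (@ge0_ae_eq_integral _ _ _ mu (Q : set Ln) If IF); first exact: mQl.
- exact: measurable_funTS.
- exact: measurable_borel_lebesgue mIF.
- by move=> x _; apply: integral_ge0 => y _; exact: Hf0.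
- by move=> x _; apply: integral_ge0 => y _; exact: HF0.
- by apply: (ae_off_null mZ Z0) => x nx _; exact: IfF.
Qed.

End transfer_JNQ.

(** * Sums over cubes with disjoint interiors *)

Section disjoint_cubes.
Local Open Scope ereal_scope.
Context {R : realType} {m : nat}.
Local Notation V := 'rV[R]_m.+1.
Local Notation Bn := (borel_rV R m).
Local Notation bmu := (@borel_mu R m).
Implicit Types (f : V -> \bar R) (P D Q : set V).

Lemma open_box_interior (a b : V) Q : open_box a b `<=` Q -> open_box a b `<=` Q°.
Proof.
move=> abQ x xab.
exists (fun _ j => `]a ord0 j, b ord0 j[%classic) => [i j|y yab].
  apply: open_nbhs_nbhs; split; first exact: itv_open.
  by rewrite (ord1 i) /= in_itv/=; exact: xab.
by apply: abQ => j; have := yab ord0 j; rewrite /= in_itv.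
Qed.

(** Distinct cubes may share points of their faces; replacing each cube by its
    interior changes no integral and makes the family disjoint. *)
Lemma cube_collection_integral_le f l (P D : set (set V)) :
  measurable_fun [set: Bn] (f : Bn -> \bar R) -> (forall x, 0 <= f x) ->
  cube_collection l P -> finite_set D -> D `<=` P ->
  \sum_(Q \in D) \int[bmu]_(x in (Q : set Bn)) f x <=
  \int[bmu]_(x in [set: Bn]) f x.
Proof.
move=> mf f0 [cP disj] fD DP.
have mI Q : measurable (Q° : set Bn).
  by apply: open_measurable_borel; exact: open_interior.
have E Q : D Q -> \int[bmu]_(x in (Q : set Bn)) f x = density mf f0 (Q° : set Bn).
  move=> DQ; have cQ := cP _ (DP _ DQ); have mQ := measurable_cube cQ.
  have [a [aQ _]] := cube_sandwich cQ.
  have null : bmu (Q `\` Q°) = 0.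
    apply/eqP; rewrite eq_le measure_ge0 andbT -(borel_mu_cubeD cQ aQ).
    apply: (@le_outer_measure _ _ (@lebesgue_outer R m)); apply: setDS.
    exact: open_box_interior.
  have mN : measurable (Q `\` Q° : set Bn) by exact: (@measurableD _ Bn).
  rewrite (@ge0_negligible_integral _ _ _ bmu (Q : set Bn) (Q `\` Q° : set Bn))//.
    by rewrite setDD setIidr//; exact: interior_subset.
  exact: measurable_funTS.
rewrite (eq_fsbigr (fun Q => density mf f0 (Q° : set Bn))); last first.
  by move=> Q /set_mem; exact: E.
rewrite -(@measure_fin_bigcup _ _ _ (density mf f0) _ D (fun Q => Q° : set Bn))//.
  by apply: le_measure => //; rewrite inE//; apply: fin_bigcup_measurable.
apply/trivIsetP => Q Q' DQ DQ' /eqP QQ'.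
by apply: disj => //; exact: DP.
Qed.

(** For e at least 1, u ^ e is at most u t ^ (e - 1) when u is at most t. *)
Lemma sum_poweR_le (I : choiceType) (D : set I) (u : I -> \bar R) (t e : R) :
  finite_set D -> (forall i, 0 <= u i) -> (1 <= e)%R -> (0 <= t)%R ->
  \sum_(i \in D) u i <= t%:E -> \sum_(i \in D) u i `^ e <= (t `^ e)%R%:E.
Proof.
move=> fD u0 e1 t0 ut.
have e0 : (0 < e)%R by exact: lt_le_trans e1.
have ui i : D i -> u i <= t%:E.
  move=> Di; apply: le_trans ut.
  have -> : u i = \sum_(j \in [set i]) u j by rewrite fsbig_set1.
  apply: lee_fsum_nneg_subset => //.
  by move=> j; rewrite !inE => ->.
apply: (@le_trans _ _ (\sum_(i \in D) (u i * (t `^ (e - 1))%R%:E))).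
  apply: lee_fsum => // i /ui.
  have := u0 i; case: (u i) => [r| |]//; rewrite !lee_fin => r0 rt.
  rewrite ?poweR_EFin -?EFinM ?lee_fin.
  have [->|rn0] := eqVneq r 0%R; first by rewrite powR0 ?mul0r// gt_eqF.
  have -> : (r `^ e = r * r `^ (e - 1))%R.
    rewrite -{2}(powRr1 r0) -powRD; last by rewrite rn0 implybT.
    by rewrite addrC subrK.
  by rewrite ler_wpM2l// ge0_ler_powR ?nnegrE// subr_ge0.
rewrite -ge0_mule_fsuml//.
apply: (@le_trans _ _ (t%:E * (t `^ (e - 1))%R%:E)).
  by rewrite lee_wpmul2r// lee_fin powR_ge0.
rewrite -EFinM lee_fin.
have [->|tn0] := eqVneq t 0%R; first by rewrite mul0r powR_ge0.
rewrite -{1}(powRr1 t0) -powRD; last by rewrite tn0 implybT.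
by rewrite addrC subrK.
Qed.

End disjoint_cubes.

(** * The embedding *)

Section sobolev_JNQ.
Local Open Scope ereal_scope.
Context {R : realType} {m : nat}.
Local Notation V := 'rV[R]_m.+1.
Local Notation Bn := (borel_rV R m).
Local Notation Ln := (lebesgue_rV R m).
Local Notation bmu := (@borel_mu R m).
Local Notation mu := (@lebesgue_measure_rV R m).
Implicit Types (f : V -> \bar R) (F : V -> R).

Lemma weak_gradientP f : weakly_differentiable f ->
  is_weak_gradient f (weak_gradient f).
Proof. by move=> [_ fg]; exact: (xgetPex (fun=> 0%R) fg). Qed.

(** The components of the weak gradient are modified one by one, and the finitely
    many null sets collected. *)
Lemma borel_representative f (gamma : R) : weakly_differentiable f ->
  exists F (Z : set V) (G : 'I_m.+1 -> V -> R),
  [/\ [/\ measurable_fun [set: Bn] (F : Bn -> R), measurable (Z : set Bn),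
        bmu Z = 0 & forall x, ~ Z x -> f x = (F x)%:E],
      loc_integrable F, forall j, loc_integrable (G j),
      forall j, weak_partial j F (G j) &
      \int[mu]_(x in [set: Ln]) (enorm (weak_gradient f x) `^ gamma)%R%:E =
      \int[bmu]_(x in [set: Bn]) (enorm (\row_j G j x) `^ gamma)%R%:E].
Proof.
move=> wf; have [floc _] := wf; have fg := weak_gradientP wf.
set g := weak_gradient f in fg *.
have [gloc _] := fg; have [mf _] := floc.
have [F [Z [mF mZ Z0 fF]]] := borel_modification mf (locally_integrable_ae_fin floc).
have H (j : 'I_m.+1) : exists GW : (V -> R) * set V,
    [/\ measurable_fun [set: Bn] (GW.1 : Bn -> R), measurable (GW.2 : set Bn),
      bmu GW.2 = 0 & forall x, ~ GW.2 x -> (g x ord0 j)%:E = (GW.1 x)%:E].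
  have [mg _] := gloc j.
  have [G [W HGW]] := borel_modification mg (locally_integrable_ae_fin (gloc j)).
  by exists (G, W).
have [GW HGW] := choice H.
pose G j := (GW j).1; pose W := \bigcup_j (GW j).2.
have mG j : measurable_fun [set: Bn] (G j : Bn -> R) by have [] := HGW j.
have gG j x : ~ (GW j).2 x -> g x ord0 j = G j x.
  by have [_ _ _ + nW] := HGW j; move=> /(_ _ nW)[].
have mW : measurable (W : set Bn).
  by apply: (@fin_bigcup_measurable _ Bn) => // j _; have [] := HGW j.
have W0 : bmu W = 0 by apply: outer_bigcup0 => j; have [] := HGW j.
exists F, Z, G; split.
- by split.
- exact: loc_integrable_modification fF.
- move=> j; have [_ mWj Wj0 GE] := HGW j.
  exact: (loc_integrable_modification (gloc j) (mG j) mWj Wj0 GE).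
- move=> j; have [_ mWj Wj0 _] := HGW j.
  exact: (weak_partial_modification fg mf mF (mG j) mZ Z0 fF mWj Wj0 (gG j)).
- have mN : measurable_fun [set: Bn]
      ((fun x => (enorm (\row_j G j x) `^ gamma)%R%:E) : Bn -> \bar R).
    apply/measurable_EFinP; apply: (measurableT_comp (measurable_powR gamma)).
    apply: (measurableT_comp (@measurable_enorm R m)).
    apply: measurable_fun_rV => j; under eq_fun do rewrite mxE.
    exact: mG.
  transitivity (\int[mu]_(x in [set: Ln]) (enorm (\row_j G j x) `^ gamma)%R%:E);
    last exact: (integral_lebesgue_borel measurableT mN).
  apply: ge0_ae_eq_integral; first exact: measurableT.
  + apply/measurable_EFinP; apply: (measurableT_comp (measurable_powR gamma)).
    apply: (measurableT_comp (@measurable_enorm R m)).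
    apply: measurable_fun_rV => j.
    by have [/measurable_EFinP] := gloc j.
  + exact: measurable_borel_lebesgue mN.
  + by move=> x _; rewrite lee_fin powR_ge0.
  + by move=> x _; rewrite lee_fin powR_ge0.
  + apply: (ae_off_null mW W0) => x nW _; congr ((enorm _ `^ _)%R%:E).
    apply/rowP => j; rewrite mxE; apply: gG => Wx; apply: nW; by exists j.
Qed.

(** Here p / gamma is at least 1, so that the bounds on the terms of disjoint
    cubes add up. *)
Lemma JNQ_norm_le (alpha p q gamma : R) : (alpha < 1)%R -> (1 <= p)%R ->
  (1 <= q)%R -> (q <= gamma)%R -> (gamma^-1 = p^-1 + m.+1%:R^-1)%R ->
  exists2 C : R, (0 < C)%R & forall f, dotW1 m gamma f ->
    JNQ_norm alpha p q f <= C%:E * dotW1_norm gamma f.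
Proof.
move=> a1 p1 q1 qg hg.
have [K K0 HK] := cube_term_le a1 p1 q1 qg hg.
have [p0 q0 g0] : [/\ 0 < p, 0 < q & 0 < gamma]%R by split; lra.
have e1 : (1 <= p / gamma)%R.
  by rewrite hg mulrDr divff ?gt_eqF// lerDl divr_ge0// ltW.
(* K may be 0, whereas the constant has to be positive *)
exists (K `^ p^-1 + 1)%R; first by rewrite ltr_wpDl ?powR_ge0.
move=> f [wf fin]; have [F [Z [G [[mF mZ Z0 fF] Floc Gloc FG NE]]]] :=
  borel_representative gamma wf.
have mf : measurable_fun [set: Ln] (f : Ln -> \bar R) by case: wf => -[].
pose N x := enorm (\row_j G j x).
have mN : measurable_fun [set: Bn] (N : Bn -> R).
  apply: (measurableT_comp (@measurable_enorm R m)).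
  apply: measurable_fun_rV => j; under eq_fun do rewrite mxE.
  by have [] := Gloc j.
have GN j x : (`|G j x| <= N x)%R.
  by have := norm_coord_le_enorm (\row_j G j x) j; rewrite mxE.
pose u (x : V) : \bar R := (N x `^ gamma)%R%:E.
have u0 x : 0 <= u x by rewrite lee_fin powR_ge0.
have mu_ : measurable_fun [set: Bn] (u : Bn -> \bar R).
  by apply/measurable_EFinP; apply: (measurableT_comp (measurable_powR gamma)).
move: fin; rewrite /dotW1_norm NE -/N -/u.
set T := \int[bmu]_(x in _) _ => fin.
have T0 : 0 <= T by apply: integral_ge0 => x _; exact: u0.
have fT : T \is a fin_num.
  by rewrite ge0_fin_numE//; apply: (lty_poweRy _ fin); rewrite invr_eq0 gt_eqF.
set t := fine T; have Tt : T = t%:E by rewrite fineK.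
have t0 : (0 <= t)%R by rewrite -lee_fin -Tt.
rewrite Tt poweR_EFin -EFinM.
apply: ge_ereal_sup => _ [l [P [l0 cP ->]]].
have cQ Q : P Q -> is_cube l Q by case: cP => + _; exact.
have S : \esum_(Q in P) (mu Q * JNQ_local alpha q f Q `^ (p / q)) <=
    (K * t `^ (p / gamma))%R%:E.
  apply: ge_ereal_sup => _ [D [fD DP] <-].
  pose I (Q : set V) := \int[bmu]_(x in (Q : set Bn)) u x.
  apply: (@le_trans _ _ (\sum_(Q \in D) (K%:E * I Q `^ (p / gamma)))).
    apply: lee_fsum => // Q /DP /cQ cubeQ.
    rewrite (JNQ_local_borel alpha q mf mF mZ Z0 fF (measurable_cube cubeQ)).
    exact: HK cubeQ.
  rewrite -ge0_mule_fsumr; last by move=> Q; exact: poweR_ge0.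
  rewrite EFinM; apply: lee_wpmul2l; first by rewrite lee_fin.
  apply: sum_poweR_le => //.
    by move=> Q; exact: integral_ge0.
  rewrite -Tt; exact: (cube_collection_integral_le mu_ u0 cP fD DP).
apply: (@le_trans _ _ ((K * t `^ (p / gamma))%R%:E `^ p^-1)).
  apply: gt0_ler_poweR => //; first by rewrite invr_ge0 ltW.
  - rewrite in_itv/= leey andbT; apply: esum_ge0 => Q _.
    by rewrite mule_ge0 ?poweR_ge0// outer_measure_ge0.
  - by rewrite in_itv/= leey andbT lee_fin mulr_ge0// powR_ge0.
rewrite poweR_EFin lee_fin powRM ?powR_ge0// -powRrM.
have -> : (p / gamma * p^-1 = gamma^-1)%R by rewrite mulrAC divff ?gt_eqF// mul1r.
by rewrite ler_wpM2r ?powR_ge0// lerDl.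
Qed.

End sobolev_JNQ.

Theorem proposition2p16 (R : realType) (m : nat) (alpha p q gamma : R)
  (halpha : alpha < 1) (hp : 1 <= p) (hq : 1 <= q) (hgamma : q <= gamma)
  (hpn : gamma^-1 = p^-1 + (m.+1%:R)^-1) :
  dotW1 m gamma `<=` JNQ m alpha p q /\
  exists C : R, 0 < C /\
    forall f, dotW1 m gamma f ->
      (JNQ_norm alpha p q f <= C%:E * dotW1_norm gamma f)%E.
Proof.
have [C C0 HC] := JNQ_norm_le halpha hp hq hgamma hpn.
split; last by exists C.
move=> f Wf; have [[floc _] fin] := Wf; split.
  by split; [case: floc|exact: locally_integrable_ae_fin].
by apply: le_lt_trans (HC _ Wf) _; rewrite lte_mul_pinfty// lee_fin ltW.
Qed.
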